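(* Let $n\ge 1$ and let $h:[0,\infty)\to[0,\infty)$ be a continuous function with $\int_0^\infty r^{2m+2n-1}e^{-2h(r)}\,dr<\infty$ for every $m\in\mathbb{N}_0$. Then the $C^*$-algebra $\mathcal{T}(\mathcal{A}_h(\mathbb{C}^n))^{\mathrm{U}(n)}$ generated by all Toeplitz operators $T_\varphi$ on $\mathcal{A}_h(\mathbb{C}^n)$ with $\mathrm{U}(n)$-invariant symbols $\varphi\in L^\infty(\mathbb{C}^n)$ is commutative.
   Context: $\mathbb{N}_0=\{0,1,2,\dots\}$. Put $h(z):=h(|z|)$ for $z\in\mathbb{C}^n$. $L^2_h(\mathbb{C}^n)$ is the Hilbert space of (classes of) Lebesgue measurable functions $f$ on $\mathbb{C}^n$ with $\|f\|_h^2=\int_{\mathbb{C}^n}|f(z)|^2e^{-2h(z)}\,dz<\infty$, where $dz$ is Lebesgue measure, with the corresponding inner product $\langle\cdot,\cdot\rangle_h$. The radially weighted Fock space $\mathcal{A}_h(\mathbb{C}^n)$ is the closed subspace of entire functions in $L^2_h(\mathbb{C}^n)$, and $P:L^2_h(\mathbb{C}^n)\to\mathcal{A}_h(\mathbb{C}^n)$ is the orthogonal projection. For $\varphi\in L^\infty(\mathbb{C}^n)$ the Toeplitz operator $T_\varphi$ on $\mathcal{A}_h(\mathbb{C}^n)$ is $T_\varphi f=P(\varphi f)$. A group $G\subseteq\mathrm{U}(n)$ acts on $L^\infty(\mathbb{C}^n)$ by $(g.\varphi)(z)=\varphi(g^{-1}z)$; $\varphi$ is $G$-invariant if $g.\varphi=\varphi$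 (as elements of $L^\infty(\mathbb{C}^n)$) for all $g\in G$. *)

(* Defs.v *)
From HB Require Import structures.
From mathcomp Require Import all_boot all_order all_algebra.
From mathcomp Require Import complex ring lra.
From mathcomp Require Import all_classical all_reals all_analysis.
From mathcomp Require Import measurable_realfun.

Set Implicit Arguments.
Unset Strict Implicit.
Unset Printing Implicit Defensive.

Import Order.TTheory GRing.Theory Num.Theory numFieldNormedType.Exports.

Local Open Scope classical_set_scope.
Local Open Scope ring_scope.

Local Notation pushforward_measure :=
  measure_function_pushforward__canonical__measure_function_Measure.

Lemma product_sigma_finite d1 d2 (T1 : measurableType d1)
    (T2 : measurableType d2) (R : realType)
    (m1 : {sigma_finite_measure set T1 -> \bar R})
    (m2 : {sigma_finite_measure set T2 -> \bar R}) :
  sigma_finite setT (m1 \x m2)%E.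
Proof.
have /sigma_finiteP[F [TF ndF Foo]] := sigma_finiteT m1.
have /sigma_finiteP[G [TG ndG Goo]] := sigma_finiteT m2.
exists (fun n => F n `*` G n).
  rewrite -setXTT TF TG predeqE => -[x y]; split.
    move=> [/= [n _ Fnx] [k _ Gky]]; exists (maxn n k) => //; split.
      by move: x Fnx; exact/subsetPset/ndF/leq_maxl.
    by move: y Gky; exact/subsetPset/ndG/leq_maxr.
  by move=> [n _ []/= ? ?]; split; exists n.
move=> k; have [? ?] := Foo k; have [? ?] := Goo k.
split; first exact: measurableX.
by rewrite product_measure1E// lte_mul_pinfty// ge0_fin_numE.
Qed.

Section product_power.
Context d (T : measurableType d) (R : realType).
Variable m : {sigma_finite_measure set T -> \bar R}.

Definition tuple_cons n (p : T * n.-tuple T) : n.+1.-tuple T :=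
  [tuple of p.1 :: p.2].

Lemma measurable_tuple_cons n : measurable_fun setT (@tuple_cons n).
Proof. exact: (measurable_cons measurable_fst measurable_snd). Qed.

Section step.
Variables (n : nat) (mu : {sigma_finite_measure set (n.-tuple T) -> \bar R}).

Definition power_step : set (n.+1.-tuple T) -> \bar R :=
  pushforward (m \x mu)%E (@tuple_cons n).

Let power_step0 : power_step set0 = 0%E.
Proof. by rewrite /power_step /pushforward preimage_set0 measure0. Qed.

Let power_step_ge0 A : (0 <= power_step A)%E.
Proof. exact: (measure_ge0 (m \x mu)%E). Qed.

Let power_step_sigma_additive : semi_sigma_additive power_step.
Proof.
exact: (@measure_semi_sigma_additive _ _ _
  (pushforward_measure (m \x mu)%E (@measurable_tuple_cons n))).
Qed.

HB.instance Definition _ := isMeasure.Build _ _ _ power_step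
  power_step0 power_step_ge0 power_step_sigma_additive.

Let power_step_sigma_finite : sigma_finite setT power_step.
Proof.
have [F TF Foo] := product_sigma_finite m mu.
pose u (t : n.+1.-tuple T) := (thead t, [tuple of behead t]).
have mu_ : measurable_fun setT u.
  apply: measurable_fun_pair; first exact: measurable_tnth.
  exact: measurable_behead.
have uK p : u (tuple_cons p) = p.
  case: p => x t; congr pair; rewrite /thead ?tnth0//.
  by apply: val_inj.
exists (fun k => u @^-1` F k).
  by rewrite -preimage_bigcup -TF preimage_setT.
move=> k; have [mF Fk] := Foo k; split.
  by rewrite -[X in measurable X]setTI; exact: mu_.
rewrite /power_step /pushforward [X in (_ \x _)%E X](_ : _ = F k)//.
by apply/seteqP; split=> p /=; rewrite uK.
Qed.

HB.instance Definition _ := Measure_isSigmaFinite.Build _ _ _ power_step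
  power_step_sigma_finite.

End step.

Fixpoint product_power n : {sigma_finite_measure set (n.-tuple T) -> \bar R} :=
  match n with
  | 0 => \d_[tuple]
  | k.+1 => power_step (product_power k)
  end.

End product_power.

Section complex_space.
Context (R : realType).
Local Open Scope complex_scope.
Local Notation C := R[i].

Definition plane_measure :
    set (measurableTypeR R * measurableTypeR R) -> \bar R :=
  (lebesgue_measure \x lebesgue_measure)%E.

HB.instance Definition _ := Measure.on plane_measure.

HB.instance Definition _ := Measure_isSigmaFinite.Build _ _ _ plane_measure
  (product_sigma_finite lebesgue_measure lebesgue_measure).

Variable n : nat.

(* R^(2n), as n pairs of reals, with the sigma-algebra of Lebesgue measurable
   sets: the Caratheodory sigma-algebra of Lebesgue outer measure. *)
Definition real_space : Type :=
  caratheodory_type (product_power plane_measure n)^*%mu.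

HB.instance Definition _ := Measurable.on real_space.

Definition lebesgue : {measure set real_space -> \bar R} :=
  @completed_measure_extension _
    (n.-tuple (measurableTypeR R * measurableTypeR R)) R (product_power plane_measure n).

Definition point_of (t : real_space) : 'cV[C]_n :=
  \col_i ((tnth t i).1 +i* (tnth t i).2).

Definition lebesgue_measurable (f : 'cV[C]_n -> C) : Prop :=
  measurable_fun setT (fun t => complex.Re (f (point_of t))) /\
  measurable_fun setT (fun t => complex.Im (f (point_of t))).

Definition integralC (f : 'cV[C]_n -> C) : C :=
  (\int[lebesgue]_t complex.Re (f (point_of t))) +i*
  (\int[lebesgue]_t complex.Im (f (point_of t))).

Definition eucl_norm (z : 'cV[C]_n) : R :=
  Num.sqrt (\sum_i Normc.normc (z i ord0) ^+ 2).
End complex_space.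

(* Only the values of weight_fun on [0, +oo[ matter. *)
Record radial_weight (R : realType) := RadialWeight {
  weight_fun :> R -> R ;
  weight_continuous : {within `[0, +oo[, continuous weight_fun} ;
  weight_ge0 : forall r, 0 <= r -> 0 <= weight_fun r }.

Section fock_space.
Context (R : realType) (n : nat) (h : radial_weight R).
Local Open Scope complex_scope.
Local Notation C := R[i].
Local Notation E := 'cV[C]_n.

Definition weight (z : E) : R := expR (- 2 * h (eucl_norm z)).

Definition sq_norm (f : E -> C) : \bar R :=
  (\int[@lebesgue R n]_t
     (Normc.normc (f (point_of t)) ^+ 2 * weight (point_of t))%:E)%E.

Definition inner (f g : E -> C) : C :=
  integralC (fun z => f z * (g z)^* * (weight z)%:C).

(* Representatives, not classes modulo a.e. equality. *)
Definition L2 : set (E -> C) :=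
  [set f | lebesgue_measurable f /\ (sq_norm f < +oo)%E].

Definition L2norm (f : E -> C) : R := Num.sqrt (fine (sq_norm f)).

Definition entire (f : E -> C) : Prop := forall z, differentiable (f : E -> C^o) z.

(* The weight is positive and entire functions are continuous, so each class
   contains at most one entire function: no quotient is needed here. *)
Definition fock_pred : {pred E -> C} := mem [set f | entire f /\ L2 f].

Local Notation mR := (measurableTypeR R).

Lemma borel_measurable d' (T' : measurableType d') (F : n.-tuple (mR * mR) -> T') :
  measurable_fun setT F -> measurable_fun setT (F : real_space R n -> T').
Proof.
move=> mF _ Y mY; rewrite setTI.
apply: caratheodory_measurable_mu_ext.
by rewrite -[X in measurable X]setTI; exact: mF.
Qed.

Lemma measurable_coord1 i :
  measurable_fun setT (fun t : real_space R n => (tnth t i).1).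
Proof.
apply: (@borel_measurable _ _ (fun t => (tnth t i).1)).
exact: (measurableT_comp measurable_fst (measurable_tnth i)).
Qed.

Lemma measurable_coord2 i :
  measurable_fun setT (fun t : real_space R n => (tnth t i).2).
Proof.
apply: (@borel_measurable _ _ (fun t => (tnth t i).2)).
exact: (measurableT_comp measurable_snd (measurable_tnth i)).
Qed.

Lemma normc_sqr (c : C) :
  Normc.normc c ^+ 2 = complex.Re c ^+ 2 + complex.Im c ^+ 2.
Proof. by case: c => a b /=; rewrite sqr_sqrtr// addr_ge0// sqr_ge0. Qed.

Lemma measurable_weight :
  measurable_fun setT (fun t : real_space R n => weight (point_of t)).
Proof.
have mnorm :
    measurable_fun setT (fun t : real_space R n => eucl_norm (point_of t)).
  rewrite (_ : (fun t => _) = fun t : real_space R n =>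
      Num.sqrt (\sum_i ((tnth t i).1 ^+ 2 + (tnth t i).2 ^+ 2))); last first.
    apply/funext => t; congr Num.sqrt; apply: eq_bigr => i _.
    by rewrite normc_sqr mxE.
  apply: measurableT_comp.
    by apply: continuous_measurable_fun; exact: sqrt_continuous.
  apply: measurable_sum => i.
  by apply: measurable_funD; apply: measurable_funX;
    [exact: measurable_coord1|exact: measurable_coord2].
apply: measurableT_comp; first exact: measurable_expR.
apply: measurable_funM; first exact: measurable_cst.
have mh : measurable_fun (`[0, +oo[%classic : set R) (weight_fun h).
  apply: subspace_continuous_measurable_fun => //; exact: weight_continuous.
have sub : (fun t : real_space R n => eucl_norm (point_of t)) @` setT `<=` (`[0, +oo[%classic : set R).
  by move=> _ [t _ <-] /=; rewrite in_itv/= andbT sqrtr_ge0.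
exact: (measurable_comp _ sub mh mnorm).
Qed.

Lemma measurable_sq_norm (f : E -> C) : lebesgue_measurable f ->
  measurable_fun setT (fun t : real_space R n =>
    (Normc.normc (f (point_of t)) ^+ 2 * weight (point_of t))%:E).
Proof.
move=> [mRe mIm]; apply/measurable_EFinP.
apply: measurable_funM; last exact: measurable_weight.
under eq_fun do rewrite normc_sqr.
by apply: measurable_funD; exact: measurable_funX.
Qed.

Lemma normcD_sqr_le (a c d : C) :
  Normc.normc (a * c + d) ^+ 2 <=
    2 * Normc.normc a ^+ 2 * Normc.normc c ^+ 2 + 2 * Normc.normc d ^+ 2.
Proof.
rewrite -mulrA -exprMn -Normc.normcM; move: (a * c) => p.
rewrite !normc_sqr; case: p d => [x y] [u v] /=; rewrite -subr_ge0.
rewrite (_ : _ - _ = (x - u) ^+ 2 + (y - v) ^+ 2).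
  by rewrite addr_ge0// sqr_ge0.
by ring.
Qed.

Lemma fock_submod_closed : submod_closed fock_pred.
Proof.
split.
  rewrite inE; split; first by move=> z; exact: differentiable_cst.
  split; first by split; exact: measurable_cst.
  rewrite /sq_norm integral0_eq ?ltry// => t _.
  by rewrite [Normc.normc _]Normc.normc0 expr0n/= mul0r.
move=> a f g; rewrite !inE => -[ef [mf Nf]] [eg [mg Ng]].
split.
  move=> z; apply: differentiableD; last exact: eg.
  by apply: differentiableZ; exact: ef.
have mfg : lebesgue_measurable (a *: f + g).
  case: mf mg => [mRf mIf] [mRg mIg]; split.
    rewrite (_ : (fun t => _) = fun t : real_space R n =>
      complex.Re a * complex.Re (f (point_of t))
      - complex.Im a * complex.Im (f (point_of t))
      + complex.Re (g (point_of t))); last first.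
      by apply/funext => t; rewrite !fctE; case: a (f _) (g _) => ? ? [? ?] [].
    apply: measurable_funD; last exact: mRg.
    apply: measurable_funB; apply: measurable_funM.
    - exact: measurable_cst.
    - exact: mRf.
    - exact: measurable_cst.
    - exact: mIf.
  rewrite (_ : (fun t => _) = fun t : real_space R n =>
    complex.Re a * complex.Im (f (point_of t))
    + complex.Im a * complex.Re (f (point_of t))
    + complex.Im (g (point_of t))); last first.
    by apply/funext => t; rewrite !fctE; case: a (f _) (g _) => ? ? [? ?] [].
  apply: measurable_funD; last exact: mIg.
  apply: measurable_funD; apply: measurable_funM.
  - exact: measurable_cst.
  - exact: mIf.
  - exact: measurable_cst.
  - exact: mRf.
split=> //.
pose k := 2 * Normc.normc a ^+ 2.
have k0 : 0 <= k by rewrite mulr_ge0// sqr_ge0.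
pose N f t := (Normc.normc (f (point_of t)) ^+ 2 * weight (point_of t))%:E.
have N0 f' t : (0 <= N f' t)%E.
  by rewrite lee_fin mulr_ge0 ?sqr_ge0// expR_ge0.
apply: (@le_lt_trans _ _
    (\int[@lebesgue R n]_t (k%:E * N f t + 2%:E * N g t)))%E.
  apply: ge0_le_integral.
  - exact: measurableT.
  - by move=> t _; exact: N0.
  - exact: measurable_sq_norm.
  - apply: emeasurable_funD; apply: measurable_funeM;
      exact: measurable_sq_norm.
  - move=> t _; rewrite /N -!EFinM -EFinD lee_fin (mulrA k) (mulrA 2) -mulrDl.
    apply: ler_wpM2r; first exact: expR_ge0.
    exact: (normcD_sqr_le a (f (point_of t)) (g (point_of t))).
rewrite ge0_integralD; first last.
- apply: measurable_funeM; exact: measurable_sq_norm.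
- by move=> t _; rewrite mule_ge0.
- apply: measurable_funeM; exact: measurable_sq_norm.
- by move=> t _; rewrite mule_ge0.
- exact: measurableT.
rewrite ge0_integralZl; first last.
- by [].
- by move=> t _; exact: N0.
- exact: measurable_sq_norm.
- exact: measurableT.
rewrite ge0_integralZl; first last.
- by [].
- by move=> t _; exact: N0.
- exact: measurable_sq_norm.
- exact: measurableT.
by rewrite lte_add_pinfty// lte_mul_pinfty.
Qed.

HB.instance Definition _ := GRing.isSubmodClosed.Build C (E -> C) fock_pred
  fock_submod_closed.

Definition fock : Type := {f : E -> C | f \in fock_pred}.

HB.instance Definition _ := [isSub of fock for sval].
HB.instance Definition _ := [Choice of fock by <:].
HB.instance Definition _ := [SubChoice_isSubLmodule of fock by <:].

Definition is_projection (f : E -> C) (p : fock) : Prop :=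
  forall u : fock, inner (f - val p) (val u) = 0.

(* P f: the point of the Fock space given by the projection theorem; the
   default value 0 is irrelevant for f in L2. *)
Definition bergman_projection (f : E -> C) : fock := xget 0 (is_projection f).

Definition Linfty : set (E -> C) :=
  [set phi | lebesgue_measurable phi /\
     exists M : R, {ae @lebesgue R n, forall t,
       Normc.normc (phi (point_of t)) <= M}].

(* As elements of Linfty, g.phi and phi are equal iff they agree
   almost everywhere. *)
Definition invariant_symbol (G : set 'M[C]_n) (phi : E -> C) : Prop :=
  forall U, G U -> {ae @lebesgue R n, forall t,
    phi (invmx U *m point_of t) = phi (point_of t)}.

Definition operator : Type := fock -> fock.
Implicit Types (A B : operator) (f g : fock).

Definition toeplitz (phi : E -> C) : operator :=
  fun f => bergman_projection (fun z => phi z * val f z).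

Definition bounded_operator A : Prop :=
  linear A /\
  exists M : R, forall f, L2norm (val (A f)) <= M * L2norm (val f).

Definition op_norm A : R :=
  sup [set L2norm (val (A f)) | f in [set f | L2norm (val f) <= 1]].

Definition is_adjoint A B : Prop :=
  forall f g, inner (val (A f)) (val g) = inner (val f) (val (B g)).

Record Cstar_subalgebra (X : set operator) : Prop := {
  Cstar_bounded : forall A, X A -> bounded_operator A ;
  Cstar_zero : X (fun=> 0) ;
  Cstar_add : forall A B, X A -> X B -> X (fun f => A f + B f) ;
  Cstar_scale : forall (c : C) A, X A -> X (fun f => c *: A f) ;
  Cstar_mul : forall A B, X A -> X B -> X (A \o B) ;
  Cstar_adjoint : forall A B, X A -> bounded_operator B -> is_adjoint A B -> X B ;
  Cstar_closed : forall A, bounded_operator A ->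
    (forall e : R, 0 < e -> exists2 B, X B & op_norm (fun f => A f - B f) < e) ->
    X A }.

Definition Cstar_generated (S : set operator) : set operator :=
  smallest Cstar_subalgebra S.

Definition toeplitz_algebra (G : set 'M[C]_n) : set operator :=
  Cstar_generated [set toeplitz phi | phi in
    [set phi | Linfty phi /\ invariant_symbol G phi]].

Definition commutative_algebra (X : set operator) : Prop :=
  forall A B, X A -> X B -> A \o B = B \o A.

End fock_space.

Arguments inner {R n} h f g.
Arguments is_projection {R n} h f p.
Arguments bergman_projection {R n} h f.
Arguments toeplitz {R n} h phi.
Arguments toeplitz_algebra {R n} h G.

Definition unitary_group (R : realType) (n : nat) : set 'M[R[i]]_n :=
  [set g | g \is unitarymx].

Arguments unitary_group : clear implicits.

(* Main.v *)
(** Let Y be the set of bounded operators on the Fock space that commute with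
    the torus action f(z) |-> f(z_1, ..., t z_j, ..., z_n), |t| = 1. Since this
    action is unitary, Y is a C*-algebra. It is commutative: an entire function
    that is homogeneous in each variable is a multiple of a monomial, so all
    operators in Y are diagonal on these, and every f in the Fock space is the
    norm limit of the partial sums of its homogeneous components in a given
    variable, so one can descend through the variables one at a time.
    A Toeplitz operator with invariant symbol phi commutes with the torus
    because the measure is invariant, provided that the projection of phi f
    exists. This is obtained without completeness of the Fock space: the
    projection of phi z^alpha is a multiple of z^alpha, and for general f one
    adds up the projections of phi times the homogeneous components, with
    pointwise bounds strong enough to make the sum entire.
    The needed facts about entire functions come from Goursat's theorem, applied
    in logarithmic polar coordinates, and from discrete averages over roots of
    unity, which replace integrals over the torus. *)

Require Import Defs.
From HB Require Import structures.
From mathcomp Require Import all_boot all_order all_algebra.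
From mathcomp Require Import complex ring lra.
From mathcomp Require Import cyclic separable cyclotomic.
From mathcomp Require Import all_classical all_reals all_analysis.
From mathcomp Require Import measurable_realfun.

Set Implicit Arguments.
Unset Strict Implicit.
Unset Printing Implicit Defensive.

Import Order.TTheory GRing.Theory Num.Theory numFieldNormedType.Exports.

Local Open Scope classical_set_scope.
Local Open Scope ring_scope.
Local Open Scope complex_scope.
Local Notation nc := Normc.normc.

(** * Complex analysis in one variable *)

(** [toeplitz] takes its value from [xget] with default 0, so nothing about it, not even linearity,
    is known before a projection has been exhibited. Three descents (orthogonality, existence of
    projections, vanishing of commutators) run over the number of variables in which the function at
    hand is already homogeneous. At the bottom stands a function determined by its value at
    [const_mx 1]; at each level the function is recovered from its components in one more variable.
    For projections the descent has to carry more than norms: norm bounds make the sum of the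
    projections square integrable, but its being entire needs locally uniform bounds. These are the
    pairs [(a, c)] of [good_projection], uniform in the function, which grow by factors 2 and 4 at
    each level. Averages over roots of unity are finite combinations of rotated copies of [f]: they
    are entire and square integrable for algebraic reasons, and Parseval is an exact finite
    identity. The true components inherit this as pointwise limits, through Fatou's lemma and Cauchy
    estimates. *)

Section interval_integral.
Context (R : realType).
Implicit Types (a b c M : R) (u v : R -> R).

Definition itg a b u : R := \int[@lebesgue_measure R]_(x in `[a, b]) u x.

Lemma itg_integrable a b u : continuous u ->
  (@lebesgue_measure R).-integrable `[a, b] (EFin \o u).
Proof.
move=> cu; apply: continuous_compact_integrable; first exact: segment_compact.
exact: continuous_subspaceT.
Qed.

Lemma itgB a b u v : continuous u -> continuous v ->
  itg a b (fun x => u x - v x) = itg a b u - itg a b v.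
Proof. by move=> cu cv; rewrite /itg RintegralB//; exact: itg_integrable. Qed.

Lemma itgD a b u v : continuous u -> continuous v ->
  itg a b (fun x => u x + v x) = itg a b u + itg a b v.
Proof. by move=> cu cv; rewrite /itg RintegralD//; exact: itg_integrable. Qed.

Lemma itgZ a b M u : continuous u ->
  itg a b (fun x => M * u x) = M * itg a b u.
Proof. by move=> cu; rewrite /itg RintegralZl//; exact: itg_integrable. Qed.

Lemma itg_cst a b M : a <= b -> itg a b (fun=> M) = M * (b - a).
Proof.
move=> ab; rewrite /itg Rintegral_cst//; congr (M * _).
rewrite /= lebesgue_measure_itv/= lte_fin.
by case: ltrP => //= ba; rewrite (@le_anti _ _ a b) ?ab ?ba// subrr.
Qed.

Lemma itg_split a b c u : a <= c <= b -> continuous u ->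
  itg a b u = itg a c u + itg c b u.
Proof.
move=> /andP[ac cb] cu; apply/eqP; rewrite addrC -subr_eq; apply/eqP.
rewrite /itg Rintegral_itvB ?bnd_simp//; last exact: itg_integrable.
rewrite Rintegral_itv_obnd_cbnd//.
apply: integrableS (itg_integrable c b cu) => //.
by apply: subset_itvr; rewrite bnd_simp.
Qed.

Lemma itg_bound a b M u : a <= b -> continuous u ->
  (forall x, a <= x <= b -> `|u x| <= M) -> `|itg a b u| <= M * (b - a).
Proof.
move=> ab cu uM; rewrite -itg_cst//.
apply: (le_trans (le_normr_Rintegral _ _)) => //.
  exact: itg_integrable.
apply: le_Rintegral => //.
- by apply: (itg_integrable a b) => x; exact: (cvg_norm (cu x)).
- by apply: (itg_integrable a b) => x; exact: cvg_cst.
Qed.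

End interval_integral.

Lemma half_pow_small (R : realType) (D e : R) : 0 < e ->
  exists n, forall m, (n <= m)%N -> D * 2^-1 ^+ m < e.
Proof.
move=> e0; exists (Num.bound (D / e)) => m /upper_nthrootP.
by rewrite ltr_pdivrMr// exprVn ltr_pdivrMr ?exprn_gt0// mulrC.
Qed.

(** * Goursat's theorem on a rectangle *)

Section goursat.
Context (R : realType) (P Q : R -> R -> R).
Hypothesis cP : forall s, continuous (P s).
Hypothesis cQ : forall t, continuous (fun s => Q s t).

(** The integral of [P dt + Q ds] along the counterclockwise boundary of [[a, b] x [c, d]]. *)
Let flux a b c d : R :=
  itg c d (P b) - itg c d (P a) - (itg a b (Q ^~ d) - itg a b (Q ^~ c)).

Let fluxs a b c d m : a <= m <= b -> c <= d ->
  flux a b c d = flux a m c d + flux m b c d.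
Proof.
move=> amb cd; rewrite /flux !(itg_split amb)//; by ring.
Qed.

Let fluxt a b c d m : c <= m <= d -> a <= b ->
  flux a b c d = flux a b c m + flux a b m d.
Proof.
move=> amb cd; rewrite /flux !(itg_split amb)//; by ring.
Qed.

(** Joint differentiability of [P] and [Q] at one point; that [p] serves both as [dP/ds] and as
    [dQ/dt] says that the form is closed there. *)
Let diverg s t := exists p q r : R, forall e : R, 0 < e ->
  exists2 dl : R, 0 < dl &
  forall s' t', `|s' - s| < dl -> `|t' - t| < dl ->
    `|P s' t' - P s t - p * (s' - s) - q * (t' - t)| <= e * (`|s' - s| + `|t' - t|) /\
    `|Q s' t' - Q s t - r * (s' - s) - p * (t' - t)| <= e * (`|s' - s| + `|t' - t|).

(** The affine part of the form is closed, so its contributions [p * (b - a) * (d - c)] from the two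
    pairs of sides cancel. What is left is the remainder, at most [e * D] times the side length for
    each pair. *)
Let flux_small s t (e : R) : diverg s t -> 0 < e -> exists2 dl : R, 0 < dl &
  forall a b c d : R, a <= s <= b -> c <= t <= d -> b - a < dl -> d - c < dl ->
  `|flux a b c d| <= e * (b - a + (d - c)) ^+ 2.
Proof.
move=> [p [q [r H]]] e0.
have [|dl dl0 {}H] := H (e / 2); first by rewrite divr_gt0.
exists dl => // a b c d /andP[as_ sb] /andP[ct td] ba dc.
have ab : a <= b := le_trans as_ sb.
have cd : c <= d := le_trans ct td.
set D := b - a + (d - c).
have H' s' t' : a <= s' <= b -> c <= t' <= d ->
    `|P s' t' - P s t - p * (s' - s) - q * (t' - t)| <= e / 2 * D /\
    `|Q s' t' - Q s t - r * (s' - s) - p * (t' - t)| <= e / 2 * D.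
  move=> /andP[as' s'b] /andP[ct' t'd].
  have s's : `|s' - s| <= b - a by rewrite ler_norml; lra.
  have t't : `|t' - t| <= d - c by rewrite ler_norml; lra.
  have [H1 H2] := H s' t' (le_lt_trans s's ba) (le_lt_trans t't dc).
  have k : e / 2 * (`|s' - s| + `|t' - t|) <= e / 2 * D.
    by apply: ler_wpM2l; [rewrite divr_ge0// ltW|rewrite lerD].
  by split; exact: le_trans k.
have K1 : `|itg c d (P b) - itg c d (P a) - p * (b - a) * (d - c)| <= e * D * (d - c).
  rewrite -itgB// -itg_cst// -itgB; last 2 first.
    by move=> x; apply: cvgB; exact: cP.
    by move=> x; exact: cvg_cst.
  apply: itg_bound => //.
    by move=> x; apply: cvgB; [apply: cvgB; exact: cP|exact: cvg_cst].
  move=> x cxd.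
  have [H1 _] := H' b x (introT andP (conj ab (lexx b))) cxd.
  have [H2 _] := H' a x (introT andP (conj (lexx a) ab)) cxd.
  by move: H1 H2; rewrite !ler_norml; lra.
have K2 : `|itg a b (Q ^~ d) - itg a b (Q ^~ c) - p * (d - c) * (b - a)| <= e * D * (b - a).
  rewrite -itgB// -itg_cst// -itgB; last 2 first.
    by move=> x; apply: cvgB; exact: cQ.
    by move=> x; exact: cvg_cst.
  apply: itg_bound => //.
    by move=> x; apply: cvgB; [apply: cvgB; exact: cQ|exact: cvg_cst].
  move=> x cxd.
  have [_ H1] := H' x d cxd (introT andP (conj cd (lexx d))).
  have [_ H2] := H' x c cxd (introT andP (conj (lexx c) cd)).
  by move: H1 H2; rewrite !ler_norml; lra.
rewrite expr2 mulrA -/D mulrDr addrC.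
move: K1 K2; rewrite /flux !ler_norml.
move: (e * D * (d - c)) (e * D * (b - a)) => A B.
have -> : p * (d - c) * (b - a) = p * (b - a) * (d - c) by ring.
lra.
Qed.

Let quarter (x x1 x2 x3 x4 : R) : x = x1 + x2 + x3 + x4 ->
  [\/ `|x| <= 4 * `|x1|, `|x| <= 4 * `|x2|, `|x| <= 4 * `|x3| | `|x| <= 4 * `|x4|].
Proof.
move=> xE.
have := ler_normD (x1 + x2 + x3) x4; have := ler_normD (x1 + x2) x3.
have := ler_normD x1 x2; rewrite -xE => A1 A2 A3.
have [B|B1] := lerP `|x| (4 * `|x1|); first by constructor 1.
have [B|B2] := lerP `|x| (4 * `|x2|); first by constructor 2.
have [B|B3] := lerP `|x| (4 * `|x3|); first by constructor 3.
by constructor 4; lra.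
Qed.

(* Goursat's bisection argument, for the differential form P dt + Q ds with
   dP/ds = dQ/dt; no continuity of the partial derivatives is assumed. *)
Lemma goursat (a b c d : R) : a <= b -> c <= d ->
  (forall s t : R, a <= s <= b -> c <= t <= d -> diverg s t) ->
  itg c d (P b) - itg c d (P a) = itg a b (Q ^~ d) - itg a b (Q ^~ c).
Proof.
move=> ab cd H; apply/eqP; rewrite -subr_eq0 -/(flux a b c d); apply/negPn/negP => f0.
have [k k0 kE] : exists2 k : R, 0 < k & k = `|flux a b c d|.
  by exists `|flux a b c d|; rewrite ?normr_gt0.
pose hh n : R := 2^-1 ^+ n.
have hS n : hh n.+1 = hh n / 2 by rewrite /hh exprSr.
have h0 n : 0 < hh n by rewrite exprn_gt0.
(* [(n, (s, t))] stands for the rectangle with lower corner [(s, t)] and sides scaled by [hh n]. The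
   relation [rl] passes to a rectangle of half the size inside it that carries at least a quarter of
   the flux. *)
pose fl (x : nat * (R * R)) := flux x.2.1 (x.2.1 + (b - a) * hh x.1)
  x.2.2 (x.2.2 + (d - c) * hh x.1).
pose rl (x y : nat * (R * R)) := [/\ y.1 = x.1.+1,
   x.2.1 <= y.2.1 <= x.2.1 + (b - a) * hh x.1 / 2,
   x.2.2 <= y.2.2 <= x.2.2 + (d - c) * hh x.1 / 2 &
   `|fl x| <= 4 * `|fl y|].
have step x : {y | rl x y}.
  apply: cid; case: x => n [s t]; rewrite /rl/=.
  set w := (b - a) * hh n; set v := (d - c) * hh n.
  have w0 : 0 <= w by rewrite mulr_ge0 ?subr_ge0// ltW.
  have v0 : 0 <= v by rewrite mulr_ge0 ?subr_ge0// ltW.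
  have mem x' : (x' = s \/ x' = s + w / 2) -> s <= x' <= s + w / 2.
    by case=> ->; lra.
  have mem' x' : (x' = t \/ x' = t + v / 2) -> t <= x' <= t + v / 2.
    by case=> ->; lra.
  have E : fl (n, (s, t)) = flux s (s + w / 2) t (t + v / 2)
      + flux s (s + w / 2) (t + v / 2) (t + v)
      + flux (s + w / 2) (s + w) t (t + v / 2)
      + flux (s + w / 2) (s + w) (t + v / 2) (t + v).
    rewrite /fl/= -/w -/v (@fluxs _ _ _ _ (s + w / 2)); [|lra|lra].
    rewrite (@fluxt s _ _ _ (t + v / 2)); [|lra|lra].
    rewrite (@fluxt _ (s + w) _ _ (t + v / 2)); [|lra|lra].
    by rewrite !addrA.
  have flE s' t' s'' t'' : s'' = s' + w / 2 -> t'' = t' + v / 2 ->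
      flux s' s'' t' t'' = fl (n.+1, (s', t')).
    by move=> -> ->; rewrite /fl/= hS !mulrA.
  rewrite (flE _ _ _ _ erefl erefl) (flE s (t + v / 2)) in E; [|by []|by lra].
  rewrite (flE (s + w / 2) t) in E; [|by lra|by []].
  rewrite (flE (s + w / 2) (t + v / 2)) in E; [|by lra|by lra].
  have rlI s' t' : (s' = s \/ s' = s + w / 2) -> (t' = t \/ t' = t + v / 2) ->
     `|fl (n, (s, t))| <= 4 * `|fl (n.+1, (s', t'))| ->
     exists y : nat * (R * R), [/\ y.1 = n.+1, s <= y.2.1 <= s + w / 2,
       t <= y.2.2 <= t + v / 2 & `|fl (n, (s, t))| <= 4 * `|fl y|].
    by move=> /mem s's /mem' t't B; exists (n.+1, (s', t')).
  case: (quarter E) => B; apply: (rlI _ _ _ _ B); solve [by left|by right].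
have [f [f00 fr]] := dependent_choice step (0%N, (a, c)).
have fn n : (f n).1 = n.
  by elim: n => [|n IH]; [rewrite f00|have [-> _ _ _] := fr n; rewrite IH].
have fk n : k * hh n ^+ 2 <= `|fl (f n)|.
  elim: n => [|n IH].
    rewrite f00 /fl/= /hh expr0 expr1n !mulr1.
    by rewrite (addrC a) subrK (addrC c) subrK kE.
  have [_ _ _ fS] := fr n; have := le_trans IH fS; rewrite hS.
  by rewrite expr_div_n; lra.
have nest (x : R ^nat) (w : R) : 0 <= w ->
   (forall n, x n <= x n.+1 <= x n + w * hh n / 2) ->
   exists l, forall n, x n <= l <= x n + w * hh n.
  move=> w0 xS.
  have m1 n m : x n <= x (n + m)%N.
    elim: m => [|m IH]; first by rewrite addn0.
    by rewrite addnS; have := xS (n + m)%N; lra.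
  have m2 n m : x (n + m)%N + w * hh (n + m)%N <= x n + w * hh n.
    elim: m => [|m IH]; first by rewrite addn0.
    by rewrite addnS hS; have := xS (n + m)%N; lra.
  have ub n m : x m <= x n + w * hh n.
    have := m1 m n; have := m2 n m; rewrite addnC.
    have : 0 <= w * hh (m + n)%N by rewrite mulr_ge0// ltW.
    lra.
  have hs (n : nat) : has_ubound (range x).
    by exists (x n + w * hh n) => _ [m _ <-]; exact: ub.
  exists (sup (range x)) => n; apply/andP; split.
    by apply: (ub_le_sup (hs n)); exists n.
  by apply: ge_sup; [exists (x n), n|move=> _ [m _ <-]; exact: ub].
have [| |s Hs] := nest (fun n => (f n).2.1) (b - a).
- by rewrite subr_ge0.
- by move=> n; have [_ + _ _] := fr n; rewrite fn.
have [| |t Ht] := nest (fun n => (f n).2.2) (d - c).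
- by rewrite subr_ge0.
- by move=> n; have [_ _ + _] := fr n; rewrite fn.
have : diverg s t.
  have := Hs 0%N; have := Ht 0%N; rewrite f00/= /hh expr0 => A B.
  by apply: H; lra.
set D := b - a + (d - c).
(* With this accuracy the local bound at depth [n] is below [k * hh n ^+ 2 / 2], against [fk];
   adding 1 to [D ^+ 2] covers degenerate rectangles. *)
move=> /flux_small-/(_ (k / (2 * (D ^+ 2 + 1)))).
have D1 : 0 < D ^+ 2 + 1 by have := sqr_ge0 D; lra.
case=> [|dl dl0 small]; first by rewrite divr_gt0// mulr_gt0.
have [n nd] : exists n, D * hh n < dl.
  by have [n /(_ n (leqnn n))] := half_pow_small D dl0; exists n.
have := small _ _ _ _ (Hs n) (Ht n).
have addl x y : x + y - x = y :> R by rewrite addrC addKr.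
rewrite !addl -mulrDl -/D.
have Dn1 : (b - a) * hh n <= D * hh n.
  by apply: ler_wpM2r; [exact: ltW|rewrite lerDl subr_ge0].
have Dn2 : (d - c) * hh n <= D * hh n.
  by apply: ler_wpM2r; [exact: ltW|rewrite lerDr subr_ge0].
have := fk n; rewrite /fl fn => kf /(_ (le_lt_trans Dn1 nd) (le_lt_trans Dn2 nd)).
move/(le_trans kf); apply/negP; rewrite -ltNge.
rewrite exprMn mulrA ltr_pM2r ?exprn_gt0// -mulrA gtr_pMr// ltr_pdivrMl.
  by have := sqr_ge0 D; lra.
by rewrite mulr_gt0.
Qed.

End goursat.

Section normc.
Context (R : realType).
Local Notation C := R[i].
Implicit Types x y z : C.

Lemma nc_def z : `|z| = (nc z)%:C.
Proof. by rewrite normc_def; case: z. Qed.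

Lemma nc_ge0 z : 0 <= nc z.
Proof. by case: z => a b; exact: sqrtr_ge0. Qed.

Lemma ncD x y : nc (x + y) <= nc x + nc y.
Proof. exact: le_normcD. Qed.

Lemma ncN x : nc (- x) = nc x.
Proof. exact: normcN. Qed.

Lemma ncB x y : nc (x - y) <= nc x + nc y.
Proof. by rewrite -(ncN y); exact: ncD. Qed.

Lemma ncC x y : nc (x - y) = nc (y - x).
Proof. by rewrite -ncN opprB. Qed.

Lemma ncX x n : nc (x ^+ n) = nc x ^+ n.
Proof.
elim: n => [|n IH]; first by rewrite !expr0 Normc.normc1.
by rewrite !exprS Normc.normcM IH.
Qed.

Lemma ncR (a : R) : nc a%:C = `|a|.
Proof. by rewrite /= expr0n/= addr0 sqrtr_sqr. Qed.

Lemma ncRe z : `|complex.Re z| <= nc z.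
Proof.
case: z => a b /=; rewrite -sqrtr_sqr ler_sqrt ?lerDl ?sqr_ge0//.
by rewrite addr_ge0 ?sqr_ge0.
Qed.

Lemma ncIm z : `|complex.Im z| <= nc z.
Proof.
case: z => a b /=; rewrite -sqrtr_sqr ler_sqrt ?lerDr ?sqr_ge0//.
by rewrite addr_ge0 ?sqr_ge0.
Qed.

Lemma nc_le z : nc z <= `|complex.Re z| + `|complex.Im z|.
Proof.
case: z => a b; rewrite {1}(_ : a +i* b = a%:C + 0 +i* b); last first.
  by apply/eqP; rewrite eq_complex/= addr0 add0r !eqxx.
apply: le_trans (ncD _ _) _; rewrite ncR/=.
by rewrite expr0n/= add0r sqrtr_sqr.
Qed.

Lemma nc_eq0 z : (nc z == 0) = (z == 0).
Proof.
apply/eqP/eqP => [|->]; last exact: Normc.normc0.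
exact: Normc.eq0_normc.
Qed.

Lemma nc_gt0 z : (0 < nc z) = (z != 0).
Proof. by rewrite lt_def nc_eq0 nc_ge0 andbT. Qed.

Lemma nc_sum (I : Type) (r : seq I) (P : pred I) (F : I -> C) :
  nc (\sum_(i <- r | P i) F i) <= \sum_(i <- r | P i) nc (F i).
Proof.
elim/big_ind2 : _ => //; first by rewrite Normc.normc0.
by move=> x1 x2 y1 y2 h1 h2; apply: le_trans (ncD _ _) _; exact: lerD.
Qed.

Lemma nc_triB x y z : nc (x - z) <= nc (x - y) + nc (y - z).
Proof. by rewrite -(subrKA y) ncD. Qed.

Lemma nc_eps0 x : (forall e : R, 0 < e -> nc x <= e) -> x = 0.
Proof.
move=> H; apply/eqP; rewrite -nc_eq0 eq_le nc_ge0 andbT.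
by apply/ler_addgt0Pr => e e0; rewrite add0r H.
Qed.

End normc.

Section differentials.
Context (R : realType) (V : normedModType R[i]).
Local Notation C := R[i].

Lemma pos_real (d : C) : 0 < d -> exists2 r : R, 0 < r & d = r%:C.
Proof.
case: d => a b; rewrite ltcE/= => /andP[/eqP -> a0].
by exists a.
Qed.

(** Norms over [R[i]] take their values in [R[i]]; this lemma and its converse [eps_diff] translate
    differentiability into estimates with real constants. *)
Lemma diff_eps (f : V -> C^o) (x : V) : differentiable f x ->
  forall e : R, 0 < e -> exists2 d : R, 0 < d &
  forall h : V, `|h| < d%:C -> `|f (h + x) - f x - 'd f x h| <= e%:C * `|h|.
Proof.
move=> /diff_locally/eqaddoP H e e0.
have e0C : 0 < e%:C by rewrite ltcR.
have /nbhs_ballP[d /= d0] := H _ e0C.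
have [r r0 ->] := pos_real d0 => Hd.
exists r => // h hr.
have := Hd h; rewrite -ball_normE/= sub0r normrN => /(_ hr).
by rewrite !fctE/= opprD addrA.
Qed.

Lemma eps_diff (f : V -> C^o) (x : V) (L : {linear V -> C^o}) : continuous L ->
  (forall e : R, 0 < e -> exists2 d : R, 0 < d &
    forall h : V, `|h| < d%:C -> `|f (h + x) - f x - L h| <= e%:C * `|h|) ->
  differentiable f x.
Proof.
move=> cL H.
suff E : f = ((fun y => f x + L (y - x)) : V -> C^o) +o_x (center x).
  apply/diffP => /=.
  (* The differential is a chosen linear map, so that exhibiting the witness [L] is enough. *)
  apply: (@getPex _ (fun (df : {linear V -> C^o}) => continuous df /\
    forall y, f y = f (lim (nbhs x)) + df (y - lim (nbhs x))
                  +o_(y \near x) (y - lim (nbhs x)))).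
  by exists L; split=> //; rewrite lim_id// => y; rewrite {1}E.
apply/eqaddoP => e e0; have [r r0 ->] := pos_real e0.
have [d d0 {}H] := H _ r0.
apply/nbhs_ballP; exists d%:C; first by rewrite /= ltcR.
move=> y; rewrite -ball_normE/= distrC => /H.
by rewrite subrK !fctE/= opprD addrA.
Qed.

End differentials.

Section cdiff.
Context (R : realType).
Local Notation C := R[i].

Definition ccont (g : C -> C) (z : C) := forall e : R, 0 < e ->
  exists2 d : R, 0 < d & forall w, nc (w - z) < d -> nc (g w - g z) < e.

Definition cderiv (g : C -> C) (z l : C) := forall e : R, 0 < e ->
  exists2 d : R, 0 < d & forall w, nc (w - z) < d ->
    nc (g w - g z - l * (w - z)) <= e * nc (w - z).

Definition cdiff (g : C -> C) (z : C) := exists l, cderiv g z l.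

Lemma cdiff_differentiable (g : C^o -> C^o) z : differentiable g z -> cdiff g z.
Proof.
move=> dg; exists ('d g z 1) => e e0; have [d d0 H] := diff_eps dg e0.
exists d => // w wz; have := H (w - z).
rewrite subrK !nc_def ltcR -rmorphM/= lecR => /(_ wz).
have -> : 'd g z (w - z) = 'd g z 1 * (w - z).
  rewrite -[w - z in LHS](mulr1 (w - z)).
  by rewrite -[(w - z) * 1]/((w - z) *: (1 : C^o)) linearZ/= mulrC.
by [].
Qed.

Lemma cdiff_ccont g z : cdiff g z -> ccont g z.
Proof.
case=> l H e e0; have [d d0 {}H] := H 1 ltr01.
pose k := nc l + 1.
have k0 : 0 < k by rewrite /k ltr_wpDl// nc_ge0.
exists (Num.min d (e / k)); first by rewrite lt_min d0 divr_gt0.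
move=> w; rewrite lt_min => /andP[/H wd we].
rewrite -(subrK (l * (w - z)) (g w - g z)); apply: le_lt_trans (ncD _ _) _.
apply: le_lt_trans (lerD wd (lexx _)) _.
by rewrite Normc.normcM -mulrDl addrC -ltr_pdivlMl// mulrC.
Qed.

Lemma cderiv_near g1 g2 z l : (exists2 d : R, 0 < d &
   forall w, nc (w - z) < d -> g1 w = g2 w) -> cderiv g1 z l -> cderiv g2 z l.
Proof.
move=> [d d0 E] H e e0; have [d' d'0 {}H] := H e e0.
exists (Num.min d d'); first by rewrite lt_min d0.
move=> w; rewrite lt_min => /andP[wd wd'].
by rewrite -!E ?subrr ?Normc.normc0//; exact: H.
Qed.

End cdiff.

(** * Logarithmic polar coordinates *)

Section polar.
Context (R : realType).
Local Notation C := R[i].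

Lemma derive_eps (f : R -> R) (x df : R) : is_derive x (1 : R) f df ->
  forall e : R, 0 < e -> exists2 d : R, 0 < d &
  forall h, `|h| < d -> `|f (h + x) - f x - df * h| <= e * `|h|.
Proof.
move=> [H dE] e e0; move: H; rewrite /derivable => /cvg_ex[l lP].
have ldf : l = df by rewrite -dE /derive; apply/esym/cvg_lim.
rewrite {}ldf in lP.
move/cvgrPdist_le : lP => /(_ e e0).
rewrite near_withinE => /nbhs_ballP[d /= d0 H].
exists d => // h hd.
have [->|h0] := eqVneq h 0; first by rewrite add0r mulr0 subr0 subrr normr0 mulr0.
have := H h; rewrite -ball_normE/= sub0r normrN hd => /(_ isT h0).
rewrite -[h%:A]/(h * 1) mulr1 -[h^-1 *: _]/(h^-1 * _) => K.
rewrite -ler_pdivrMr ?normr_gt0// -normfV -normrM.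
by rewrite mulrBl mulfK// distrC mulrC.
Qed.

(** This is [exp (s + i t)]: circles around 0 become lines of constant [s], with radius [expR s]. *)
Definition polar (s t : R) : C := (expR s * cos t) +i* (expR s * sin t).

Lemma polarD s t s' t' : polar (s + s') (t + t') = polar s t * polar s' t'.
Proof.
rewrite /polar expRD cosD sinD; simpc.
by apply/eqP; rewrite eq_complex/=; apply/andP; split; apply/eqP; ring.
Qed.

Lemma nc_polar s t : nc (polar s t) = expR s.
Proof.
rewrite /polar/= !exprMn -mulrDr cos2Dsin2 mulr1 sqrtr_sqr ger0_norm// expR_ge0.
Qed.

Lemma polar_neq0 s t : polar s t != 0.
Proof. by rewrite -nc_gt0 nc_polar expR_gt0. Qed.

Lemma polar2pi s : polar s (2 * pi) = polar s 0.
Proof. by rewrite /polar mulr_natl cos2pi sin2pi cos0 sin0. Qed.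

Lemma polar_deriv0 (e : R) : 0 < e -> exists2 d : R, 0 < d &
  forall x y, `|x| < d -> `|y| < d ->
    nc (polar x y - 1 - (x +i* y)) <= e * (`|x| + `|y|).
Proof.
move=> e0.
(* The remainders below add up to at most [6 * e'] times [|x| + |y|]; the condition [e' <= 1] yields
   [|E| <= 3]. *)
have [e' [e'0 e'1 e'8]] : exists e' : R, [/\ 0 < e', e' <= 1 & e' <= e / 8].
  by exists (Num.min 1 (e / 8)); rewrite lt_min ltr01 divr_gt0// !ge_min !lexx orbT.
have [d1 d10 H1] := derive_eps (is_derive_expR 0) e'0.
have [d2 d20 H2] := derive_eps (is_derive_cos 0) e'0.
have [d3 d30 H3] := derive_eps (is_derive_sin 0) e'0.
exists (Num.min e' (Num.min (Num.min d1 d2) d3)).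
  by rewrite !lt_min e'0 d10 d20.
move=> x y; rewrite !lt_min => /andP[xe /andP[/andP[x1 x2] x3]].
move=> /andP[ye /andP[/andP[y1 y2] y3]].
have {H1} := H1 x x1; have {H2} := H2 y y2; have {H3} := H3 y y3.
rewrite !addr0 expR0 cos0 sin0 oppr0 mul0r !subr0 !addr0 !mul1r.
set c := cos y; set s := sin y; set E := expR x => S K X.
apply: le_trans (nc_le _) _; rewrite /polar/= -/c -/s -/E subr0.
have -> : E * c - 1 - x = (E - 1 - x) + E * (c - 1) by ring.
have -> : E * s - y = (E - 1 - x) * y + x * y + E * (s - y) by ring.
have E3 : `|E| <= 3.
  have -> : E = (E - 1 - x) + (1 + x) by ring.
  apply: le_trans (ler_normD _ _) _.
  have := ler_normD 1 x; rewrite normr1 => A.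
  have : e' * `|x| <= 1 * 1 by apply: ler_pM => //; lra.
  lra.
have := ler_normD (E - 1 - x) (E * (c - 1)).
have := ler_normD ((E - 1 - x) * y + x * y) (E * (s - y)).
have := ler_normD ((E - 1 - x) * y) (x * y).
rewrite !normrM => A1 A2 A3.
have B1 : `|E| * `|c - 1| <= 3 * (e' * `|y|) by apply: ler_pM.
have B2 : `|E| * `|s - y| <= 3 * (e' * `|y|) by apply: ler_pM.
have B3 : `|E - 1 - x| * `|y| <= (e' * `|x|) * 1 by apply: ler_pM => //; lra.
have B4 : `|x| * `|y| <= `|x| * e' by apply: ler_pM => //; lra.
have B5 : e' * `|x| <= e / 8 * `|x| by apply: ler_wpM2r.
have B6 : e' * `|y| <= e / 8 * `|y| by apply: ler_wpM2r.
have B7 : 0 <= e * `|x| by rewrite mulr_ge0// ltW.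
have B8 : 0 <= e * `|y| by rewrite mulr_ge0// ltW.
rewrite [leRHS]mulrDr.
move: A1 A2 A3 B1 B2 B3 B4 B5 B6 B7 B8 X; rewrite (mulrC `|x| e').
rewrite !(mulrAC e 8^-1) !mulr1.
by move: (e * `|x|) (e * `|y|) (e' * `|x|) (e' * `|y|) => ? ? ? ?; lra.
Qed.

Lemma polar_deriv (s t e : R) : 0 < e -> exists2 d : R, 0 < d &
  forall s' t', `|s' - s| < d -> `|t' - t| < d ->
    nc (polar s' t' - polar s t - polar s t * ((s' - s) +i* (t' - t)))
    <= e * (`|s' - s| + `|t' - t|).
Proof.
move=> e0; have [d d0 H] := polar_deriv0 (divr_gt0 e0 (expR_gt0 s)).
exists d => // s' t' hs ht; have := H _ _ hs ht.
have -> : polar s' t' = polar s t * polar (s' - s) (t' - t).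
  by rewrite -polarD !(addrC _ (_ - _)) !subrK.
rewrite -[X in _ * _ - X - _]mulr1 -!mulrBr Normc.normcM nc_polar.
by rewrite mulrAC ler_pdivlMr ?expR_gt0// mulrC.
Qed.

Lemma polar_cont (s t e : R) : 0 < e -> exists2 d : R, 0 < d &
  forall s' t', `|s' - s| < d -> `|t' - t| < d -> nc (polar s' t' - polar s t) < e.
Proof.
move=> e0; have [d d0 H] := polar_deriv s t ltr01.
pose k := 2 * (expR s + 1).
have k0 : 0 < k by rewrite mulr_gt0// addr_gt0// expR_gt0.
exists (Num.min d (e / k)); first by rewrite lt_min d0 divr_gt0.
move=> s' t'; rewrite !lt_min => /andP[sd se] /andP[td te].
have := H s' t' sd td; set A := polar s' t' - _; set B := polar s t * _ => AB.
rewrite -(subrK B A); apply: le_lt_trans (ncD _ _) _.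
have Bl : nc B <= expR s * (`|s' - s| + `|t' - t|).
  rewrite Normc.normcM nc_polar; apply: ler_wpM2l; first exact: expR_ge0.
  exact: nc_le.
apply: le_lt_trans (lerD AB Bl) _.
rewrite -mulrDl -ltr_pdivlMl; last by rewrite addrC addr_gt0// expR_gt0.
apply: lt_le_trans (ltrD se te) _.
rewrite /k; have := expR_gt0 s; move: (expR s) => E E0.
by rewrite le_eqVlt; apply/orP; left; apply/eqP; field; lra.
Qed.

End polar.

Section cdiff_rules.
Context (R : realType).
Local Notation C := R[i].

Definition lmul (l : C) (h : C^o) : C^o := l * h.

Lemma lmul_linear l : linear (lmul l).
Proof. by move=> a x y; rewrite /lmul mulrDr mulrCA. Qed.

HB.instance Definition _ l := GRing.isLinear.Build C C^o C^o *:%R (lmul l) (lmul_linear l).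

Lemma cdiffP (g : C^o -> C^o) (z : C^o) : cdiff g z <-> differentiable g z.
Proof.
split; last exact: cdiff_differentiable.
case=> l H; apply: (@eps_diff _ _ _ _ (lmul l)).
  exact: (@mulrl_continuous C l).
move=> e /H[d d0 {}H]; exists d => // h hd.
have := H (h + z); rewrite addrK -ltcR -nc_def => /(_ hd).
by rewrite -lecR rmorphM/= -!nc_def.
Qed.

Implicit Types (f g : C -> C) (z : C).

Lemma cdiff_cst (c : C) z : cdiff (fun=> c) z.
Proof. by apply/cdiffP; exact: (@differentiable_cst C C^o). Qed.

Lemma cdiff_id z : cdiff id z.
Proof. by apply/cdiffP; exact: (@ex_diff _ _ _ _ _ _ id). Qed.

Lemma cdiffB f g z : cdiff f z -> cdiff g z -> cdiff (fun w => f w - g w) z.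
Proof.
move=> /cdiffP df /cdiffP dg; apply/cdiffP.
exact: (@differentiableB C C^o C^o).
Qed.

Lemma cdiffM f g z : cdiff f z -> cdiff g z -> cdiff (fun w => f w * g w) z.
Proof.
move=> /cdiffP df /cdiffP dg; apply/cdiffP.
exact: (@differentiableM C C^o).
Qed.

Lemma cdiffV f z : cdiff f z -> f z != 0 -> cdiff (fun w => (f w)^-1) z.
Proof.
move=> /cdiffP df f0; apply/cdiffP.
exact: (@differentiableV C C^o).
Qed.

Lemma cdiffX f n z : cdiff f z -> cdiff (fun w => f w ^+ n) z.
Proof.
move=> df; elim: n => [|n IH].
  by rewrite (_ : (fun w => _) = fun=> 1) ?funeqE//; exact: cdiff_cst.
by under eq_fun do rewrite exprS; exact: cdiffM.
Qed.

Lemma cdiff_near f g z : (exists2 d : R, 0 < d &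
   forall w, nc (w - z) < d -> f w = g w) -> cdiff f z -> cdiff g z.
Proof. by move=> H [l fl]; exists l; exact: cderiv_near fl. Qed.

End cdiff_rules.

(** * Circle integrals and Cauchy's theorem *)

Section circle_integral.
Context (R : realType).
Local Notation C := R[i].
Implicit Types (u v : R -> C) (G : C -> C).

Definition tcont u := forall t (e : R), 0 < e ->
  exists2 d : R, 0 < d & forall t', `|t' - t| < d -> nc (u t' - u t) < e.

Lemma tcont_polar G s : (forall t, ccont G (polar s t)) -> tcont (fun t => G (polar s t)).
Proof.
move=> cG t e /(cG t)[d d0 H].
have [d' d'0 H'] := polar_cont s t d0.
by exists d' => // t' t't; apply/H/H' => //; rewrite subrr normr0.
Qed.

Lemma tcontRe u : tcont u -> continuous (fun t => complex.Re (u t)).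
Proof.
move=> cu t; apply/cvgrPdist_lt => e /(cu t)[d d0 H].
apply/nbhs_ballP; exists d => // t'; rewrite /ball/= distrC => /H.
rewrite ncC; apply: le_lt_trans.
by apply: le_trans (ncRe _); case: (u t) (u t') => [? ?] [? ?].
Qed.

Lemma tcontIm u : tcont u -> continuous (fun t => complex.Im (u t)).
Proof.
move=> cu t; apply/cvgrPdist_lt => e /(cu t)[d d0 H].
apply/nbhs_ballP; exists d => // t'; rewrite /ball/= distrC => /H.
rewrite ncC; apply: le_lt_trans.
by apply: le_trans (ncIm _); case: (u t) (u t') => [? ?] [? ?].
Qed.

Lemma tcontZ (c : C) u : tcont u -> tcont (fun t => c * u t).
Proof.
move=> cu t e e0; have k0 : 0 < nc c + 1 by rewrite ltr_wpDl// nc_ge0.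
have [d d0 H] := cu t (e / (nc c + 1)) (divr_gt0 e0 k0).
exists d => // t' /H; rewrite -mulrBr Normc.normcM ltr_pdivlMr//.
apply: le_lt_trans; rewrite mulrC; apply: ler_wpM2l; first exact: nc_ge0.
by rewrite lerDl.
Qed.

Lemma tcontB u v : tcont u -> tcont v -> tcont (fun t => u t - v t).
Proof.
move=> cu cv t e e0; have e20 : 0 < e / 2 by rewrite divr_gt0.
have [d d0 H] := cu t _ e20; have [d' d'0 H'] := cv t _ e20.
exists (Num.min d d'); first by rewrite lt_min d0.
move=> t'; rewrite lt_min => /andP[/H A /H' B].
rewrite (_ : _ - _ = (u t' - u t) - (v t' - v t)); last by ring.
by apply: le_lt_trans (ncB _ _) _; rewrite [e]splitr ltrD.
Qed.

(** Integration is against the angle, that is against [dz / (i z)]. A contour integral in [dz] thus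
    shows up with an extra factor [z] in the integrand. *)
Definition cint u : C := itg 0 (2 * pi) (fun t => complex.Re (u t)) +i*
  itg 0 (2 * pi) (fun t => complex.Im (u t)).

Lemma cintB u v : tcont u -> tcont v -> cint (fun t => u t - v t) = cint u - cint v.
Proof.
move=> cu cv; rewrite /cint; simpc.
rewrite -!itgB; [|exact: tcontIm..|exact: tcontRe|exact: tcontRe].
by congr (_ +i* _); congr itg; apply/funext => t; case: (u t) (v t) => [? ?] [? ?].
Qed.

Lemma cintZ (c : C) u : tcont u -> cint (fun t => c * u t) = c * cint u.
Proof.
move=> cu; case: c => a b; rewrite /cint; simpc.
have cR := tcontRe cu; have cI := tcontIm cu.
have cZ (k : R) (w : R -> R) : continuous w -> continuous (fun t => k * w t).
  by move=> cw t; apply: cvgM; [exact: cvg_cst|exact: cw].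
rewrite -!itgZ// -itgB; [|exact: cZ..].
rewrite -itgD; [|exact: cZ..].
by congr (_ +i* _); congr itg; apply/funext => t; case: (u t) => x y /=; ring.
Qed.

Lemma cint_cst (c : C) : cint (fun=> c) = (2 * pi)%:C * c.
Proof.
have p0 : 0 <= 2 * pi :> R by rewrite mulr_ge0// pi_ge0.
by case: c => a b; rewrite /cint/= !itg_cst// subr0; simpc; rewrite !(mulrC (2 * pi)).
Qed.

(** Real and imaginary parts are bounded separately, hence [4 * pi] instead of [2 * pi]; this is the
    origin of the factor 2 in [taylor_coef_bound]. *)
Lemma cint_bound u (M : R) : tcont u ->
  (forall t, 0 <= t <= 2 * pi -> nc (u t) <= M) ->
  nc (cint u) <= 4 * pi * M.
Proof.
have p0 : 0 <= 2 * pi :> R by rewrite mulr_ge0// pi_ge0.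
move=> cu uM; apply: le_trans (nc_le _) _.
have -> : 4 * pi * M = M * (2 * pi - 0) + M * (2 * pi - 0) by ring.
apply: lerD; apply: itg_bound => //=.
- exact: tcontRe.
- by move=> t /uM; exact: le_trans (ncRe _).
- exact: tcontIm.
- by move=> t /uM; exact: le_trans (ncIm _).
Qed.

(* Cauchy's theorem on an annulus: in the coordinates zeta = e^(s + it) the
   annulus is a rectangle, and the sides t = 0 and t = 2 pi cancel out. *)
Lemma cint_annulus G a b : a <= b -> (forall z, z != 0 -> ccont G z) ->
  (forall s t, a <= s <= b -> cdiff G (polar s t)) ->
  cint (fun t => G (polar a t)) = cint (fun t => G (polar b t)).
Proof.
move=> ab cG dG.
have p0 : 0 <= 2 * pi :> R by rewrite mulr_ge0// pi_ge0.
have ct s : tcont (fun t => G (polar s t)).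
  by apply: tcont_polar => t; apply: cG; exact: polar_neq0.
have cs t : tcont (fun s => G (polar s t)).
  move=> s e /(cG _ (polar_neq0 s t))[d d0 H].
  have [d' d'0 H'] := polar_cont s t d0.
  by exists d' => // s' s's; apply/H/H' => //; rewrite subrr normr0.
(* The chain rule: [G] composed with [polar] has complex derivative [l * polar s t] in [s + i t],
   where [l] is the derivative of [G]. *)
have D s t : a <= s <= b -> exists x y : R, forall e : R, 0 < e ->
  exists2 d : R, 0 < d & forall s' t', `|s' - s| < d -> `|t' - t| < d ->
    nc (G (polar s' t') - G (polar s t) - (x +i* y) * ((s' - s) +i* (t' - t)))
      <= e * (`|s' - s| + `|t' - t|).
  move=> /(dG _ t)[l Hl]; exists (complex.Re (l * polar s t)), (complex.Im (l * polar s t)).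
  move=> e e0; rewrite (_ : _ +i* _ = l * polar s t); last by case: (l * _).
  pose q := 1 + expR s; have q0 : 0 < q by rewrite addr_gt0// expR_gt0.
  have e20 : 0 < e / 2 by rewrite divr_gt0.
  have nl0 : 0 < 1 + nc l by rewrite ltr_pwDl// nc_ge0.
  have [d1 d10 H1] := Hl (e / 2 / q) (divr_gt0 e20 q0).
  have [d2 d20 H2] := polar_cont s t d10.
  have [d3 d30 H3] := polar_deriv s t (ltr01 : 0 < 1 :> R).
  have [d4 d40 H4] := polar_deriv s t (divr_gt0 e20 nl0).
  exists (Num.min (Num.min d2 d3) d4); first by rewrite !lt_min d20 d30.
  move=> s' t'; rewrite !lt_min => /andP[/andP[s2 s3] s4] /andP[/andP[t2 t3] t4].
  have {H1} H1 := H1 _ (H2 _ _ s2 t2); have {H3} H3 := H3 _ _ s3 t3.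
  have {H4} H4 := H4 _ _ s4 t4.
  set h := _ +i* _ in H3 H4 *; set p := polar s' t' - polar s t in H1 H3 H4 *.
  have hle : nc h <= `|s' - s| + `|t' - t| := nc_le h.
  set N := _ + _ in hle H3 H4 *.
  have ple : nc p <= q * N.
    rewrite -(subrK (polar s t * h) p); apply: le_trans (ncD _ _) _.
    rewrite mulrDl; apply: lerD => //.
    by rewrite Normc.normcM nc_polar; apply: ler_wpM2l => //; exact: expR_ge0.
  rewrite -[X in nc X](subrKA (l * p)); apply: le_trans (ncD _ _) _.
  rewrite [X in _ <= X * _](splitr e) mulrDl; apply: lerD.
    apply: le_trans H1 _; rewrite mulrAC -mulrA; apply: ler_wpM2l.
      by rewrite divr_ge0// ltW.
    by rewrite ler_pdivrMr// mulrC.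
  rewrite -mulrA -mulrBr Normc.normcM.
  apply: le_trans (ler_wpM2l (nc_ge0 l) H4) _.
  rewrite mulrA; apply: ler_wpM2r; first by rewrite /N addr_ge0.
  rewrite mulrCA ler_piMr ?divr_ge0 ?(ltW e0)//.
  by rewrite ler_pdivrMr// mul1r lerDr.
have per s : polar s (2 * pi) = polar s 0 := polar2pi s.
(* Cauchy-Riemann in the coordinates [(s, t)]: for the derivative [x +i* y], the coefficient shared
   by the pair [(Re G, Im G)] is [x], and the one shared by [(Im G, - Re G)] is [y]. *)
rewrite /cint; congr (_ +i* _); apply/esym/eqP; rewrite -subr_eq0; apply/eqP.
  rewrite (@goursat _ (fun s t => complex.Re (G (polar s t)))
    (fun s t => complex.Im (G (polar s t)))) //.
  - apply/eqP; rewrite subr_eq0; apply/eqP; congr itg.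
    by apply/funext => s /=; rewrite per.
  - by move=> s; exact: (tcontRe (ct s)).
  - by move=> t; exact: (tcontIm (cs t)).
  - move=> s t sab _; have [x [y H]] := D s t sab; exists x, (- y), y => e e0.
    have [d d0 {}H] := H e e0; exists d => // s' t' sd td.
    have {}H := H s' t' sd td; split; apply: le_trans H;
      [apply: le_trans (ncRe _)|apply: le_trans (ncIm _)];
      case: (G (polar s' t')) (G (polar s t)) => [x1 x2] [y1 y2]/=;
      rewrite le_eqVlt; apply/orP; left; apply/eqP; congr (`| _ |); ring.
rewrite (@goursat _ (fun s t => complex.Im (G (polar s t)))
    (fun s t => - complex.Re (G (polar s t)))) //.
- apply/eqP; rewrite subr_eq0; apply/eqP; congr itg.
  by apply/funext => s /=; rewrite per.
- by move=> s; exact: (tcontIm (ct s)).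
- by move=> t x; apply: cvgN; exact: (tcontRe (cs t)).
- move=> s t sab _; have [x [y H]] := D s t sab; exists y, x, (- x) => e e0.
  have [d d0 {}H] := H e e0; exists d => // s' t' sd td.
  have {}H := H s' t' sd td; split; apply: le_trans H;
    [apply: le_trans (ncIm _)|apply: le_trans (ncRe _); rewrite -normrN];
    case: (G (polar s' t')) (G (polar s t)) => [x1 x2] [y1 y2]/=;
    rewrite le_eqVlt; apply/orP; left; apply/eqP; congr (`| _ |); ring.
Qed.

End circle_integral.

Section mean_value.
Context (R : realType).
Local Notation C := R[i].
Implicit Types (G f : C -> C).

Lemma circle_uniform G s (e : R) : (forall z, ccont G z) -> 0 < e ->
  exists2 d : R, 0 < d & forall s', `|s' - s| < d ->
    forall t, 0 <= t <= 2 * pi -> nc (G (polar s' t) - G (polar s t)) <= e.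
Proof.
move=> cG e0.
have /compact_near_coveringP := @segment_compact R 0 (2 * pi).
move=> /(_ R (nbhs s) (fun s' t => nc (G (polar s' t) - G (polar s t)) <= e) _).
case.
  move=> t _.
  have e20 : 0 < e / 2 by rewrite divr_gt0.
  have [d d0 H] := cG (polar s t) _ e20.
  have [d' d'0 H'] := polar_cont s t d0.
  exists (ball t d', ball s d').
    by split; apply: nbhsx_ballx.
  move=> [t' s'] [/=]; rewrite /ball/= distrC => tt'; rewrite distrC => ss'.
  apply: le_trans (nc_triB _ (G (polar s t)) _) _.
  rewrite [e]splitr; apply: lerD; first by apply/ltW/H/H'.
  by rewrite ncC; apply/ltW/H/H' => //; rewrite subrr normr0.
move=> d /= d0 H; exists d => // s' ss' t t2.
by apply: (H s'); rewrite /= 1?distrC// in_itv.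
Qed.

Lemma circle_bound G s : (forall z, ccont G z) ->
  exists M : R, forall t, 0 <= t <= 2 * pi -> nc (G (polar s t)) <= M.
Proof.
move=> cG.
have ct : tcont (fun t => G (polar s t)) by apply: tcont_polar.
have /compact_near_coveringP := @segment_compact R 0 (2 * pi).
move=> /(_ R +oo%R (fun M t => nc (G (polar s t)) <= M) _)[].
  move=> t _; have [d d0 H] := ct t 1 ltr01.
  exists (ball t d, [set M : R | nc (G (polar s t)) + 1 < M]).
    split; first exact: nbhsx_ballx.
    by exists (nc (G (polar s t)) + 1); split=> //; rewrite num_real.
  move=> [t' M] [/=]; rewrite /ball/= distrC => /H tt' /ltW; apply: le_trans.
  rewrite -(subrK (G (polar s t)) (G (polar s t'))).
  by apply: le_trans (ncD _ _) _; rewrite addrC lerD// ltW.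
move=> M [Mr H]; exists (M + 1) => t t2.
by apply: (H (M + 1)); rewrite /= ?ltrDl// in_itv.
Qed.

(** A removable singularity at [z0] is dealt with here. Only the circle at [p = ln (nc z0)] can meet
    [z0]; by [cint_annulus] the integral is constant on each side of [p], by continuity in [s] the
    two constants agree, and [s -> -oo] identifies them with the value at 0. *)
Lemma cint_mean G z0 : (forall z, ccont G z) -> (forall z, z != z0 -> cdiff G z) ->
  forall s, cint (fun t => G (polar s t)) = (2 * pi)%:C * G 0.
Proof.
move=> cG dG.
have pi40 : 0 < 4 * pi :> R by rewrite mulr_gt0// pi_gt0.
pose m s := cint (fun t => G (polar s t)).
have ct s : tcont (fun t => G (polar s t)) by apply: tcont_polar.
have [p Hp] : exists p : R, forall s t, s != p -> polar s t != z0.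
  exists (ln (nc z0)) => s t; apply: contra_neq => <-.
  by rewrite nc_polar expRK.
have mC a b : a <= b -> (b < p) || (p < a) -> m a = m b.
  move=> ab H; apply: cint_annulus => // s t /andP[as_ sb]; apply/dG/Hp.
  by apply/eqP => sp; move: H; rewrite -sp !ltNge as_ sb.
have mlim (e : R) : 0 < e -> exists S, forall s, s <= S -> nc (m s - (2 * pi)%:C * G 0) <= e.
  move=> e0; have [d d0 H] := cG 0 _ (divr_gt0 e0 pi40).
  exists (ln (d / 2)) => s sS.
  have tc : tcont (fun=> G 0) by move=> t e' e'0; exists 1 => // *; rewrite subrr Normc.normc0.
  rewrite -cint_cst -cintB//.
  have -> : e = 4 * pi * (e / (4 * pi)) by rewrite mulrCA divff ?mulr1// gt_eqF.
  apply: cint_bound; first exact: tcontB.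
  move=> t _; apply/ltW/H; rewrite subr0 nc_polar.
  apply: le_lt_trans (_ : expR (ln (d / 2)) < _); first by rewrite ler_expR.
  by rewrite lnK ?posrE ?divr_gt0//; lra.
have mcont s (e : R) : 0 < e -> exists2 d : R, 0 < d & forall s', `|s' - s| < d -> nc (m s' - m s) <= e.
  move=> e0; have [d d0 H] := circle_uniform s cG (divr_gt0 e0 pi40).
  exists d => // s' /H {}H; rewrite -cintB//.
  have -> : e = 4 * pi * (e / (4 * pi)) by rewrite mulrCA divff ?mulr1// gt_eqF.
  by apply: cint_bound; first exact: tcontB.
have mlt s : s < p -> m s = (2 * pi)%:C * G 0.
  move=> sp; apply/eqP; rewrite -subr_eq0; apply/eqP/nc_eps0 => e e0.
  have [S HS] := mlim e e0.
  rewrite -(mC (Num.min s S)) ?sp//; last by rewrite ge_min lexx.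
  by apply: HS; rewrite ge_min lexx orbT.
have mp : m p = (2 * pi)%:C * G 0.
  apply/eqP; rewrite -subr_eq0; apply/eqP/nc_eps0 => e e0.
  have [d d0 H] := mcont p e e0.
  rewrite -(mlt (p - d / 2)); last by rewrite ltrBlDr ltrDl divr_gt0.
  rewrite ncC; apply: H.
  by rewrite addrAC subrr sub0r normrN gtr0_norm ?divr_gt0//; lra.
move=> s; case: (ltgtP s p) => [/mlt//|ps|->//].
apply/eqP; rewrite -subr_eq0 -mp; apply/eqP/nc_eps0 => e e0.
have [d d0 H] := mcont p e e0.
rewrite -[cint _]/(m s) -(mC (Num.min s (p + d / 2)) s).
- apply: H; have : p < Num.min s (p + d / 2) by rewrite lt_min ps ltrDl divr_gt0.
  have : Num.min s (p + d / 2) <= p + d / 2 by rewrite ge_min lexx orbT.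
  by rewrite ltr_norml; lra.
- by rewrite ge_min lexx.
- by rewrite lt_min ps ltrDl divr_gt0// orbT.
Qed.

End mean_value.

(** * Taylor expansion of an entire function *)

Section taylor.
Context (R : realType).
Local Notation C := R[i].

Lemma tcontM (u v : R -> C) : tcont u -> tcont v -> tcont (fun t => u t * v t).
Proof.
move=> cu cv t e e0; pose p := nc (u t) + 1; pose q := nc (v t) + 1.
have p0 : 0 < p by rewrite ltr_wpDl// nc_ge0.
have q0 : 0 < q by rewrite ltr_wpDl// nc_ge0.
have e20 : 0 < e / 2 by rewrite divr_gt0.
have [d1 d10 H1] := cu t _ (divr_gt0 e20 q0).
have [d2 d20 H2] := cv t _ (divr_gt0 e20 p0).
have [d3 d30 H3] := cv t 1 ltr01.
exists (Num.min (Num.min d1 d2) d3); first by rewrite !lt_min d10 d20.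
move=> t'; rewrite !lt_min => /andP[/andP[/H1 {}H1 /H2 {}H2] /H3 {}H3].
have -> : u t' * v t' - u t * v t = (u t' - u t) * v t' + u t * (v t' - v t) by ring.
apply: le_lt_trans (ncD _ _) _; rewrite !Normc.normcM [e]splitr.
have vq : nc (v t') <= q.
  rewrite -(subrK (v t) (v t')); apply: le_trans (ncD _ _) _.
  by rewrite addrC lerD2l ltW.
apply: ltr_leD.
  rewrite ltr_pdivlMr// in H1; apply: le_lt_trans H1.
  by apply: ler_wpM2l; rewrite ?nc_ge0.
rewrite ltr_pdivlMr// in H2; apply: le_trans (ltW H2); rewrite mulrC.
by apply: ler_wpM2l; rewrite ?nc_ge0// /p lerDl.
Qed.

Definition polarV k s t : C := (polar s t)^-1 ^+ k.

Lemma cdiff_powV k z : z != 0 -> cdiff (fun w : C => w^-1 ^+ k) z.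
Proof. by move=> z0; apply/cdiffX/cdiffV => //; exact: cdiff_id. Qed.

Lemma tcont_polarV k s : tcont (polarV k s).
Proof.
apply: (@tcont_polar _ (fun z => z^-1 ^+ k)) => t.
by apply/cdiff_ccont/cdiff_powV/polar_neq0.
Qed.

Lemma nc_polarV k s t : nc (polarV k s t) = expR (- s) ^+ k.
Proof. by rewrite ncX Normc.normcV nc_polar expRN. Qed.

Let pi20 : 0 < 2 * pi :> R. Proof. by rewrite mulr_gt0// pi_gt0. Qed.

Let pi40 : 0 < 4 * pi :> R. Proof. by rewrite mulr_gt0// pi_gt0. Qed.

Lemma cint_powV (f : C -> C) k s s' : (forall z, cdiff f z) ->
  cint (fun t => polarV k s t * f (polar s t)) =
  cint (fun t => polarV k s' t * f (polar s' t)).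
Proof.
move=> df.
have D z : z != 0 -> cdiff (fun z => z^-1 ^+ k * f z) z.
  by move=> z0; apply: cdiffM => //; exact: cdiff_powV.
wlog ss' : s s' / s <= s' => [H|].
  by case/orP : (le_total s s') => /H.
apply: (@cint_annulus _ (fun z => z^-1 ^+ k * f z)) => //.
  by move=> z /D; exact: cdiff_ccont.
by move=> s1 t _; apply/D/polar_neq0.
Qed.

(** By [cint_powV] the radius is free, and the integrand tends to 0 as the radius grows. *)
Lemma cint_polarV k s : (0 < k)%N -> cint (polarV k s) = 0.
Proof.
move=> k0; apply: nc_eps0 => e e0.
have E s' : polarV k s' = fun t => polarV k s' t * 1 by apply/funext => t; rewrite mulr1.
pose s' := Num.max 0 (- ln (e / (4 * pi))).
rewrite E (cint_powV (f := fun=> 1) k s s')-?E; last by move=> z; exact: cdiff_cst.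
have -> : e = 4 * pi * (e / (4 * pi)) by rewrite mulrCA divff ?mulr1// gt_eqF.
apply: cint_bound; first exact: tcont_polarV.
move=> t _; rewrite nc_polarV.
have h1 : expR (- s') <= e / (4 * pi).
  rewrite -[leRHS]lnK ?posrE ?divr_gt0// ler_expR.
  by rewrite lerNl le_max lexx orbT.
apply: le_trans h1; rewrite -[leRHS]expr1; apply: ler_wiXn2l; rewrite ?expR_ge0//.
by rewrite -expR0 ler_expR oppr_le0 le_max lexx.
Qed.

(* The coefficients are taken on the unit circle; by Cauchy's theorem every
   circle around 0 gives the same ones. *)
Definition taylor_coef (f : C -> C) k : C :=
  (2 * pi)%:C^-1 * cint (fun t => polarV k 0 t * f (polar 0 t)).

Variable f : C -> C.
Hypothesis df : forall z, cdiff f z.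
Let a := taylor_coef f.

Let tcf k s : tcont (fun t => polarV k s t * f (polar s t)).
Proof.
apply: tcontM; first exact: tcont_polarV.
by apply: tcont_polar => t; apply: cdiff_ccont.
Qed.

Let cint_coef k s :
  cint (fun t => polarV k s t * f (polar s t)) = (2 * pi)%:C * a k.
Proof.
rewrite /a /taylor_coef mulrA divff ?mul1r; first exact: cint_powV.
by rewrite -nc_eq0 ncR normr_eq0 gt_eqF.
Qed.

Lemma taylor_coef_bound (r M : R) k : 0 < r ->
  (forall z, nc z = r -> nc (f z) <= M) -> nc (a k) * r ^+ k <= 2 * M.
Proof.
move=> r0 fM.
have rE : expR (ln r) = r by rewrite lnK ?posrE.
have H : nc (cint (fun t => polarV k (ln r) t * f (polar (ln r) t))) <= 4 * pi * (r^-1 ^+ k * M).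
  apply: cint_bound => // t _; rewrite Normc.normcM nc_polarV expRN rE.
  by apply: ler_wpM2l; rewrite ?exprn_ge0 ?invr_ge0 ?(ltW r0)// fM// nc_polar.
rewrite cint_coef Normc.normcM ncR gtr0_norm// in H.
have -> : 2 * M = (2 * pi)^-1 * (4 * pi * (r^-1 ^+ k * M)) * r ^+ k.
  have p0 := @pi_gt0 R; have := exprn_gt0 k r0; rewrite exprVn.
  by move: p0 (r ^+ k); move: pi => p p0 x x0; field; rewrite !gt_eqF.
by apply: ler_wpM2r; rewrite ?exprn_ge0 ?(ltW r0)// ler_pdivlMl.
Qed.

Section expansion.
Variable z0 : C.

(** The difference quotient of [f] at [z0], completed by the derivative and multiplied by [z]
    because [cint] integrates against [dz / (i z)]. Since [G 0 = 0], [cint_mean] makes its integral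
    vanish, which is Cauchy's formula at [z0]. *)
Let G z : C := if z == z0 then z0 * xget 0 (cderiv f z0) else z * ((f z - f z0) / (z - z0)).

Let dG z : z != z0 -> cdiff G z.
Proof.
move=> zz0; apply: (@cdiff_near _ (fun z => z * ((f z - f z0) / (z - z0)))).
  exists (nc (z - z0)); first by rewrite nc_gt0 subr_eq0.
  by move=> w; rewrite /G ncC; case: eqVneq => // ->; rewrite ltxx.
apply: cdiffM; first exact: cdiff_id.
apply: cdiffM; first by apply: cdiffB => //; exact: cdiff_cst.
by apply: cdiffV; rewrite ?subr_eq0//; apply: cdiffB; [exact: cdiff_id|exact: cdiff_cst].
Qed.

Let cG z : ccont G z.
Proof.
case: (eqVneq z z0) => [->|zz0]; last by apply/cdiff_ccont/dG.
have [l0 Hl0] := df z0.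
have Hl : cderiv f z0 (xget 0 (cderiv f z0)) by apply: xgetPex; exists l0.
rewrite /ccont /G eqxx; set l := xget _ _ in Hl *.
move=> e e0.
pose p := nc z0 + 1; have p0 : 0 < p by rewrite ltr_wpDl// nc_ge0.
pose q := nc l + 1; have q0 : 0 < q by rewrite ltr_wpDl// nc_ge0.
have e20 : 0 < e / 2 by rewrite divr_gt0.
have [d d0 H] := Hl _ (divr_gt0 e20 p0).
exists (Num.min d (Num.min 1 (e / 2 / q))); first by rewrite !lt_min d0 ltr01 divr_gt0.
move=> w; rewrite !lt_min => /and3P[wd w1 wq].
case: eqVneq => [_|wz]; first by rewrite subrr Normc.normc0.
have wz' : w - z0 != 0 by rewrite subr_eq0.
have -> : w * ((f w - f z0) / (w - z0)) - z0 * l =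
    w * ((f w - f z0 - l * (w - z0)) / (w - z0)) + (w - z0) * l.
  by field.
apply: le_lt_trans (ncD _ _) _; rewrite [e]splitr; apply: ler_ltD.
  rewrite 2!Normc.normcM Normc.normcV.
  have wp : nc w <= p.
    by rewrite -(subrK z0 w) addrC; apply: le_trans (ncD _ _) _; rewrite lerD2l ltW.
  have -> : e / 2 = p * (e / 2 / p) by rewrite mulrCA divff ?mulr1// gt_eqF.
  apply: ler_pM => //; rewrite ?divr_ge0 ?nc_ge0//.
  by rewrite ler_pdivrMr ?nc_gt0// H.
rewrite Normc.normcM; rewrite ltr_pdivlMr// in wq.
by apply: le_lt_trans wq; apply: ler_wpM2l; rewrite ?nc_ge0// lerDl.
Qed.

Let J k s := cint (fun t => polarV k s t * G (polar s t)).

Let tcG k s : tcont (fun t => polarV k s t * G (polar s t)).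
Proof. by apply: tcontM; [exact: tcont_polarV|exact: tcont_polar]. Qed.

(** This is [G = f - f z0 + z0 * G / z], valid off [z0], divided by [z ^+ k] and integrated.
    Iterating it from [J 0 s = 0] produces the Taylor polynomial together with an exact
    remainder. *)
Let JS k s : nc z0 < expR s ->
  J k s = (2 * pi)%:C * a k - f z0 * cint (polarV k s) + z0 * J k.+1 s.
Proof.
move=> zs; rewrite -(cint_coef k s) -cintZ; last exact: tcont_polarV.
rewrite -cintB; [|exact: tcf|exact/tcontZ/tcont_polarV].
rewrite -[X in _ + X]opprK -mulNr -cintZ; last exact: tcG.
rewrite -cintB; last 2 first.
- by apply: tcontB; [exact: tcf|exact/tcontZ/tcont_polarV].
- exact/tcontZ/tcG.
congr cint; apply/funext => t; rewrite /polarV exprS /G.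
have pz : polar s t != z0 by apply/eqP => E; rewrite -E nc_polar ltxx in zs.
rewrite (negPf pz); have := polar_neq0 s t; move: pz; rewrite -subr_eq0.
move: (polar s t) => w wz w0; rewrite exprVn.
by field; rewrite wz w0 expf_neq0.
Qed.

Let J0 s : nc z0 < expR s -> J 0 s = 0.
Proof.
move=> zs; rewrite /J (_ : (fun t => _) = fun t => G (polar s t)); last first.
  by apply/funext => t; rewrite /polarV expr0 mul1r.
rewrite (@cint_mean _ G z0)//; rewrite /G; case: eqVneq => [<-|_].
  by rewrite mul0r mulr0.
by rewrite mul0r mulr0.
Qed.

Let remainder k s : nc z0 < expR s ->
  (2 * pi)%:C * (f z0 - \sum_(i < k.+1) a i * z0 ^+ i) = z0 ^+ k.+1 * J k.+1 s.
Proof.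
move=> zs; elim: k => [|k IH].
  have := J0 zs; rewrite (JS 0 zs) big_ord1 expr0 mulr1 expr1.
  rewrite (_ : polarV 0 s = fun=> 1) ?cint_cst ?mulr1; last first.
    by apply/funext => t; rewrite /polarV expr0.
  move/eqP; rewrite addrC addr_eq0 => /eqP ->; ring.
rewrite big_ord_recr/= opprD addrA mulrDr IH (JS _ zs) cint_polarV// mulr0 subr0.
by rewrite (exprSr _ k.+1); ring.
Qed.

Lemma taylor_cvg (e : R) : 0 < e -> exists K0, forall K, (K0 <= K)%N ->
  nc (f z0 - \sum_(i < K) a i * z0 ^+ i) <= e.
Proof.
(* On the circle of radius [2 * nc z0 + 1] the quotient of [nc z0] by the radius is at most 1/2, so
   the remainder decays geometrically; the summand 1 keeps the radius positive when [z0 = 0]. *)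
move=> e0; pose s := ln (2 * nc z0 + 1).
have n0 := nc_ge0 z0.
have sE : expR s = 2 * nc z0 + 1 by rewrite lnK// posrE; lra.
have zs : nc z0 < expR s by rewrite sE; lra.
have [M HM] := circle_bound s cG.
have M0 : 0 <= M by apply: le_trans (HM 0 _); rewrite ?nc_ge0// lexx ltW.
have [K0 HK] := half_pow_small (2 * M) e0.
exists K0.+1 => -[//|k] Kk.
have R0 := remainder k zs.
have -> : f z0 - \sum_(i < k.+1) a i * z0 ^+ i =
    (2 * pi)%:C^-1 * (z0 ^+ k.+1 * J k.+1 s).
  rewrite -R0 mulrA mulVf ?mul1r// -nc_eq0 ncR normr_eq0 gt_eqF//.
rewrite !Normc.normcM Normc.normcV ncR gtr0_norm// ncX.
apply: le_trans (ltW (HK k.+1 (ltnW Kk))).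
rewrite ler_pdivrMl//.
have JB : nc (J k.+1 s) <= 4 * pi * (expR (- s) ^+ k.+1 * M).
  apply: cint_bound; first exact: tcG.
  move=> t t2; rewrite Normc.normcM nc_polarV; apply: ler_wpM2l; last exact: HM.
  by rewrite exprn_ge0// expR_ge0.
apply: le_trans (ler_wpM2l (exprn_ge0 _ n0) JB) _.
have -> : nc z0 ^+ k.+1 * (4 * pi * (expR (- s) ^+ k.+1 * M)) =
   4 * pi * M * (nc z0 * expR (- s)) ^+ k.+1 by rewrite exprMn; ring.
have -> : 2 * pi * (2 * M * 2^-1 ^+ k.+1) = 4 * pi * M * 2^-1 ^+ k.+1 by ring.
apply: ler_wpM2l; first by rewrite !mulr_ge0// pi_ge0.
rewrite ler_pXn2r// ?nnegrE ?invr_ge0//; last first.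
  by rewrite mulr_ge0// expR_ge0.
by rewrite expRN sE ler_pdivrMr; lra.
Qed.

End expansion.

End taylor.

(** * Averages over roots of unity *)

Section roots_of_unity.
Context (R : realType).
Local Notation C := R[i].

Lemma prim_root_ex n : exists z : C, n.+1.-primitive_root z.
Proof.
have [r Dp] := closed_field_poly_normal ('X^(n.+1) - 1 : {poly C}).
rewrite (monicP _) ?monicXnsubC// scale1r in Dp.
have rn1 : all n.+1.-unity_root r by apply/allP => z; rewrite -root_prod_XsubC -Dp.
have sz : (n.+1 < (size r).+1)%N by rewrite -(size_prod_XsubC r id) -Dp size_XnsubC.
have ur : uniq r by rewrite -separable_prod_XsubC -Dp separable_Xn_sub_1// pnatr_eq0.
by have /hasP[z _ zn] := has_prim_root (ltn0Sn n) rn1 ur sz; exists z.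
Qed.

Definition unity n : C := xget 0 [set z | n.+1.-primitive_root z].

Lemma unityP n : n.+1.-primitive_root (unity n).
Proof. exact: (xgetPex 0 (prim_root_ex n)). Qed.

Lemma nc1_expr n (z : C) : z ^+ n.+1 = 1 -> nc z = 1.
Proof.
move=> /(congr1 (@Normc.normc R)); rewrite ncX Normc.normc1 => /eqP.
by rewrite pexpr_eq1// ?nc_ge0// => /eqP.
Qed.

Lemma nc_unity n i : nc (unity n ^+ i) = 1.
Proof.
by rewrite ncX (nc1_expr (prim_expr_order (unityP n))) expr1n.
Qed.

Lemma unity_neq0 n i : unity n ^+ i != 0.
Proof. by rewrite -nc_eq0 nc_unity oner_eq0. Qed.

Lemma unity_sum n k : \sum_(i < n.+1) (unity n ^+ k) ^+ i =
  if (n.+1 %| k)%N then n.+1%:R else 0.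
Proof.
rewrite (prim_order_dvd (unityP n)); set z := unity n ^+ k.
case: eqVneq => [->|z1].
  by under eq_bigr do rewrite expr1n; rewrite sumr_const card_ord.
apply: (mulfI (_ : z - 1 != 0)); rewrite ?subr_eq0// mulr0 -subrX1.
by rewrite /z exprAC (prim_expr_order (unityP n)) expr1n subrr.
Qed.

(** The [k]-th Fourier coefficient of [g] on the cyclic group of roots of unity of order [n.+1]. *)
Definition dft n k (g : C -> C) : C :=
  n.+1%:R^-1 * \sum_(i < n.+1) (unity n ^+ i)^-1 ^+ k * g (unity n ^+ i).

Lemma nc_nat n : nc (n%:R : C) = n%:R.
Proof. by rewrite -(rmorph_nat (real_complex R)) ncR normr_nat. Qed.

Lemma dft_bound n k (g : C -> C) (M : R) : (forall z, nc z = 1 -> nc (g z) <= M) ->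
  nc (dft n k g) <= M.
Proof.
move=> gM; rewrite Normc.normcM Normc.normcV nc_nat ler_pdivrMl ?ltr0n//.
apply: le_trans (nc_sum _ _ _) _.
rewrite mulr_natl -[X in _ <= _ *+ X]card_ord -sumr_const; apply: ler_sum => i _.
by rewrite Normc.normcM ncX Normc.normcV nc_unity invr1 expr1n mul1r gM// nc_unity.
Qed.

Lemma dftB n k (g g' : C -> C) : dft n k (fun z => g z - g' z) = dft n k g - dft n k g'.
Proof.
rewrite /dft -mulrBr -sumrB; congr (_ * _); apply: eq_bigr => i _.
by rewrite mulrBr.
Qed.

(** Aliasing: powers with exponents congruent modulo [n.+1] agree on the roots of unity. *)
Lemma dft_poly n k K (a : nat -> C) :
  dft n k (fun z => \sum_(m < K) a m * z ^+ m) =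
  \sum_(m < K | (m == k %[mod n.+1])%N) a m.
Proof.
rewrite /dft; under eq_bigr do rewrite mulr_sumr.
rewrite exchange_big/= mulr_sumr [RHS]big_mkcond/=; apply: eq_bigr => m _.
under eq_bigr do rewrite mulrCA.
rewrite -mulr_sumr mulrCA.
(* A natural number congruent to [- k] modulo [n.+1], which turns the inverse powers into powers. *)
pose k' := (n * k)%N.
have kE i : (unity n ^+ i)^-1 ^+ k = (unity n ^+ i) ^+ k'.
  apply: (mulfI (expf_neq0 k (unity_neq0 n i))).
  rewrite -exprMn divff ?unity_neq0// expr1n -exprD -mulSn exprM.
  by rewrite (exprAC _ i) (prim_expr_order (unityP n)) !expr1n.
under eq_bigr => i _ do rewrite kE -exprD -exprM mulnC exprM.
rewrite unity_sum.
have -> : (n.+1 %| k' + m)%N = (m == k %[mod n.+1])%N.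
  by rewrite -(eqn_modDl k') {3}/k' -mulSnr modnMr.
case: ifP => _; last by rewrite !mulr0.
by rewrite mulVf ?mulr1// pnatr_eq0.
Qed.

Lemma geo_half N d : \sum_(N <= m < N + d) 2^-1 ^+ m <= 2 * 2^-1 ^+ N :> R.
Proof.
suff -> : \sum_(N <= m < N + d) 2^-1 ^+ m = 2 * 2^-1 ^+ N - 2 * 2^-1 ^+ (N + d) :> R.
  by rewrite gerBl mulr_ge0// exprn_ge0// invr_ge0.
elim: d => [|d IH]; first by rewrite addn0 big_geq// subrr.
rewrite addnS big_nat_recr ?leq_addr//= IH exprS.
by move: (2^-1 ^+ (N + d)) => x; field.
Qed.

(** By [dft_poly] the error consists of coefficients with exponents above [n], bounded by the
    geometric tail starting at [n.+1]. The series has to be controlled only at the finitely many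
    roots of unity, so a common [K0] exists. *)
Lemma dft_cvg n k (g : C -> C) (a : nat -> C) (M : R) : (k <= n)%N ->
  (forall m, nc (a m) <= M * 2^-1 ^+ m) ->
  (forall z, nc z = 1 -> forall e : R, 0 < e -> exists K0, forall K, (K0 <= K)%N ->
     nc (g z - \sum_(m < K) a m * z ^+ m) <= e) ->
  nc (dft n k g - a k) <= M * 2^-1 ^+ n.
Proof.
move=> kn aM gS; apply/ler_addgt0Pr => e e0.
have M0 : 0 <= M by have := aM 0%N; rewrite expr0 mulr1; apply: le_trans (nc_ge0 _).
have [K0 HK] : exists K0, forall K, (K0 <= K)%N -> forall i : 'I_n.+1,
    nc (g (unity n ^+ i) - \sum_(m < K) a m * (unity n ^+ i) ^+ m) <= e.
  have /choice[K0 HK] := fun i : 'I_n.+1 => gS _ (nc_unity n i) _ e0.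
  exists (\max_i K0 i)%N => K KK i; apply: HK; apply: leq_trans KK.
  exact: leq_bigmax.
pose K := (n.+1 + K0)%N.
have -> : dft n k g - a k = dft n k (fun z => g z - \sum_(m < K) a m * z ^+ m) +
    (\sum_(m < K | (m == k %[mod n.+1])%N) a m - a k).
  by rewrite dftB dft_poly; ring.
apply: le_trans (ncD _ _) _; rewrite addrC; apply: lerD; last first.
  rewrite Normc.normcM Normc.normcV nc_nat ler_pdivrMl ?ltr0n//.
  apply: le_trans (nc_sum _ _ _) _.
  rewrite mulr_natl -[X in _ <= _ *+ X]card_ord -sumr_const; apply: ler_sum => i _.
  rewrite Normc.normcM ncX Normc.normcV nc_unity invr1 expr1n mul1r.
  by apply: HK; rewrite leq_addl.
rewrite -(big_mkord (fun m => (m == k %[mod n.+1])%N) a).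
rewrite (big_cat_nat (n := n.+1))//= ?leq_addr// big_mkord.
have -> : \sum_(m < n.+1 | (m == k %[mod n.+1])%N) a m = a k.
  rewrite (big_pred1 (Ordinal (kn : (k < n.+1)%N)))// => m /=.
  by rewrite !modn_small ?ltnS// -1?ltnS// -val_eqE.
rewrite addrAC subrr add0r; apply: le_trans (nc_sum _ _ _) _.
apply: (@le_trans _ _ (\sum_(n.+1 <= m < n.+1 + K0) M * 2^-1 ^+ m)).
  rewrite big_mkcond/=; apply: ler_sum => m _; case: ifP => _ //.
  by rewrite mulr_ge0// exprn_ge0// invr_ge0.
rewrite -mulr_sumr; apply: ler_wpM2l => //; apply: le_trans (geo_half _ _) _.
by rewrite exprS mulrA divff// mul1r.
Qed.

(** Orthogonality of the characters of the cyclic group. Applied at each point of the space and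
    integrated, it gives [dcomp_parseval]. *)
Lemma dft_parseval n (g : C -> C) :
  \sum_(k < n.+1) nc (dft n k g) ^+ 2 =
  n.+1%:R^-1 * \sum_(i < n.+1) nc (g (unity n ^+ i)) ^+ 2.
Proof.
have sq (z : C) : ((nc z) ^+ 2)%:C = z * conjc z by rewrite rmorphXn/= -nc_def sqr_normc.
apply: complexI; rewrite rmorph_sum/= rmorphM/= fmorphV rmorph_nat rmorph_sum/=.
under eq_bigr do rewrite sq; under [in RHS]eq_bigr do rewrite sq.
pose w := unity n.
have cw i : conjc (w ^+ i) = (w ^+ i)^-1.
  apply: (mulfI (unity_neq0 n i)); rewrite divff ?unity_neq0//.
  by rewrite -sq nc_unity expr1n.
have conjM (x y : C) : conjc (x * y) = conjc x * conjc y by rewrite rmorphM.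
have conjX (x : C) m : conjc (x ^+ m) = conjc x ^+ m by rewrite rmorphXn.
have conjS (F : 'I_n.+1 -> C) : conjc (\sum_i F i) = \sum_i conjc (F i) by rewrite rmorph_sum.
have cj : conjc (n.+1%:R^-1 : C) = n.+1%:R^-1 by rewrite conjc_inv conjc_nat.
have E k : dft n k g * conjc (dft n k g) = n.+1%:R^-1 * n.+1%:R^-1 *
    \sum_(i < n.+1) \sum_(j < n.+1) (w ^+ j / w ^+ i) ^+ k * (g (w ^+ i) * conjc (g (w ^+ j))).
  rewrite /dft conjM cj mulrACA; congr (_ * _).
  rewrite conjS mulr_suml; apply: eq_bigr => i _.
  rewrite mulr_sumr; apply: eq_bigr => j _.
  by rewrite conjM conjX conjc_inv cw invrK exprMn; ring.
under eq_bigr do rewrite E.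
rewrite -mulr_sumr -mulrA; congr (_ * _).
rewrite exchange_big/= mulr_sumr; apply: eq_bigr => i _.
rewrite exchange_big/= (bigD1 i)//= [X in _ * (_ + X)]big1 ?addr0.
  under eq_bigr do rewrite divff ?unity_neq0// expr1n mul1r.
  by rewrite sumr_const card_ord -[X in _ * X]mulr_natl mulrA mulVf ?mul1r// pnatr_eq0.
move=> j ji; rewrite -mulr_suml; apply/eqP; rewrite mulf_eq0; apply/orP; left; apply/eqP.
apply: (mulfI (_ : w ^+ j / w ^+ i - 1 != 0)).
  rewrite subr_eq0; apply: contra ji => /eqP H.
  have : w ^+ j == w ^+ i by rewrite -(divfK (unity_neq0 n i) (w ^+ j)) H mul1r.
  by rewrite (eq_prim_root_expr (unityP n)) !modn_small// -val_eqE.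
rewrite mulr0 -subrX1 expr_div_n -!exprM !(mulnC _ n.+1) !exprM.
by rewrite (prim_expr_order (unityP n)) !expr1n divr1 subrr.
Qed.

End roots_of_unity.

Section one_variable.
Context (R : realType) (g : R[i] -> R[i]) (B : R).
Local Notation C := R[i].
Hypothesis dg : forall z, cdiff g z.
Hypothesis gB : forall z, nc z = 1 -> nc (g z) <= B.

Let aB k : nc (taylor_coef g k) <= 2 * B.
Proof. by have := taylor_coef_bound dg k ltr01 gB; rewrite expr1n mulr1. Qed.

Let B0 : 0 <= B.
Proof. by have := aB 0; have := nc_ge0 (taylor_coef g 0); lra. Qed.

Lemma taylor_coef0 : taylor_coef g 0 = g 0.
Proof.
apply/eqP; rewrite eq_sym -subr_eq0; apply/eqP/nc_eps0 => e e0.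
have [K0 H] := taylor_cvg dg 0 e0; have := H K0.+1 (leqnSn _).
rewrite big_ord_recl expr0 mulr1 big1 ?addr0// => i _.
by rewrite expr0n mulr0.
Qed.

(** The coefficients are at most [2 * B] by the Cauchy estimate on the unit circle; for
    [nc z <= 2^-1] the tail from degree 2 on is at most [2 * B * nc z ^+ 2] times a geometric sum
    bounded by 2. *)
Lemma taylor_order1 z : nc z <= 2^-1 ->
  nc (g z - g 0 - taylor_coef g 1 * z) <= 4 * B * nc z ^+ 2.
Proof.
move=> z2; apply/ler_addgt0Pr => e e0.
have [K0 H] := taylor_cvg dg z e0; have {H} := H K0.+2 (leqW (leqnSn _)).
rewrite !big_ord_recl/= expr0 mulr1 expr1 taylor_coef0.
set S := \sum_(i < _) _ => H.
have -> : g z - g 0 - taylor_coef g 1 * z = g z - (g 0 + (taylor_coef g 1 * z + S)) + S.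
  by ring.
apply: le_trans (ncD _ _) _; rewrite addrC; apply: lerD => //.
apply: le_trans (nc_sum _ _ _) _.
apply: (@le_trans _ _ (\sum_(i < K0) 2 * B * nc z ^+ 2 * 2^-1 ^+ i)).
  apply: ler_sum => i _; rewrite Normc.normcM ncX.
  have -> : bump 0 (bump 0 i) = (i + 2)%N by rewrite addn2.
  rewrite exprD.
  rewrite -mulrA (mulrC (nc z ^+ 2)).
  apply: ler_pM; rewrite ?nc_ge0 ?mulr_ge0 ?exprn_ge0 ?nc_ge0//.
  apply: ler_wpM2r; first by rewrite exprn_ge0// nc_ge0.
  by apply: lerXn2r; rewrite ?nnegrE ?nc_ge0.
rewrite -mulr_sumr.
have := geo_half R 0 K0; rewrite add0n expr0 mulr1 big_mkord => G2.
have -> : 4 * B * nc z ^+ 2 = 2 * B * nc z ^+ 2 * 2 by ring.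
by apply: ler_wpM2l => //; rewrite !mulr_ge0 ?nc_ge0.
Qed.

(** Identifies the directional derivatives in [entire_lim] with the coefficients that occur in
    [taylor_order1]. *)
Lemma cderiv_taylor_coef l : cderiv g 0 l -> taylor_coef g 1 = l.
Proof.
move=> gl; apply/eqP; rewrite -subr_eq0; apply/eqP/nc_eps0 => e e0.
have e20 : 0 < e / 2 by rewrite divr_gt0.
have [d d0 H] := gl _ e20.
have B1 : 0 < 4 * B + 1 by have := B0; lra.
have [r [r0 r1 r2 r3]] : exists r : R, [/\ 0 < r, r < d, r <= 2^-1 & (4 * B + 1) * r <= e / 2].
  exists (Num.min (d / 2) (Num.min 2^-1 (e / 2 / (4 * B + 1)))).
  set m := Num.min _ _.
  have m0 : 0 < m by rewrite !lt_min invr_gt0 !divr_gt0 //= ltr0n.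
  have m1 : m <= d / 2 by rewrite ge_min lexx.
  have m2 : m <= 2^-1 by rewrite !ge_min lexx orbT.
  have m3 : m <= e / 2 / (4 * B + 1) by rewrite !ge_min lexx !orbT.
  split => //; first by lra.
  by rewrite mulrC -ler_pdivlMr.
have nr : nc r%:C = r by rewrite ncR gtr0_norm.
have := H r%:C; rewrite subr0 nr => /(_ r1) H1.
have := @taylor_order1 r%:C; rewrite nr => /(_ r2) H2.
rewrite -(ler_pM2r r0) -[X in _ * X <= _]nr -Normc.normcM.
have -> : (taylor_coef g 1 - l) * r%:C =
  (g r%:C - g 0 - l * r%:C) - (g r%:C - g 0 - taylor_coef g 1 * r%:C) by ring.
apply: le_trans (ncB _ _) _; apply: le_trans (lerD H1 H2) _.
have -> : e * r = e / 2 * r + e / 2 * r by field.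
rewrite lerD2l expr2 mulrA; apply: ler_wpM2r; first exact: ltW.
by apply: le_trans r3; apply: ler_wpM2r; [exact: ltW|rewrite lerDl].
Qed.

End one_variable.

Lemma complex_cauchy (R : realType) (u : nat -> R[i]) :
  (forall e : R, 0 < e -> exists N, forall m k, (N <= m)%N -> (N <= k)%N ->
     nc (u m - u k) <= e) ->
  exists l, forall e : R, 0 < e -> exists N, forall m, (N <= m)%N -> nc (u m - l) <= e.
Proof.
move=> H.
have cR (v : nat -> R) : (forall e : R, 0 < e -> exists N, forall m k, (N <= m)%N ->
    (N <= k)%N -> `|v m - v k| <= e) -> exists l : R, forall e : R, 0 < e ->
    exists N, forall m, (N <= m)%N -> `|v m - l| <= e.
  move=> Hv; have /cvg_ex[l /cvgrPdist_le lv] : cvgn v.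
    apply: cauchy_cvg; apply/cauchy_ballP => e e0.
    have [N HN] := Hv (e / 2) (divr_gt0 e0 (ltr0Sn R 1)).
    exists (v @` [set m | (N <= m)%N], v @` [set m | (N <= m)%N]).
      by split; exists N => // m Nm; exists m.
    move=> [_ _] [[m Nm <-] [k Nk <-]]; rewrite /ball/=.
    by apply: le_lt_trans (HN m k Nm Nk) _; rewrite ltr_pdivrMr// ltr_pMr// ltr1n.
  exists l => e /lv[N _ HN]; exists N => m Nm; rewrite distrC; exact: HN.
have [|x Hx] := cR (fun m => complex.Re (u m)).
  move=> e /H[N HN]; exists N => m k Nm Nk; apply: le_trans (HN m k Nm Nk).
  by apply: le_trans (ncRe _); case: (u m) (u k) => [? ?] [? ?].
have [|y Hy] := cR (fun m => complex.Im (u m)).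
  move=> e /H[N HN]; exists N => m k Nm Nk; apply: le_trans (HN m k Nm Nk).
  by apply: le_trans (ncIm _); case: (u m) (u k) => [? ?] [? ?].
exists (x +i* y) => e e0; have e20 : 0 < e / 2 by rewrite divr_gt0.
have [N1 H1] := Hx _ e20; have [N2 H2] := Hy _ e20.
exists (maxn N1 N2) => m; rewrite geq_max => /andP[m1 m2].
apply: le_trans (nc_le _) _; rewrite [e]splitr; apply: lerD.
  by have := H1 m m1; case: (u m).
by have := H2 m m2; case: (u m).
Qed.

(** * Entire functions of several variables *)

Section space.
Context (R : realType) (n : nat).
Local Notation C := R[i].
Local Notation E := 'cV[C]_n.
Implicit Types (z w : E) (i j : 'I_n).

(** The norm of a column is its maximum norm, with values in [R[i]]; this is the same number as an
    element of [R]. *)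
Definition en z : R := complex.Re `|z|.

Lemma enE z : `|z| = (en z)%:C.
Proof.
by rewrite /en RRe_real// normr_real.
Qed.

Lemma en_ge0 z : 0 <= en z.
Proof. by rewrite -lecR -enE; exact: normr_ge0. Qed.

Lemma en_lt z (r : R) : 0 < r -> en z < r <-> forall i, nc (z i ord0) < r.
Proof.
move=> r0.
have -> : en z < r = (`|0 - z| < r%:C) by rewrite sub0r normrN enE ltcR.
split=> [H i|H].
  have : @ball C (E : normedModType C) 0 r%:C z by rewrite -ball_normE.
  by case=> _ /(_ i ord0); rewrite mxE -ball_normE/= sub0r normrN nc_def ltcR.
suff : @ball C (E : normedModType C) 0 r%:C z by rewrite -ball_normE.
by split=> [|i j]; [rewrite ltcR|rewrite mxE -ball_normE/= sub0r normrN nc_def ltcR (ord1 j)].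
Qed.

Lemma en_coord z i : nc (z i ord0) <= en z.
Proof.
apply/ler_addgt0Pr => e e0.
have z0 : 0 < en z + e by rewrite ltr_wpDl// en_ge0.
by apply/ltW; apply (en_lt z z0); rewrite ltrDl.
Qed.

Lemma en_le z (r : R) : 0 <= r -> (forall i, nc (z i ord0) <= r) -> en z <= r.
Proof.
move=> r0 zr; apply/ler_addgt0Pr => e e0; apply/ltW/en_lt => [|i].
  by rewrite ltr_wpDl.
by rewrite (le_lt_trans (zr i))// ltrDl.
Qed.

End space.

Section entire_functions.
Context (R : realType) (n : nat).
Local Notation C := R[i].
Local Notation E := 'cV[C]_n.
Implicit Types (z w : E) (i j : 'I_n) (f : E -> C).

Definition dotc (l : 'I_n -> C) (w : E) : C^o := \sum_i l i * w i ord0.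

Lemma dotc_linear l : linear (dotc l).
Proof.
move=> a x y; rewrite /dotc scaler_sumr -big_split; apply: eq_bigr => i _.
by rewrite !mxE mulrDr mulrCA.
Qed.

HB.instance Definition _ l := GRing.isLinear.Build C E C^o *:%R (dotc l) (dotc_linear l).

Lemma linear_dotc (L : {linear E -> C^o}) : L =1 dotc (fun i => L (delta_mx i ord0)).
Proof.
move=> w; rewrite {1}(matrix_sum_delta w) linear_sum; apply: eq_bigr => i _.
by rewrite big_ord1 linearZ/= mulrC.
Qed.

Lemma en_continuous (V : normedModType C) (L : {linear E -> V}) (M : R) :
  (forall w, `|L w| <= M%:C * `|w|) -> continuous (L : (E : normedModType C) -> V).
Proof.
move=> LM; apply: bounded_linear_continuous; apply/linear_boundedP.
exists M%:C; split; first by rewrite complex_real.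
move=> r Mr w; apply: le_trans (LM w) _; apply: ler_wpM2r => //; exact: ltW.
Qed.

Lemma dotc_continuous l : continuous (dotc l : (E : normedModType C) -> C^o).
Proof.
apply: (@en_continuous _ _ (\sum_i nc (l i))) => w.
rewrite enE nc_def -rmorphM/= lecR; apply: le_trans (nc_sum _ _ _) _.
rewrite mulr_suml; apply: ler_sum => i _; rewrite Normc.normcM.
by apply: ler_wpM2l; [exact: nc_ge0|exact: en_coord].
Qed.

Definition polydisc_bound f (r M : R) := forall z, (forall i, nc (z i ord0) <= r) -> nc (f z) <= M.

Lemma entire_eps f z : entire f -> exists l, forall e : R, 0 < e ->
  exists2 d : R, 0 < d & forall w, en w < d ->
    nc (f (w + z) - f z - dotc l w) <= e * en w.
Proof.
move=> ef; exists (fun i =>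
  'd (f : (E : normedModType C) -> C^o) (z : (E : normedModType C)) (delta_mx i ord0)) => e e0.
have [d d0 H] := diff_eps (ef z) e0.
exists d => // w wd; have := H w; rewrite enE ltcR => /(_ wd).
by rewrite nc_def -rmorphM/= lecR linear_dotc.
Qed.

Lemma eps_entire f : (forall z, exists l, forall e : R, 0 < e ->
  exists2 d : R, 0 < d & forall w, en w < d ->
    nc (f (w + z) - f z - dotc l w) <= e * en w) -> entire f.
Proof.
move=> H z; have [l Hl] := H z;
apply: (@eps_diff R (E : normedModType C) f z (dotc l) (@dotc_continuous l)) => e e0.
have [d d0 {}Hl] := Hl e e0; exists d => // w; rewrite enE ltcR => wd.
by rewrite nc_def -rmorphM/= lecR Hl.
Qed.

Lemma en_scale (a : C) w : en (a *: w) = nc a * en w.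
Proof.
apply: complexI; rewrite -enE rmorphM/= -nc_def -enE.
exact: (@normrZ C (E : normedModType C)).
Qed.

Lemma dotcZ l (a : C) w : dotc l (a *: w) = a * dotc l w.
Proof. exact: linearZ. Qed.

Lemma entire_line_deriv f z w l : (forall e : R, 0 < e ->
    exists2 d : R, 0 < d & forall w, en w < d ->
    nc (f (w + z) - f z - dotc l w) <= e * en w) ->
  cderiv (fun x : C => f (z + x *: w)) 0 (dotc l w).
Proof.
move=> H e e0; have k0 : 0 < en w + 1 by rewrite ltr_wpDl// en_ge0.
have [d d0 {}H] := H _ (divr_gt0 e0 k0).
exists (d / (en w + 1)); first by rewrite divr_gt0.
move=> x; rewrite subr0 scale0r addr0 ltr_pdivlMr// => xd.
have xw : en (x *: w) <= nc x * (en w + 1).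
  by rewrite en_scale; apply: ler_wpM2l; rewrite ?nc_ge0// lerDl.
rewrite [dotc l w * x]mulrC -dotcZ (addrC z).
apply: le_trans (H _ (le_lt_trans xw xd)) _.
rewrite mulrAC ler_pdivrMr// -mulrA; apply: ler_wpM2l => //; exact: ltW.
Qed.

Lemma entire_line f z w x : entire f -> cdiff (fun x : C => f (z + x *: w)) x.
Proof.
move=> ef; have [l /entire_line_deriv H] := entire_eps (z + x *: w) ef.
have [l' Hl'] : exists l', cderiv (fun y : C => f (z + x *: w + y *: w)) 0 l'.
  by exists (dotc l w); exact: H.
exists l' => e /Hl'[d d0 {}H]; exists d => // y yx.
have := H (y - x); rewrite subr0 => /(_ yx).
have -> : z + x *: w + (y - x) *: w = z + y *: w.
  by rewrite -addrA -scalerDl (addrC x) subrK.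
by rewrite scale0r addr0.
Qed.

(* Cauchy estimates give a uniform second order remainder along the sequence. *)
Lemma entire_lim (F : nat -> E -> C) f : (forall N, entire (F N)) ->
  (forall z (e : R), 0 < e -> exists N0, forall N, (N0 <= N)%N -> nc (F N z - f z) <= e) ->
  (forall r : R, exists M : R, forall N, polydisc_bound (F N) r M) ->
  entire f.
Proof.
move=> eF Ff FM; apply: eps_entire => z.
have /choice[l Hl] := fun N => entire_eps z (eF N).
have [M HM] := FM (en z + 1).
have M0 : 0 <= M.
  apply: le_trans (HM 0%N z _); first exact: nc_ge0.
  by move=> i; apply: le_trans (en_coord _ _) _; rewrite lerDl.
(* [taylor_order1] on the line through [z] in direction [w]. The bound on the polydisc of radius
   [en z + 1] makes the constant independent of [N]. *)
have T N w (x : C) : en w <= 1 -> nc x <= 2^-1 ->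
    nc (F N (z + x *: w) - F N z - x * dotc (l N) w) <= 4 * M * nc x ^+ 2.
  move=> w1 x2; pose g (y : C) := F N (z + y *: w).
  have gM y : nc y = 1 -> nc (g y) <= M.
    move=> y1; apply: HM => i; rewrite !mxE; apply: le_trans (ncD _ _) _.
    apply: lerD; first exact: en_coord.
    by rewrite Normc.normcM y1 mul1r; apply: le_trans (en_coord _ _) _.
  have dg y : cdiff g y by exact: entire_line.
  have := taylor_order1 dg gM x2.
  rewrite (cderiv_taylor_coef dg gM (entire_line_deriv w (Hl N))).
  by rewrite /g scale0r addr0 (mulrC _ x).
have [c Hc] : exists c : 'I_n -> C, forall i (e : R), 0 < e ->
    exists N0, forall N, (N0 <= N)%N -> nc (l N i - c i) <= e.
  suff H i : exists c : C, forall e : R, 0 < e ->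
      exists N0, forall N, (N0 <= N)%N -> nc (l N i - c) <= e.
    by have /choice[c] := H; exists c.
  apply: complex_cauchy => e e0.
  pose w : E := delta_mx i ord0.
  have dw N : dotc (l N) w = l N i.
    rewrite /dotc (bigD1 i)//= big1 ?addr0 => [|k ki]; rewrite mxE ?eqxx ?mulr1//.
    by rewrite (negPf ki)/= mulr0.
  have w1 : en w <= 1.
    apply: en_le => // k; rewrite mxE; case: (_ && _); rewrite ?Normc.normc1//.
    by rewrite Normc.normc0.
  (* Difference quotients of step [t] compare the partial derivatives of [F m] and [F k]: two
     quadratic remainders of at most [t * (e / 4)] and four pointwise errors of at most
     [t * (e / 8)] add up to [t * e]. *)
  have [t [t0 t2 tM]] : exists t : R, [/\ 0 < t, t <= 2^-1 & 4 * M * t <= e / 4].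
    exists (Num.min 2^-1 (e / 4 / (4 * M + 1))).
    set m := Num.min _ _.
    have k0 : 0 < 4 * M + 1 by lra.
    have m0 : 0 < m by rewrite !lt_min invr_gt0 ltr0n !divr_gt0.
    have m2 : m <= 2^-1 by rewrite !ge_min lexx.
    have m3 : m <= e / 4 / (4 * M + 1) by rewrite !ge_min lexx !orbT.
    split => //; move: m3; rewrite ler_pdivlMr//; nra.
  have nt : nc t%:C = t by rewrite ncR gtr0_norm.
  have te0 : 0 < t * (e / 8) by rewrite mulr_gt0// divr_gt0.
  have [N1 H1] := Ff (z + t%:C *: w) _ te0; have [N2 H2] := Ff z _ te0.
  exists (maxn N1 N2) => m k; rewrite !geq_max => /andP[m1 m2] /andP[k1 k2].
  rewrite -(ler_pM2l t0) -[X in X * _ <= _]nt -Normc.normcM.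
  have := T m w t%:C w1; have := T k w t%:C w1; rewrite nt !dw => /(_ t2) Tk /(_ t2) Tm.
  set A := F m (z + t%:C *: w) in H1 Tm; set A' := F k (z + t%:C *: w) in H1 Tk.
  have HA := H1 m m1; have HA' := H1 k k1; have HB := H2 m m2; have HB' := H2 k k2.
  rewrite -/A -/A' in HA HA'.
  set L := f (z + _) in HA HA'.
  have -> : t%:C * (l m i - l k i) =
     (A' - F k z - t%:C * l k i) - (A - F m z - t%:C * l m i)
     + ((A - L) - (A' - L)) - ((F m z - f z) - (F k z - f z)) by ring.
  have := ncB ((A' - F k z - t%:C * l k i) - (A - F m z - t%:C * l m i)
     + ((A - L) - (A' - L))) ((F m z - f z) - (F k z - f z)).
  have := ncD ((A' - F k z - t%:C * l k i) - (A - F m z - t%:C * l m i)) ((A - L) - (A' - L)).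
  have := ncB (A' - F k z - t%:C * l k i) (A - F m z - t%:C * l m i).
  have := ncB (A - L) (A' - L).
  have := ncB (F m z - f z) (F k z - f z).
  move: Tk Tm HA HA' HB HB'; have : 4 * M * t ^+ 2 <= t * (e / 4).
    by rewrite expr2 mulrA mulrC; apply: ler_wpM2l => //; exact: ltW.
  have -> : t * (e / 4) = t * (e / 8) * 2 by field.
  have -> : t * e = t * (e / 8) * 8 by field.
  move: (t * (e / 8)) (4 * M * t ^+ 2) => p q.
  move: (nc (A' - F k z - _)) (nc (A - F m z - _)) (nc (A - L)) (nc (A' - L)).
  move: (nc (F m z - f z)) (nc (F k z - f z)) => *; lra.
exists c => e e0.
pose d := Num.min 2^-1 (e / (4 * M + 1)).
have k0 : 0 < 4 * M + 1 by lra.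
exists d; first by rewrite lt_min invr_gt0 ltr0n divr_gt0.
move=> w; rewrite lt_min => /andP[/ltW w2 we].
have w0 := en_ge0 w.
apply: (@le_trans _ _ (4 * M * en w ^+ 2)); last first.
  rewrite expr2 mulrA; apply: ler_wpM2r => //.
  by move: we; rewrite ltr_pdivlMr//; nra.
have [w00|w00] := eqVneq (en w) 0.
  have -> : w = 0.
    by apply/eqP; rewrite -(@normr_eq0 C (E : normedModType C)) enE w00.
  by rewrite add0r linear0 !subr0 subrr Normc.normc0 mulr_ge0 ?sqr_ge0// mulr_ge0.
have wE : w = (en w)%:C *: ((en w)^-1%:C *: w).
  by rewrite scalerA -rmorphM/= divff// scale1r.
pose w' := (en w)^-1%:C *: w.
have w'1 : en w' <= 1.
  by rewrite /w' en_scale ncR ger0_norm ?invr_ge0// mulVf.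
have nw : nc (en w)%:C = en w by rewrite ncR ger0_norm.
have Tw N : nc (F N (w + z) - F N z - dotc (l N) w) <= 4 * M * en w ^+ 2.
  have := T N w' (en w)%:C w'1; rewrite nw => /(_ w2).
  by rewrite -dotcZ -wE (addrC z).
apply/ler_addgt0Pr => b b0.
have b30 : 0 < b / 3 by rewrite divr_gt0.
have [N1 H1] := Ff (w + z) _ b30; have [N2 H2] := Ff z _ b30.
have [N3 H3] : exists N0, forall N, (N0 <= N)%N -> nc (dotc (l N) w - dotc c w) <= b / 3.
  pose q := (n%:R * en w + 1) ; have q0 : 0 < q by rewrite ltr_wpDl// mulr_ge0.
  have /choice[N0 HN] := fun i => Hc i _ (divr_gt0 b30 q0).
  exists (\max_i N0 i)%N => N HN0; rewrite /dotc -sumrB.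
  apply: le_trans (nc_sum _ _ _) _.
  apply: (@le_trans _ _ (\sum_(i < n) (b / 3 / q * en w))).
    apply: ler_sum => i _; rewrite -mulrBl Normc.normcM.
    apply: ler_pM; rewrite ?nc_ge0 ?en_coord//; apply: HN.
    by apply: leq_trans HN0; exact: leq_bigmax.
  rewrite sumr_const card_ord -[X in X <= _]mulr_natl mulrCA mulrAC ler_pdivrMr//.
  by apply: ler_wpM2l; [exact: ltW|rewrite /q lerDl].
pose N := maxn N1 (maxn N2 N3).
have {}H1 := H1 N (leq_maxl _ _).
have {}H2 := H2 N (leq_trans (leq_maxl _ _) (leq_maxr _ _)).
have {}H3 := H3 N (leq_trans (leq_maxr _ _) (leq_maxr _ _)).
have -> : f (w + z) - f z - dotc c w = (F N (w + z) - F N z - dotc (l N) w)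
   + (- (F N (w + z) - f (w + z)) + (F N z - f z) + (dotc (l N) w - dotc c w)) by ring.
apply: le_trans (ncD _ _) _; apply: lerD => //.
apply: le_trans (ncD _ _) _.
have := ncD (- (F N (w + z) - f (w + z))) (F N z - f z); rewrite ncN.
move: H1 H2 H3; lra.
Qed.

End entire_functions.

(** * Rotations and homogeneous components *)

Section components.
Context (R : realType) (n : nat).
Local Notation C := R[i].
Local Notation E := 'cV[C]_n.
Implicit Types (z w : E) (i j : 'I_n) (f : E -> C) (s t : C).

Lemma entire_cont f z (e : R) : entire f -> 0 < e -> exists2 d : R, 0 < d &
  forall w, en (w - z) < d -> nc (f w - f z) < e.
Proof.
move=> ef e0; have [l H] := entire_eps z ef.
have [d d0 {}H] := H 1 ltr01.
pose k := \sum_i nc (l i) + 1.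
have k0 : 0 < k by rewrite ltr_wpDl// sumr_ge0// => i _; exact: nc_ge0.
exists (Num.min d (e / k)); first by rewrite lt_min d0 divr_gt0.
move=> w; rewrite lt_min => /andP[/H]; rewrite subrK mul1r => wd we.
rewrite -(subrK (dotc l (w - z)) (f w - f z)); apply: le_lt_trans (ncD _ _) _.
rewrite ltr_pdivlMr// in we; apply: le_lt_trans we.
rewrite /k mulrDr mulr1 addrC; apply: lerD => //.
apply: le_trans (nc_sum _ _ _) _; rewrite mulr_sumr; apply: ler_sum => i _.
by rewrite Normc.normcM mulrC; apply: ler_wpM2r; [exact: nc_ge0|exact: en_coord].
Qed.

(** Local boundedness and compactness of the box of real and imaginary parts in [[- r, r]], which
    contains the polydisc. *)
Lemma entire_polydisc_bound f (r : R) : entire f -> exists M : R, polydisc_bound f r M.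
Proof.
move=> ef.
pose p (v : 'rV[R]_n * 'rV[R]_n) : E := \col_i (v.1 ord0 i +i* v.2 ord0 i).
have rc := @rV_compact R n (fun=> `[- r, r]%classic) (fun=> @segment_compact R (- r) r).
have /compact_near_coveringP := compact_setX rc rc.
move=> /(_ R +oo%R (fun M v => nc (f (p v)) <= M) _)[].
  move=> v _; have [d d0 H] := entire_cont (p v) ef ltr01.
  exists (ball v (d / 2), [set M : R | nc (f (p v)) + 1 < M]).
    split; first by apply: nbhsx_ballx; rewrite divr_gt0.
    by exists (nc (f (p v)) + 1); split=> //; rewrite num_real.
  move=> [v' M] [/= [[_ v1] [_ v2]] /ltW]; apply: le_trans.
  rewrite -(subrK (f (p v)) (f (p v'))).
  apply: le_trans (ncD _ _) _; rewrite addrC lerD2l ltW//.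
  apply: H; apply/en_lt => // i; rewrite !mxE.
  have h1 := v1 ord0 i; have h2 := v2 ord0 i; rewrite /ball/= in h1 h2.
  by apply: le_lt_trans (nc_le _) _ => /=; rewrite [d]splitr; apply: ltrD;
    rewrite distrC.
move=> M [Mr H]; exists (M + 1) => z zr.
have zE : z = p (\row_i complex.Re (z i ord0), \row_i complex.Im (z i ord0)).
  by apply/colP => i; rewrite !mxE /=; case: (z i ord0).
rewrite zE; apply: (H (M + 1)); first by rewrite ltrDl.
split=> i /=; rewrite mxE in_itv/= -ler_norml.
  exact: le_trans (ncRe _) _.
exact: le_trans (ncIm _) _.
Qed.

(** Here [t] is any complex number: for [nc t = 1] this is the torus action, and as [t] varies over
    the plane it gives the slices to which the one-variable theory applies. *)
Definition rot j t z : E := \col_i ((if i == j then t else 1) * z i ord0).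

Lemma rot_linear j t : linear (rot j t).
Proof. by move=> a x y; apply/colP => i; rewrite !mxE mulrDr mulrCA. Qed.

HB.instance Definition _ j t := GRing.isLinear.Build C E E *:%R (rot j t) (rot_linear j t).

Lemma rotM j s t z : rot j s (rot j t z) = rot j (s * t) z.
Proof. by apply/colP => i; rewrite !mxE mulrA; case: eqP => // _; rewrite mulr1. Qed.

Lemma rotC i j s t z : rot i s (rot j t z) = rot j t (rot i s z).
Proof. by apply/colP => k; rewrite !mxE mulrCA. Qed.

Lemma rot1 j z : rot j 1 z = z.
Proof. by apply/colP => i; rewrite !mxE; case: eqP => _; rewrite mul1r. Qed.

Lemma rot_en j t z : en (rot j t z) <= (nc t + 1) * en z.
Proof.
apply: en_le => [|i]; first by rewrite mulr_ge0 ?en_ge0// addr_ge0// nc_ge0.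
rewrite mxE Normc.normcM; apply: ler_pM; rewrite ?nc_ge0 ?en_coord//.
by case: ifP => _; rewrite ?Normc.normc1 ?lerDl ?lerDr// nc_ge0.
Qed.

Lemma entire_rot f j t : entire f -> entire (fun z => f (rot j t z)).
Proof.
move=> ef; apply: eps_entire => z.
have [l Hl] := entire_eps (rot j t z) ef.
exists (fun i => dotc l (rot j t (delta_mx i ord0))) => e e0.
have k0 : 0 < nc t + 1 by rewrite ltr_wpDl// nc_ge0.
have [d d0 H] := Hl _ (divr_gt0 e0 k0).
exists (d / (nc t + 1)); first by rewrite divr_gt0.
move=> w; rewrite ltr_pdivlMr// mulrC => wd.
rewrite -(linear_dotc (dotc l \o rot j t)) linearD/=.
apply: le_trans (H _ (le_lt_trans (rot_en _ _ _) wd)) _.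
by rewrite mulrAC ler_pdivrMr// -mulrA; apply: ler_wpM2l; [exact: ltW|rewrite mulrC rot_en].
Qed.

Lemma entire_slice f j z x : entire f -> cdiff (fun t => f (rot j t z)) x.
Proof.
move=> ef.
rewrite (_ : (fun t => _) = fun t => f (rot j 0 z + t *: (z j ord0 *: delta_mx j ord0))).
  exact: entire_line.
apply/funext => t; congr f; apply/colP => i; rewrite !mxE eqxx andbT.
by case: eqP => [->|_]; rewrite ?mul0r ?add0r ?mulr1// !mulr0 addr0.
Qed.

Lemma entireD f g : entire f -> entire g -> entire (f + g).
Proof. by move=> ef eg z; exact: (@differentiableD C (E : normedModType C) C^o). Qed.

Lemma entireZ (c : C) f : entire f -> entire (c *: f).
Proof. by move=> ef z; exact: (@differentiableZ C (E : normedModType C) C^o). Qed.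

Lemma entire_cst (c : C) : entire (fun _ : E => c).
Proof. by move=> z; exact: (@differentiable_cst C (E : normedModType C) C^o). Qed.

Lemma entire_sum (I : Type) (r : seq I) (F : I -> E -> C) :
  (forall k, entire (F k)) -> entire (\sum_(k <- r) F k).
Proof.
move=> eF; elim: r => [|a r IH].
  by rewrite big_nil; exact: (entire_cst 0).
by rewrite big_cons; apply: entireD.
Qed.

(* The homogeneous component of degree k in the j-th variable. *)
Definition comp j k f z : C := taylor_coef (fun t => f (rot j t z)) k.

Definition dcomp j N k f z : C := dft N k (fun t => f (rot j t z)).

Lemma rot_bound f j (r M : R) s z : polydisc_bound f ((nc s + 1) * r) M ->
  (forall i, nc (z i ord0) <= r) -> nc (f (rot j s z)) <= M.
Proof.
move=> fM zr; apply: fM => i; rewrite mxE Normc.normcM; apply: ler_pM; rewrite ?nc_ge0//.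
by case: ifP => _; rewrite ?Normc.normc1 ?lerDl ?lerDr// nc_ge0.
Qed.

(** The Cauchy estimate is taken at radius 2 while the components are evaluated at radius 1; the
    ratio is the source of all geometric series in [2^-1]. *)
Lemma comp_bound f j k z (M : R) : entire f ->
  (forall t, nc t = 2 -> nc (f (rot j t z)) <= M) -> nc (comp j k f z) <= 2 * M * 2^-1 ^+ k.
Proof.
move=> ef fM; have df x := entire_slice j z x ef.
have := taylor_coef_bound df k (ltr0Sn R 1) fM.
by rewrite exprVn ler_pdivlMr// exprn_gt0.
Qed.

Lemma rot_slice_bound f j z (r : R) : entire f ->
  exists M : R, forall t, nc t = r -> nc (f (rot j t z)) <= M.
Proof.
move=> ef; have [M HM] := entire_polydisc_bound ((r + 1) * en z) ef.
exists M => t tr; apply: (@rot_bound _ _ (en z)); first by rewrite tr.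
by move=> i; exact: en_coord.
Qed.

Lemma comp_cvg f j z (e : R) : entire f -> 0 < e -> exists K0, forall K, (K0 <= K)%N ->
  nc (f z - \sum_(k < K) comp j k f z) <= e.
Proof.
move=> ef e0; have [K0 H] := taylor_cvg (fun x => entire_slice j z x ef) 1 e0.
exists K0 => K /H; rewrite rot1.
by under eq_bigr do rewrite expr1n mulr1.
Qed.

Lemma dcomp_cvg f j k z (e : R) : entire f -> 0 < e -> exists N0, forall N, (N0 <= N)%N ->
  nc (dcomp j N k f z - comp j k f z) <= e.
Proof.
move=> ef e0; have [M HM] := rot_slice_bound j z 2 ef.
have [N0 HN] := half_pow_small (2 * M) e0.
exists (maxn N0 k) => N; rewrite geq_max => /andP[/HN/ltW N0N kN].
apply: le_trans N0N; apply: (@dft_cvg _ _ _ _ (fun m => comp j m f z)) => //.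
  by move=> m; exact: comp_bound.
by move=> x _ e' e'0; exact: (taylor_cvg (fun x => entire_slice j z x ef) x e'0).
Qed.

Lemma entire_dcomp f j N k : entire f -> entire (dcomp j N k f).
Proof.
move=> ef.
rewrite (_ : dcomp j N k f = N.+1%:R^-1 *: \sum_(i < N.+1)
   ((unity R N ^+ i)^-1 ^+ k *: (fun z => f (rot j (unity R N ^+ i) z)))).
  by apply/entireZ/entire_sum => i; apply/entireZ/entire_rot.
by apply/funext => z; rewrite /dcomp /dft !fctE fct_sumE.
Qed.

(** The averages [dcomp j N k f] are finite sums of rotated copies of [f], hence entire, and bounded
    on polydiscs uniformly in [N]; [entire_lim] applies. *)
Lemma entire_comp f j k : entire f -> entire (comp j k f).
Proof.
move=> ef; apply: (@entire_lim _ _ (fun N => dcomp j N k f)).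
- by move=> N; exact: entire_dcomp.
- by move=> z e; exact: dcomp_cvg.
- move=> r; have [M HM] := entire_polydisc_bound ((1 + 1) * r) ef.
  exists M => N z zr; apply: dft_bound => t t1.
  by apply: rot_bound zr; rewrite t1.
Qed.

(* Discrete averages over roots of unity recover the coefficients. *)
Lemma taylor_coef_unique (g : C -> C) (b : nat -> C) (M B : R) k :
  (forall x, cdiff g x) -> (forall x, nc x = 2 -> nc (g x) <= B) ->
  (forall m, nc (b m) <= M * 2^-1 ^+ m) ->
  (forall x, nc x = 1 -> forall e : R, 0 < e -> exists K0, forall K, (K0 <= K)%N ->
     nc (g x - \sum_(m < K) b m * x ^+ m) <= e) ->
  taylor_coef g k = b k.
Proof.
move=> dg gB bM gb; apply/eqP; rewrite -subr_eq0; apply/eqP/nc_eps0 => e e0.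
have [N0 HN] := half_pow_small (2 * B + M) e0.
pose N := maxn N0 k; have kN : (k <= N)%N := leq_maxr _ _.
have H1 : nc (dft N k g - taylor_coef g k) <= 2 * B * 2^-1 ^+ N.
  apply: dft_cvg => //.
    move=> m; have := taylor_coef_bound dg m (ltr0Sn R 1) gB.
    by rewrite exprVn ler_pdivlMr// exprn_gt0.
  by move=> x _ e' e'0; exact: taylor_cvg.
have H2 : nc (dft N k g - b k) <= M * 2^-1 ^+ N by exact: dft_cvg.
have := HN N (leq_maxl _ _); rewrite mulrDl => /ltW; apply: le_trans.
apply: le_trans (lerD H1 H2); rewrite [X in _ <= X + _]ncC; exact: nc_triB.
Qed.

(** The slice through [rot j s z] has the expansion with coefficients [s ^+ m * comp j m f z], and
    coefficients are unique. The Cauchy estimate at radius [2 * q] with [nc s <= q] absorbs the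
    powers of [s]. *)
Lemma comp_rot f j k s z : entire f -> comp j k f (rot j s z) = s ^+ k * comp j k f z.
Proof.
move=> ef.
pose q := nc s + 1; have q1 : 1 <= q by rewrite lerDr nc_ge0.
have q0 : 0 < q by apply: lt_le_trans q1.
have sq : nc s <= q by rewrite lerDl.
have [B HB] := rot_slice_bound j (rot j s z) 2 ef.
have [M HM] := rot_slice_bound j z (2 * q) ef.
apply: (@taylor_coef_unique _ (fun k => s ^+ k * comp j k f z) (2 * M) B k) => //.
- by move=> x; exact: entire_slice.
- move=> m; have := taylor_coef_bound (fun x => entire_slice j z x ef) m (mulr_gt0 (ltr0Sn R 1) q0) HM.
  rewrite exprMn exprVn ler_pdivlMr ?exprn_gt0//; apply: le_trans.
  rewrite Normc.normcM ncX -/(comp j m f z).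
  rewrite [leLHS](_ : _ = nc (comp j m f z) * (2 ^+ m * nc s ^+ m)); last by ring.
  apply: ler_wpM2l; first exact: nc_ge0.
  apply: ler_wpM2l; first by rewrite exprn_ge0.
  by apply: lerXn2r; rewrite ?nnegrE ?nc_ge0// ltW.
- move=> x x1 e e0.
  have [K0 H] := taylor_cvg (fun x => entire_slice j z x ef) (x * s) e0.
  exists K0 => K /H {}H; rewrite rotM.
  have -> : \sum_(m < K) s ^+ m * comp j m f z * x ^+ m =
      \sum_(m < K) comp j m f z * (x * s) ^+ m.
    by apply: eq_bigr => m _; rewrite exprMn mulrAC (mulrC (_ * _)) (mulrC (s ^+ m)).
  exact: H.
Qed.

Definition pure j k f := forall s z, f (rot j s z) = s ^+ k * f z.

Lemma taylor_coefZ (c : C) (g : C -> C) k : (forall x, cdiff g x) ->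
  taylor_coef (fun x => c * g x) k = c * taylor_coef g k.
Proof.
move=> dg; rewrite /taylor_coef mulrCA; congr (_ * _).
rewrite -cintZ; last first.
  by apply: tcontM; [exact: tcont_polarV|apply: tcont_polar => t; exact: cdiff_ccont].
by apply: (congr1 (@cint R)); apply/funext => t; rewrite mulrCA.
Qed.

Lemma comp_pure_other f i j k m : entire f -> pure i m f -> pure i m (comp j k f).
Proof.
move=> ef fm s z; rewrite /comp -taylor_coefZ; last by move=> x; exact: entire_slice.
apply: (congr1 (fun g => taylor_coef g k)).
by apply/funext => t; rewrite rotC fm.
Qed.

Lemma comp_pure f j k : entire f -> pure j k (comp j k f).
Proof. by move=> ef s z; exact: comp_rot. Qed.

(** Roots of unity have modulus 1, so every average [dcomp j N k f] equals [f]; thus [f] is its own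
    component of degree [k]. *)
Lemma unit_pure f j k : entire f ->
  (forall s z, nc s = 1 -> f (rot j s z) = s ^+ k * f z) -> pure j k f.
Proof.
move=> ef fk; suff <- : comp j k f = f by exact: comp_pure.
apply/funext => z; apply/eqP; rewrite -subr_eq0; apply/eqP/nc_eps0 => e e0.
have [N0 H] := dcomp_cvg j k z ef e0; rewrite ncC; apply: le_trans (H N0 (leqnn _)).
rewrite /dcomp /dft (eq_bigr (fun=> f z)); last first.
  move=> i _; rewrite fk ?nc_unity// mulrA -exprMn mulVf ?unity_neq0//.
  by rewrite expr1n mul1r.
by rewrite sumr_const card_ord -[X in _ * X]mulr_natl mulrA mulVf ?mul1r// pnatr_eq0.
Qed.

Lemma pure_eq1 f (k : 'I_n -> nat) z : (forall j, pure j (k j) f) ->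
  f z = (\prod_j z j ord0 ^+ k j) * f (const_mx 1).
Proof.
move=> fk.
(* The list [r] holds the coordinates already scaled by those of [z]; the point [w] is free so that
   the induction can move one coordinate at a time. *)
have H (r : seq 'I_n) : uniq r -> forall w,
    f (\col_i (if i \in r then z i ord0 * w i ord0 else w i ord0)) =
    (\prod_(j <- r) z j ord0 ^+ k j) * f w.
  elim: r => [_ w|j r IH /= /andP[jr ur] w].
    by rewrite big_nil mul1r; congr f; apply/colP => i; rewrite mxE.
  rewrite big_cons -mulrA -(IH ur) -(fk j); congr f.
  apply/colP => i; rewrite !mxE inE; case: eqP => [->|_] /=.
    by rewrite (negPf jr).
  by rewrite mul1r.
rewrite -(H (index_enum _) (index_enum_uniq _)); congr f; apply/colP => i.
by rewrite !mxE mem_index_enum mulr1.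
Qed.

End components.

(** * Invariance of Lebesgue measure under rotations *)

Section shears.
Local Open Scope ereal_scope.

Section preserving.
Context d (T : measurableType d) (R : realType).
Implicit Types (mu : {measure set T -> \bar R}) (phi psi : T -> T).

Definition preserving (mu : set T -> \bar R) phi :=
  measurable_fun setT phi /\ forall A, measurable A -> mu (phi @^-1` A) = mu A.

Lemma preserving_id (mu : set T -> \bar R) : preserving mu id.
Proof. by split=> //; exact: measurable_id. Qed.

Lemma preserving_comp (mu : set T -> \bar R) phi psi :
  preserving mu phi -> preserving mu psi -> preserving mu (phi \o psi).
Proof.
move=> [mphi Hphi] [mpsi Hpsi]; split; first exact: measurableT_comp.
move=> A mA; rewrite comp_preimage Hpsi ?Hphi//.
by rewrite -[X in measurable X]setTI; exact: mphi.
Qed.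

End preserving.

Lemma preserving_prod d1 d2 (T1 : measurableType d1) (T2 : measurableType d2) (R : realType)
    (m1 : {sigma_finite_measure set T1 -> \bar R})
    (m2 : {sigma_finite_measure set T2 -> \bar R}) (phi : T1 -> T1) (psi : T2 -> T2) :
  preserving m1 phi -> preserving m2 psi ->
  preserving (m1 \x m2) (fun p => (phi p.1, psi p.2)).
Proof.
move=> [mphi Hphi] [mpsi Hpsi].
have mpp : measurable_fun setT (fun p : T1 * T2 => (phi p.1, psi p.2)).
  by apply: measurable_fun_pair; apply: measurableT_comp.
split=> // A mA; apply/esym.
apply: (@product_measure_unique _ _ _ _ _ m1 m2
  (measure_function_pushforward__canonical__measure_function_Measure (m1 \x m2) mpp)) => //.
move=> B D mB mD /=; rewrite /pushforward.
rewrite (_ : _ @^-1` _ = (phi @^-1` B) `*` (psi @^-1` D))//.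
have mB' : measurable (phi @^-1` B).
  by rewrite -[X in measurable X]setTI; exact: mphi.
have mD' : measurable (psi @^-1` D).
  by rewrite -[X in measurable X]setTI; exact: mpsi.
rewrite [LHS](product_measure1E m1 m2 mB' mD').
by congr (_ * _); [exact: Hphi|exact: Hpsi].
Qed.

Section plane.
Context (R : realType).
Notation mu := (@lebesgue_measure R).
Notation mR := (measurableTypeR R).

Lemma preserving_shift (a : R) : preserving mu (fun x : mR => (x + a)%R).
Proof.
have ma : @measurable_fun _ _ mR mR setT (fun x => (x + a)%R).
  by apply: measurable_funD => //; exact: measurable_id.
split=> // A mA; apply/esym.
pose M : {measure set mR -> \bar R} :=
  @measure_function_pushforward__canonical__measure_function_Measure _ _ mR mR R mu _ ma.
suff H X : ocitv X -> mu X = M X by exact: (@lebesgue_measure_unique R M H A mA).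
move=> [[x y] _ <-] /=; rewrite /pushforward.
rewrite (_ : _ @^-1` _ = `](x - a)%R, (y - a)%R]%classic); last first.
  by apply/seteqP; split=> t /=; rewrite !in_itv/= ltrBlDr lerBrDr.
rewrite !lebesgue_measure_itv/= !lte_fin ltrD2r.
by case: ifP => // _; rewrite -!EFinB; congr (_%:E); lra.
Qed.

Notation plane := (mu \x mu).

Lemma preserving_shear1 (a : R) : preserving plane (fun p : mR * mR => ((p.1 + a * p.2)%R, p.2)).
Proof.
have ms : measurable_fun setT (fun p : mR * mR => ((p.1 + a * p.2)%R, p.2) : mR * mR).
  apply: measurable_fun_pair; last exact: measurable_snd.
  apply: measurable_funD; first exact: measurable_fst.
  by apply: measurable_funM => //; exact: measurable_snd.
split=> // A mA; have mA' : measurable ((fun p : mR * mR => ((p.1 + a * p.2)%R, p.2)) @^-1` A).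
  by rewrite -[X in measurable X]setTI; exact: ms.
(* The shear translates the sections at fixed second coordinate, so the iterated integral has to be
   taken in the other order. *)
have E : forall X, measurable X -> (mu \x mu) X = (mu \x^ mu) X.
  move=> X mX; apply: product_measure_unique => // B D mB mD.
  exact: product_measure2E.
rewrite !E// /product_measure2; apply: eq_integral => y _ /=.
rewrite -[RHS](preserving_shift (a * y)).2; last exact: measurable_ysection.
by congr (mu _); apply/seteqP; split=> x /=; rewrite /ysection/= !inE.
Qed.

Lemma preserving_shear2 (a : R) : preserving plane (fun p : mR * mR => (p.1, (p.2 + a * p.1)%R)).
Proof.
have ms : measurable_fun setT (fun p : mR * mR => (p.1, (p.2 + a * p.1)%R) : mR * mR).
  apply: measurable_fun_pair; first exact: measurable_fst.
  apply: measurable_funD; first exact: measurable_snd.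
  by apply: measurable_funM => //; exact: measurable_fst.
split=> // A mA; rewrite /product_measure1; apply: eq_integral => x _ /=.
rewrite -[RHS](preserving_shift (a * x)).2; last exact: measurable_xsection.
by congr (mu _); apply/seteqP; split=> y /=; rewrite /xsection/= !inE.
Qed.

Definition rotation (c s : R) (p : mR * mR) : mR * mR :=
  ((c * p.1 - s * p.2)%R, (s * p.1 + c * p.2)%R).

(* A rotation that is not +-1 is a product of three shears. *)
Lemma preserving_rotation (c s : R) : (c ^+ 2 + s ^+ 2 = 1)%R ->
  preserving plane (rotation c s).
Proof.
have rot0 c' s' : (s' != 0)%R -> (c' ^+ 2 + s' ^+ 2 = 1)%R -> preserving plane (rotation c' s').
  (* For the angle [theta] this is [- tan (theta / 2)]. *)
  move=> s0 cs; pose a := ((c' - 1) / s')%R.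
  have := preserving_comp (preserving_shear1 a)
    (preserving_comp (preserving_shear2 s') (preserving_shear1 a)).
  congr preserving; apply/funext => -[x y]; rewrite /rotation /= /a.
  have c2 : (c' ^+ 2 = 1 - s' ^+ 2)%R by rewrite -cs addrK.
  by congr pair; field: c2.
move=> cs; have [s0|] := eqVneq s 0%R; last by move=> s0; exact: rot0.
(* For [s = 0] the rotation is the identity or the square of this quarter turn. *)
have r90 : preserving plane (rotation 0 1).
  by apply: rot0; rewrite ?oner_eq0// expr0n expr1n add0r.
have : (c ^+ 2 = 1)%R by rewrite -cs s0 expr0n addr0.
move/eqP; rewrite sqrf_eq1 => /orP[/eqP c1|/eqP c1]; rewrite s0 c1.
  have := preserving_id plane; congr preserving.
  by apply/funext => -[x y]; rewrite /rotation/= !mul0r !mul1r subr0 add0r.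
have := preserving_comp r90 r90; congr preserving.
by apply/funext => -[x y]; rewrite /rotation/=; congr pair; ring.
Qed.

End plane.

End shears.

Section power.
Context d (T : measurableType d) (R : realType).
Variable m : {sigma_finite_measure set T -> \bar R}.
Local Open Scope ereal_scope.

Definition tmap n (j : 'I_n) (phi : T -> T) (t : n.-tuple T) : n.-tuple T :=
  [tuple (if i == j then phi (tnth t i) else tnth t i) | i < n].

Lemma tmap_comp n (j : 'I_n) (phi psi : T -> T) t :
  tmap j phi (tmap j psi t) = tmap j (phi \o psi) t.
Proof. by apply: eq_from_tnth => i; rewrite !tnth_mktuple; case: eqP. Qed.

Lemma tmap_id n (j : 'I_n) (phi : T -> T) t : phi =1 id -> tmap j phi t = t.
Proof. by move=> pi; apply: eq_from_tnth => i; rewrite !tnth_mktuple pi; case: eqP. Qed.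

Lemma measurable_tmap n (j : 'I_n) (phi : T -> T) : measurable_fun setT phi ->
  measurable_fun setT (tmap j phi).
Proof.
move=> mphi; apply/measurable_fun_tnthP => i.
rewrite (_ : _ \o _ = fun t : n.-tuple T => if i == j then phi (tnth t i) else tnth t i); last first.
  by apply/funext => t; rewrite /= tnth_mktuple.
case: eqP => _; last exact: measurable_tnth.
exact: measurableT_comp (measurable_tnth i).
Qed.

Lemma preserving_power n (j : 'I_n) (phi : T -> T) : preserving m phi ->
  preserving (product_power m n) (tmap j phi).
Proof.
move=> mphi; split; first exact: measurable_tmap mphi.1.
elim: n j => [[]//|n IH] j A mA; rewrite /= /power_step /pushforward.
have mA' : measurable (@tuple_cons d T n @^-1` A).
  by rewrite -[X in measurable X]setTI; exact: measurable_tuple_cons.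
have [|j0] := unliftP ord0 j.
  move=> j' jE.
  have pr : preserving (product_power m n) (tmap j' phi).
    by split; [exact: measurable_tmap mphi.1|exact: IH].
  rewrite -[RHS](preserving_prod (preserving_id m) pr).2//.
  congr (_ _); apply/seteqP; split=> -[x t] /=;
    rewrite (_ : tmap j phi _ = tuple_cons (x, tmap j' phi t))//;
    by apply: eq_from_tnth => i; rewrite tnth_mktuple jE; case: (unliftP ord0 i) => [i' ->|->];
      rewrite ?tnth0 ?tnthS ?tnth_mktuple// (inj_eq lift_inj).
rewrite -[RHS](preserving_prod mphi (preserving_id (product_power m n))).2//.
congr (_ _); apply/seteqP; split=> -[x t] /=;
  rewrite (_ : tmap j phi _ = tuple_cons (phi x, t))//;
  by apply: eq_from_tnth => i; rewrite tnth_mktuple j0; case: (unliftP ord0 i) => [i' ->|->];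
    rewrite ?tnth0 ?tnthS.
Qed.

Definition box n (B : 'I_n -> set T) : set (n.-tuple T) := [set t | forall i, B i (tnth t i)].

Lemma measurable_box n (B : 'I_n -> set T) : (forall i, measurable (B i)) -> measurable (box B).
Proof.
move=> mB; rewrite (_ : box B = \bigcap_(i in [set: 'I_n]) ((fun t => tnth t i) @^-1` B i)).
  apply: fin_bigcap_measurable => // i _; rewrite -[X in measurable X]setTI.
  exact: measurable_tnth.
by apply/seteqP; split=> [t H i _|t H i]; exact: H.
Qed.

Lemma power_box_gt0 n (B : 'I_n -> set T) : (forall i, measurable (B i)) ->
  (forall i, 0 < m (B i)) -> 0 < product_power m n (box B).
Proof.
elim: n B => [|n IH] B mB B0.
  rewrite /= /dirac indicE mem_set ?lte_fin ?ltr01// => -[]//.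
rewrite /= /power_step /pushforward.
have -> : @tuple_cons d T n @^-1` box B = B ord0 `*` box (fun i => B (lift ord0 i)).
  apply/seteqP; split=> -[x t] /=.
    move=> H; split; first by have := H ord0; rewrite tnth0.
    by move=> i; have := H (lift ord0 i); rewrite tnthS.
  case=> Bx Bt i; case: (unliftP ord0 i) => [i' ->|->]; rewrite ?tnthS ?tnth0//; exact: Bt.
have mb : measurable (box (fun i => B (lift ord0 i))) by exact: measurable_box.
rewrite [ltRHS](product_measure1E m (product_power m n) (mB ord0) mb).
apply: mule_gt0; first exact: B0.
exact: (IH (fun i => B (lift ord0 i)) (fun i => mB _) (fun i => B0 _)).
Qed.

End power.

Section caratheodory.
Context d (T : measurableType d) (R : realType) (mu : {measure set T -> \bar R}).
Variables (phi psi : T -> T).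
Hypotheses (phiK : cancel phi psi) (psiK : cancel psi phi).
Hypotheses (Hphi : preserving mu phi) (Hpsi : preserving mu psi).
Local Open Scope ereal_scope.

(** The measure [lebesgue] lives on Caratheodory measurable sets, so invariance must be shown for
    the outer measure. Preimages of a measurable cover form a cover of the same total measure;
    equality then follows from the inverse map. *)
Lemma mu_ext_preimage_le f (A : set T) : preserving mu f -> (mu^*)%mu (f @^-1` A) <= (mu^*)%mu A.
Proof.
move=> [mf Hf]; apply: ereal_inf_le_tmp => _ [F [mF AF] <-].
have mF' k : measurable (f @^-1` F k) by rewrite -[X in measurable X]setTI; exact: mf.
exists (fun k => f @^-1` F k).
  by split=> // t /AF[k _ Fk]; exists k.
by apply: eq_eseriesr => k _; exact: Hf.
Qed.

Lemma mu_ext_preimage (A : set T) : (mu^*)%mu (phi @^-1` A) = (mu^*)%mu A.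
Proof.
apply/eqP; rewrite eq_le mu_ext_preimage_le//=.
rewrite -[X in (mu^*)%mu X <= _](_ : psi @^-1` (phi @^-1` A) = A); last first.
  by apply/seteqP; split=> t /=; rewrite psiK.
exact: mu_ext_preimage_le.
Qed.

Lemma caratheodory_preimage (A : set T) :
  caratheodory_measurable (mu^*)%mu A -> caratheodory_measurable (mu^*)%mu (phi @^-1` A).
Proof.
move=> mA X.
rewrite -[X](_ : phi @^-1` (psi @^-1` X) = X); last first.
  by apply/seteqP; split=> t /=; rewrite phiK.
by rewrite preimage_setC -!preimage_setI !mu_ext_preimage; exact: mA.
Qed.

End caratheodory.

Section lebesgue.
Context (R : realType) (n : nat).
Local Open Scope complex_scope.
Local Notation C := R[i].
Local Notation E := 'cV[C]_n.
Local Notation mR := (measurableTypeR R).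
Local Notation P := (mR * mR)%type.
Local Notation leb := (@lebesgue R n).

Definition trot (j : 'I_n) (t : C) (x : real_space R n) : real_space R n :=
  tmap j (rotation (complex.Re t) (complex.Im t)) (x : n.-tuple P).

Lemma unit_sqr (t : C) : Normc.normc t = 1 -> complex.Re t ^+ 2 + complex.Im t ^+ 2 = 1.
Proof. by rewrite -normc_sqr => ->; rewrite expr1n. Qed.

Lemma trotK (j : 'I_n) (t : C) : Normc.normc t = 1 -> cancel (trot j t) (trot j t^-1).
Proof.
move=> t1 x; rewrite /trot tmap_comp tmap_id// => -[a b].
have := unit_sqr t1; case: t {t1} => u v /= uv; rewrite uv invr1 !mulr1.
rewrite /rotation /=; congr pair; last first.
  by transitivity ((u ^+ 2 + v ^+ 2) * b); [ring|rewrite uv mul1r].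
by transitivity ((u ^+ 2 + v ^+ 2) * a); [ring|rewrite uv mul1r].
Qed.

Lemma trot_preserving (j : 'I_n) (t : C) : Normc.normc t = 1 -> preserving leb (trot j t).
Proof.
move=> t1.
pose M : {measure set (n.-tuple P) -> \bar R} := product_power (@plane_measure R) n.
have pr s : Normc.normc s = 1 -> preserving M (trot j s : n.-tuple P -> n.-tuple P).
  by move=> s1; apply: preserving_power; apply: preserving_rotation; exact: unit_sqr.
have tV1 : Normc.normc t^-1 = 1 by rewrite Normc.normcV t1 invr1.
have K := trotK j t1.
have KV : cancel (trot j t^-1) (trot j t) by have := trotK j tV1; rewrite invrK.
split; last first.
  move=> A _; exact: (@mu_ext_preimage _ _ _ M _ _ KV (pr _ t1) (pr _ tV1)).
move=> _ A mA; rewrite setTI.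
exact: (@caratheodory_preimage _ _ _ M _ _ K KV (pr _ t1) (pr _ tV1)).
Qed.

Lemma lebesgue_box_gt0 (B : 'I_n -> set P) : (forall i, measurable (B i)) ->
  (forall i, 0 < plane_measure (B i))%E -> (0 < leb (box B))%E.
Proof.
move=> mB B0; rewrite /lebesgue/= /completed_measure_extension measurable_mu_extE.
  exact: power_box_gt0.
exact: measurable_box.
Qed.

Lemma measurable_lebesgue_box (B : 'I_n -> set P) : (forall i, measurable (B i)) ->
  measurable (box B : set (real_space R n)).
Proof. by move=> mB; apply: caratheodory_measurable_mu_ext; exact: measurable_box. Qed.

End lebesgue.

(** * Square integrable functions *)

Section measurability.
Context (R : realType) (n : nat).
Local Notation C := R[i].
Local Notation E := 'cV[C]_n.
Implicit Types (f g : E -> C) (z : E).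

Lemma point_of_trot (j : 'I_n) (t : C) (x : real_space R n) :
  point_of (trot j t x) = rot j t (point_of x).
Proof.
apply/colP => i; rewrite !mxE /trot tnth_mktuple; case: eqP => _; last first.
  by rewrite mul1r.
rewrite /rotation; case: t => u v; case: (tnth _ _) => a b /=.
by simpc; congr (_ +i* _); rewrite addrC.
Qed.

Lemma lmeas_cst (c : C) : lebesgue_measurable (fun _ : E => c).
Proof. by split; exact: measurable_cst. Qed.

Lemma lmeasD f g : lebesgue_measurable f -> lebesgue_measurable g ->
  lebesgue_measurable (fun z => f z + g z).
Proof.
move=> [f1 f2] [g1 g2]; split.
  rewrite (_ : (fun t => _) = (fun t => complex.Re (f (point_of t))) \+
    (fun t => complex.Re (g (point_of t)))); first exact: measurable_funD.
  by apply/funext => t /=; case: (f _) (g _) => [? ?] [].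
rewrite (_ : (fun t => _) = (fun t => complex.Im (f (point_of t))) \+
    (fun t => complex.Im (g (point_of t)))); first exact: measurable_funD.
by apply/funext => t /=; case: (f _) (g _) => [? ?] [].
Qed.

Lemma lmeasM f g : lebesgue_measurable f -> lebesgue_measurable g ->
  lebesgue_measurable (fun z => f z * g z).
Proof.
move=> [f1 f2] [g1 g2]; split.
  rewrite (_ : (fun t => _) = (fun t => complex.Re (f (point_of t)) * complex.Re (g (point_of t))
     - complex.Im (f (point_of t)) * complex.Im (g (point_of t)))).
    by apply: measurable_funB; exact: measurable_funM.
  by apply/funext => t /=; case: (f _) (g _) => [? ?] [].
rewrite (_ : (fun t => _) = (fun t => complex.Re (f (point_of t)) * complex.Im (g (point_of t))
     + complex.Im (f (point_of t)) * complex.Re (g (point_of t)))).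
  by apply: measurable_funD; exact: measurable_funM.
by apply/funext => t /=; case: (f _) (g _) => [? ?] [].
Qed.

Lemma lmeas_conj f : lebesgue_measurable f -> lebesgue_measurable (fun z => conjc (f z)).
Proof.
move=> [f1 f2]; split.
  by rewrite (_ : (fun t => _) = fun t => complex.Re (f (point_of t)))//;
    apply/funext => t; case: (f _).
rewrite (_ : (fun t => _) = \- (fun t => complex.Im (f (point_of t)))).
  exact: measurable_funN.
by apply/funext => t /=; case: (f _).
Qed.

Lemma lmeas_rot f (j : 'I_n) (t : C) : nc t = 1 -> lebesgue_measurable f ->
  lebesgue_measurable (fun z => f (rot j t z)).
Proof.
move=> t1 [f1 f2]; have [mt _] := trot_preserving j t1; split.
  under eq_fun do rewrite -point_of_trot; exact: measurableT_comp f1 mt.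
under eq_fun do rewrite -point_of_trot; exact: measurableT_comp f2 mt.
Qed.

Definition ptlim (F : nat -> E -> C) f := forall z (e : R), 0 < e ->
  exists N0, forall N, (N0 <= N)%N -> nc (F N z - f z) <= e.

Lemma lmeas_lim (F : nat -> E -> C) f : (forall N, lebesgue_measurable (F N)) ->
  ptlim F f -> lebesgue_measurable f.
Proof.
move=> mF Ff; split.
  apply: (@measurable_fun_cvg _ _ _ _ (fun N t => complex.Re (F N (point_of t)))).
    by move=> N; exact: (mF N).1.
  move=> t _; apply/cvgrPdist_le => e e0; have [N0 H] := Ff (point_of t) e e0.
  exists N0 => // N NN; rewrite distrC; apply: le_trans (H N NN).
  by apply: le_trans (ncRe _); case: (F N _) (f _) => [? ?] [].
apply: (@measurable_fun_cvg _ _ _ _ (fun N t => complex.Im (F N (point_of t)))).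
  by move=> N; exact: (mF N).2.
move=> t _; apply/cvgrPdist_le => e e0; have [N0 H] := Ff (point_of t) e e0.
exists N0 => // N NN; rewrite distrC; apply: le_trans (H N NN).
by apply: le_trans (ncIm _); case: (F N _) (f _) => [? ?] [].
Qed.

End measurability.

Section integrals.
Context d (T : measurableType d) (R : realType) (mu : {measure set T -> \bar R}).
Implicit Types F G H : T -> R.
Local Open Scope ereal_scope.

Lemma intZ (c : R) F : (0 <= c)%R -> measurable_fun setT (EFin \o F) ->
  (forall t, 0 <= F t)%R -> \int[mu]_t (c * F t)%:E = c%:E * \int[mu]_t (F t)%:E.
Proof.
move=> c0 mF F0; rewrite -ge0_integralZl//.
by move=> t _; rewrite lee_fin.
Qed.

Lemma int2D F G H : measurable_fun setT (EFin \o F) -> measurable_fun setT (EFin \o G) ->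
  measurable_fun setT (EFin \o H) -> (forall t, 0 <= F t)%R -> (forall t, 0 <= G t)%R ->
  (forall t, 0 <= H t)%R -> (forall t, H t <= 2 * F t + 2 * G t)%R ->
  \int[mu]_t (H t)%:E <= 2%:E * \int[mu]_t (F t)%:E + 2%:E * \int[mu]_t (G t)%:E.
Proof.
move=> mF mG mH F0 G0 H0 HFG; rewrite -!intZ//.
have m2 (K : T -> R) : measurable_fun setT (EFin \o K) -> measurable_fun setT (fun t => (2 * K t)%:E).
  by move=> mK; under eq_fun do rewrite EFinM; exact: (measurable_funeM 2%:E mK).
have mF2 := m2 _ mF; have mG2 := m2 _ mG.
rewrite -ge0_integralD//.
- apply: ge0_le_integral => //.
  + by move=> t _; rewrite lee_fin.
  + exact: emeasurable_funD.
  + by move=> t _; rewrite -EFinD lee_fin.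
- by move=> t _; rewrite lee_fin mulr_ge0.
- by move=> t _; rewrite lee_fin mulr_ge0.
Qed.

Lemma int_fatou (F : nat -> T -> R) G (c : \bar R) :
  (forall k, measurable_fun setT (EFin \o F k)) -> (forall k t, 0 <= F k t)%R ->
  (forall t, F k t @[k --> \oo] --> G t) ->
  (forall k, \int[mu]_t (F k t)%:E <= c) -> \int[mu]_t (G t)%:E <= c.
Proof.
move=> mF F0 FG Fc.
have := @fatou _ _ _ mu setT measurableT (fun k => EFin \o F k) mF
  (fun k t _ => F0 k t).
rewrite [leLHS](_ : _ = \int[mu]_t (G t)%:E); last first.
  apply: eq_integral => t _.
  have Gt : (EFin \o F k) t @[k --> \oo] --> (G t)%:E.
    by apply: cvg_EFin; [exact: nearW|exact: FG].
  by have [] := cvg_limn_einf_sup Gt.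
move/le_trans; apply; rewrite limn_einf_lim; apply: lime_le; first exact: is_cvg_einfs.
by apply: nearW => k; apply: le_trans (Fc k); apply: ereal_inf_lbound; exists k => //=.
Qed.

Lemma int_le F G : measurable_fun setT (EFin \o F) -> measurable_fun setT (EFin \o G) ->
  (forall t, 0 <= F t)%R -> (forall t, 0 <= G t)%R ->
  {ae mu, forall t, (F t <= G t)%R} -> \int[mu]_t (F t)%:E <= \int[mu]_t (G t)%:E.
Proof.
move=> mF mG F0 G0 FG; apply: ae_ge0_le_integral => //.
- by move=> t _; rewrite lee_fin.
- by move=> t _; rewrite lee_fin.
- by apply: filterS FG => t FGt _; rewrite lee_fin.
Qed.

End integrals.

Section square_integrable.
Context (R : realType) (n : nat) (h : radial_weight R).
Local Notation C := R[i].
Local Notation E := 'cV[C]_n.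
Local Notation leb := (@lebesgue R n).
Local Notation N := (sq_norm h).
Implicit Types (f g : E -> C) (z : E).

Definition dens f (t : real_space R n) : R :=
  nc (f (point_of t)) ^+ 2 * weight h (point_of t).

Lemma weight_ge0 z : 0 <= weight h z.
Proof. exact: expR_ge0. Qed.

Lemma dens_ge0 f t : 0 <= dens f t.
Proof. by rewrite mulr_ge0 ?sqr_ge0 ?weight_ge0. Qed.

Lemma measurable_dens f : lebesgue_measurable f ->
  measurable_fun setT (fun t => (dens f t)%:E).
Proof. exact: measurable_sq_norm. Qed.

Lemma sq_norm_ge0 f : (0 <= N f)%E.
Proof. by apply: integral_ge0 => t _; rewrite lee_fin dens_ge0. Qed.

(** Estimates are made on squared norms: [n2D], with its constants 2, stands in for the triangle
    inequality. *)
Definition norm_sqr f : R := fine (N f).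

Lemma n2_ge0 f : 0 <= norm_sqr f.
Proof. by rewrite fine_ge0// sq_norm_ge0. Qed.

Lemma sq_normE f : L2 h f -> N f = (norm_sqr f)%:E.
Proof. by move=> [_ Nf]; rewrite fineK// ge0_fin_numE// sq_norm_ge0. Qed.

Lemma le_sq_norm f g : lebesgue_measurable f -> lebesgue_measurable g ->
  {ae leb, forall t, nc (f (point_of t)) <= nc (g (point_of t))} -> (N f <= N g)%E.
Proof.
move=> mf mg fg; apply: (@int_le _ _ _ leb (dens f) (dens g)).
- exact: measurable_dens.
- exact: measurable_dens.
- exact: dens_ge0.
- exact: dens_ge0.
apply: filterS fg => t fgt; apply: ler_wpM2r; first exact: weight_ge0.
by apply: lerXn2r; rewrite ?nnegrE ?nc_ge0.
Qed.

Lemma weight_rot (j : 'I_n) (t : C) z : nc t = 1 -> weight h (rot j t z) = weight h z.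
Proof.
move=> t1; rewrite /weight /eucl_norm; congr (expR (_ * h (Num.sqrt _))).
apply: eq_bigr => i _; rewrite mxE Normc.normcM; case: eqP => _; rewrite ?t1 ?Normc.normc1 mul1r//.
Qed.

Lemma sq_norm_rot f (j : 'I_n) (t : C) : nc t = 1 -> lebesgue_measurable f ->
  N (fun z => f (rot j t z)) = N f.
Proof.
move=> t1 mf; have [mt Ht] := trot_preserving j t1.
have d0 : {in [set: real_space R n], forall x, (0 <= (EFin \o dens f) x)%E}.
  by move=> x _; rewrite lee_fin dens_ge0.
have := @ge0_integral_pushforward _ _ _ _ R _ mt leb setT (EFin \o dens f)
  measurableT (measurable_dens mf) d0.
rewrite preimage_setT => HH.
transitivity (\int[leb]_x ((EFin \o dens f) \o trot j t) x)%E.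
  apply: eq_integral => x _; rewrite /dens/= point_of_trot; congr (_%:E).
  by rewrite weight_rot.
rewrite -HH; apply: eq_measure_integral => A mA _; exact: Ht.
Qed.

Lemma sq_normD f g : lebesgue_measurable f -> lebesgue_measurable g ->
  (N (fun z => f z + g z)%R <= 2%:E * N f + 2%:E * N g)%E.
Proof.
move=> mf mg; apply: (@int2D _ _ _ leb (dens f) (dens g) (dens (fun z => f z + g z))).
- exact: measurable_dens.
- exact: measurable_dens.
- exact: measurable_dens (lmeasD mf mg).
- exact: dens_ge0.
- exact: dens_ge0.
- exact: dens_ge0.
move=> t; rewrite -mulrDr -mulrDl [leRHS]mulrA mulrDr.
apply: ler_wpM2r; first exact: weight_ge0.
have := normcD_sqr_le 1 (f (point_of t)) (g (point_of t)).
by rewrite Normc.normc1 expr1n mulr1 mul1r.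
Qed.

Lemma sq_normZ (c : C) f : lebesgue_measurable f ->
  N (fun z => c * f z) = ((nc c ^+ 2)%:E * N f)%E.
Proof.
move=> mf; rewrite -intZ; last 3 first.
- exact: sqr_ge0.
- exact: measurable_dens.
- exact: dens_ge0.
by apply: eq_integral => t _; rewrite Normc.normcM exprMn -mulrA.
Qed.

Lemma dens_cvg (F : nat -> E -> C) f t : ptlim F f -> dens (F k) t @[k --> \oo] --> dens f t.
Proof.
move=> Ff; apply: cvgM; last exact: cvg_cst.
have H : nc (F k (point_of t)) @[k --> \oo] --> nc (f (point_of t)).
  apply/cvgrPdist_le => e e0; have [N0 HN] := Ff (point_of t) e e0.
  exists N0 => // k /HN {}HN; apply: le_trans HN.
  set x := F _ _; set y := f _.
  have := ncD (x - y) y; have := ncD (y - x) x; rewrite !subrK (ncC y x) => A B.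
  by rewrite ler_norml; lra.
by under eq_fun do rewrite expr2; rewrite expr2; apply: cvgM.
Qed.

Lemma sq_norm_fatou (F : nat -> E -> C) f (c : \bar R) K0 :
  (forall K, lebesgue_measurable (F K)) -> ptlim F f ->
  (forall K, (K0 <= K)%N -> (N (F K) <= c)%E) -> (N f <= c)%E.
Proof.
move=> mF Ff Fc.
apply: (@int_fatou _ _ _ leb (fun k => dens (F (k + K0)%N))).
- by move=> k; exact: measurable_dens.
- by move=> k t; exact: dens_ge0.
- move=> t; rewrite (cvg_shiftn K0 (fun k => dens (F k) t)); exact: dens_cvg.
- by move=> k; apply: Fc; rewrite leq_addl.
Qed.

End square_integrable.

Section Rintegrals.
Context d (T : measurableType d) (R : realType) (mu : {measure set T -> \bar R}).
Implicit Types u v w : T -> R.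

Lemma integrableZR (a : R) u :
  mu.-integrable setT (EFin \o u) -> mu.-integrable setT (EFin \o (fun t => a * u t)).
Proof.
move=> iu; have := integrableZl measurableT a iu.
by congr (_.-integrable _ _); apply/funext => t.
Qed.

Lemma integrable_mean u v : mu.-integrable setT (EFin \o u) -> mu.-integrable setT (EFin \o v) ->
  mu.-integrable setT (EFin \o (fun t => (u t + v t) / 2)).
Proof.
move=> iu iv; have := integrableZR 2^-1 (integrableD measurableT iu iv).
by congr (_.-integrable _ _); apply/funext => t /=; rewrite mulrC.
Qed.

Lemma Rint_lin (a b : R) u v : mu.-integrable setT (EFin \o u) ->
  mu.-integrable setT (EFin \o v) ->
  \int[mu]_t (a * u t + b * v t) = a * \int[mu]_t u t + b * \int[mu]_t v t.
Proof.
move=> iu iv; have iau := integrableZR a iu; have ibv := integrableZR b iv.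
by rewrite RintegralD// !RintegralZl.
Qed.

Lemma Rint_mean u v w : mu.-integrable setT (EFin \o u) -> mu.-integrable setT (EFin \o v) ->
  mu.-integrable setT (EFin \o w) -> (forall t, `|w t| <= (u t + v t) / 2) ->
  `|\int[mu]_t w t| <= (\int[mu]_t u t + \int[mu]_t v t) / 2.
Proof.
move=> iu iv iw ub; apply: (le_trans (le_normr_Rintegral measurableT iw)).
rewrite -RintegralD// -RintegralZr//; last exact: (integrableD measurableT iu iv).
apply: le_Rintegral => //; first exact: integrable_norm iw.
exact: integrable_mean.
Qed.

Lemma integrable_le u v : measurable_fun setT u -> (forall t, `|u t| <= v t) ->
  mu.-integrable setT (EFin \o v) -> mu.-integrable setT (EFin \o u).
Proof.
move=> mu' uv iv; apply: (le_integrable measurableT _ _ iv).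
  exact/measurable_EFinP.
by move=> t _; rewrite lee_fin; apply: le_trans (ler_norm _).
Qed.

Lemma integrable_ge0 u : (forall t, 0 <= u t) -> measurable_fun setT (EFin \o u) ->
  (\int[mu]_t (u t)%:E < +oo)%E -> mu.-integrable setT (EFin \o u).
Proof.
move=> u0 mu' ui; apply/integrableP; split => //.
by under eq_integral do rewrite /= ger0_norm//.
Qed.

Lemma Rintegral_pushforward (phi : T -> T) u : preserving mu phi -> measurable_fun setT u ->
  mu.-integrable setT (EFin \o (u \o phi)) -> \int[mu]_x (u (phi x)) = \int[mu]_x (u x).
Proof.
move=> [mp Hp] mu' iu; congr fine.
have := @integral_pushforward _ _ _ _ R _ mp mu setT (EFin \o u).
rewrite preimage_setT => <- //; last exact/measurable_EFinP.
by apply: eq_measure_integral => A mA _; exact: Hp.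
Qed.

Lemma Rintegral_ae u v : measurable_fun setT u -> measurable_fun setT v ->
  {ae mu, forall t, u t = v t} -> \int[mu]_x (u x) = \int[mu]_x (v x).
Proof.
move=> mu' mv uv; congr fine; apply: ae_eq_integral => //.
- exact/measurable_EFinP.
- exact/measurable_EFinP.
- by apply: filterS uv => t ut _; rewrite ut.
Qed.

End Rintegrals.

Section inner_product.
Context (R : realType) (n : nat) (h : radial_weight R).
Local Notation C := R[i].
Local Notation E := 'cV[C]_n.
Local Notation leb := (@lebesgue R n).
Local Notation n2 := (norm_sqr h).
Local Notation L2 := (L2 h).
Implicit Types (f g F G : E -> C) (z : E).

Lemma L2D f g : L2 f -> L2 g -> L2 (fun z => f z + g z).
Proof.
move=> [mf Nf] [mg Ng]; split; first exact: lmeasD.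
apply: le_lt_trans (sq_normD h mf mg) _.
by apply: lte_add_pinfty; apply: lte_mul_pinfty.
Qed.

Lemma L2Z (c : C) f : L2 f -> L2 (fun z => c * f z).
Proof.
move=> [mf Nf]; split; first by apply: lmeasM => //; exact: lmeas_cst.
by rewrite sq_normZ//; apply: lte_mul_pinfty => //; rewrite lee_fin sqr_ge0.
Qed.

Lemma L2B f g : L2 f -> L2 g -> L2 (fun z => f z - g z).
Proof.
move=> Lf /(L2Z (-1)) Lg; rewrite (_ : (fun z => _) = fun z => f z + -1 * g z).
  exact: L2D.
by apply/funext => z; rewrite mulN1r.
Qed.

Lemma L2_rot f (j : 'I_n) (t : C) : nc t = 1 -> L2 f -> L2 (fun z => f (rot j t z)).
Proof.
by move=> t1 [mf Nf]; split; [exact: lmeas_rot|rewrite sq_norm_rot].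
Qed.

Lemma L2_cst0 : L2 ((fun=> 0) : E -> C).
Proof.
split; first exact: lmeas_cst.
rewrite (_ : (fun=> 0) = (fun _ : E => 0 * 0)); last by apply/funext => z; rewrite mulr0.
by rewrite sq_normZ ?Normc.normc0 ?expr0n/= ?mul0e//; exact: lmeas_cst.
Qed.

Lemma L2_sum (I : Type) (r : seq I) (P : pred I) (H : I -> E -> C) :
  (forall i, P i -> L2 (H i)) -> L2 (fun z => \sum_(i <- r | P i) H i z).
Proof.
move=> LH; elim: r => [|a r IH].
  by rewrite (_ : (fun z => _) = fun=> 0); [exact: L2_cst0|apply/funext => z; rewrite big_nil].
have [Pa|Pa] := boolP (P a).
  rewrite (_ : (fun z => _) = fun z => H a z + \sum_(i <- r | P i) H i z).
    by apply: L2D; [exact: LH|exact: IH].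
  by apply/funext => z; rewrite big_cons Pa.
rewrite (_ : (fun z => _) = fun z => \sum_(i <- r | P i) H i z); first exact: IH.
by apply/funext => z; rewrite big_cons (negPf Pa).
Qed.

Lemma n2D f g : L2 f -> L2 g -> n2 (fun z => f z + g z) <= 2 * n2 f + 2 * n2 g.
Proof.
move=> Lf Lg; rewrite -lee_fin -(sq_normE (L2D Lf Lg)) EFinD !EFinM.
rewrite -(sq_normE Lf) -(sq_normE Lg).
exact: (sq_normD h Lf.1 Lg.1).
Qed.

Lemma n2Z (c : C) f : L2 f -> n2 (fun z => c * f z) = nc c ^+ 2 * n2 f.
Proof.
move=> Lf; apply: EFin_inj; rewrite -(sq_normE (L2Z c Lf)) EFinM -(sq_normE Lf).
exact: (sq_normZ h c Lf.1).
Qed.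

Lemma n2N f : L2 f -> n2 (fun z => - f z) = n2 f.
Proof.
move=> Lf; rewrite (_ : (fun z => _) = fun z => -1 * f z).
  by rewrite (n2Z _ Lf) ncN Normc.normc1 expr1n mul1r.
by apply/funext => z; rewrite mulN1r.
Qed.

Lemma n2B f g : L2 f -> L2 g -> n2 (fun z => f z - g z) <= 2 * n2 f + 2 * n2 g.
Proof.
move=> Lf Lg; rewrite -(n2N Lg); apply: n2D; first exact: Lf.
rewrite (_ : (fun z => _) = fun z => -1 * g z); first exact: L2Z.
by apply/funext => z; rewrite mulN1r.
Qed.

Lemma n2_rot f (j : 'I_n) (t : C) : nc t = 1 -> L2 f -> n2 (fun z => f (rot j t z)) = n2 f.
Proof. by move=> t1 [mf _]; rewrite /norm_sqr sq_norm_rot. Qed.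

Definition integrand f g z : C := f z * Num.conj (g z) * (weight h z)%:C.

Lemma integrand_bound f g t :
  nc (integrand f g (point_of t)) <= (dens h f t + dens h g t) / 2.
Proof.
rewrite /integrand !Normc.normcM ncR ger0_norm ?weight_ge0//.
have -> : nc (Num.conj (g (point_of t))) = nc (g (point_of t)).
  by case: (g _) => a b /=; rewrite sqrrN.
rewrite /dens -mulrDl [leRHS]mulrAC; apply: ler_wpM2r; first exact: weight_ge0.
rewrite ler_pdivlMr//; set a := nc _; set b := nc _.
by have := sqr_ge0 (a - b); rewrite sqrrB -mulr_natr; lra.
Qed.

Definition L1 F := leb.-integrable setT (EFin \o (fun t => complex.Re (F (point_of t)))) /\
  leb.-integrable setT (EFin \o (fun t => complex.Im (F (point_of t)))).

Lemma lmeas_integrand f g : lebesgue_measurable f -> lebesgue_measurable g ->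
  lebesgue_measurable (integrand f g).
Proof.
move=> mf mg; apply: (lmeasM (lmeasM mf (lmeas_conj mg))).
split; first exact: measurable_weight.
exact: measurable_cst.
Qed.

Lemma integrable_dens f : L2 f -> leb.-integrable setT (EFin \o dens h f).
Proof.
move=> [mf Nf]; apply: integrable_ge0; [exact: dens_ge0|exact: measurable_dens|exact: Nf].
Qed.

Lemma L1_integrand f g : L2 f -> L2 g -> L1 (integrand f g).
Proof.
move=> Lf Lg; have [mRe mIm] := lmeas_integrand Lf.1 Lg.1.
have i := integrable_mean (integrable_dens Lf) (integrable_dens Lg).
split.
  apply: (integrable_le mRe _ i) => t.
  by apply: le_trans (ncRe _) _; exact: integrand_bound.
apply: (integrable_le mIm _ i) => t.
by apply: le_trans (ncIm _) _; exact: integrand_bound.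
Qed.

Lemma integralCD F G : L1 F -> L1 G ->
  integralC (fun z => F z + G z) = integralC F + integralC G.
Proof.
move=> [F1 F2] [G1 G2]; rewrite /integralC; simpc.
rewrite -!RintegralD//; congr (_ +i* _); apply: eq_Rintegral => t _.
  by case: (F _) (G _) => [? ?] [].
by case: (F _) (G _) => [? ?] [].
Qed.

Lemma integralCZ (c : C) F : L1 F -> integralC (fun z => c * F z) = c * integralC F.
Proof.
case: c => a b [F1 F2]; rewrite /integralC; simpc.
rewrite -mulNr -(Rint_lin _ _ F1 F2) -(Rint_lin _ _ F2 F1).
congr (_ +i* _); apply: eq_Rintegral => t _; case: (F _) => x y /=; ring.
Qed.

Lemma innerDl f f' g : L2 f -> L2 f' -> L2 g ->
  inner h (fun z => f z + f' z) g = inner h f g + inner h f' g.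
Proof.
move=> Lf Lf' Lg; rewrite -[RHS]integralCD; [|exact: L1_integrand..].
by congr integralC; apply/funext => z; rewrite /integrand !mulrDl.
Qed.

Lemma innerZl (c : C) f g : L2 f -> L2 g ->
  inner h (fun z => c * f z) g = c * inner h f g.
Proof.
move=> Lf Lg; rewrite -[RHS]integralCZ; last exact: L1_integrand.
by congr integralC; apply/funext => z; rewrite /integrand !mulrA.
Qed.

Lemma inner_conj f g : L2 f -> L2 g -> inner h g f = Num.conj (inner h f g).
Proof.
move=> Lf Lg; have [i1 i2] := L1_integrand Lf Lg.
rewrite /inner /integralC; apply/eqP; rewrite eq_complex/=; apply/andP; split; apply/eqP.
  apply: eq_Rintegral => t _; case: (f _) (g _) => [a b] [a' b'] /=; ring.
rewrite -mulN1r -[RHS]addr0 -(mul0r (\int[leb]_t complex.Im (integrand f g (point_of t)))).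
rewrite -(Rint_lin _ _ i2 i2); apply: eq_Rintegral => t _; rewrite /integrand.
by case: (f _) (g _) => [a b] [a' b'] /=; ring.
Qed.

Lemma inner_self f : L2 f -> inner h f f = (n2 f)%:C.
Proof.
move=> Lf; apply/eqP; rewrite eq_complex/=; apply/andP; split; apply/eqP.
  congr fine; apply: eq_integral => t _; congr (_%:E).
  by rewrite /dens normc_sqr; case: (f _) => a b /=; ring.
rewrite -[RHS](_ : \int[leb]_t 0 = 0); last by rewrite Rintegral_cst// mul0r.
by apply: eq_Rintegral => t _; case: (f _) => a b /=; ring.
Qed.

Lemma inner_Re f g : L2 f -> L2 g -> `|complex.Re (inner h f g)| <= (n2 f + n2 g) / 2.
Proof.
move=> Lf Lg; have [i1 i2] := L1_integrand Lf Lg.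
apply: (Rint_mean (integrable_dens Lf) (integrable_dens Lg) i1) => t.
by apply: le_trans (ncRe _) _; exact: integrand_bound.
Qed.

Lemma inner_Im f g : L2 f -> L2 g -> `|complex.Im (inner h f g)| <= (n2 f + n2 g) / 2.
Proof.
move=> Lf Lg; have [i1 i2] := L1_integrand Lf Lg.
apply: (Rint_mean (integrable_dens Lf) (integrable_dens Lg) i2) => t.
by apply: le_trans (ncIm _) _; exact: integrand_bound.
Qed.

Lemma inner_le f g : L2 f -> L2 g -> nc (inner h f g) <= n2 f + n2 g.
Proof.
move=> Lf Lg; apply: le_trans (nc_le _) _.
by have := inner_Re Lf Lg; have := inner_Im Lf Lg; lra.
Qed.

(** The additive bound [inner_le] takes the place of Cauchy-Schwarz: multiplying [f] by [c] and [g]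
    by its inverse leaves the inner product unchanged, and [c] is chosen so that the share of [g] is
    at most [e / 2]. *)
Lemma inner_small g (e : R) : L2 g -> 0 < e -> exists2 d : R, 0 < d &
  forall f, L2 f -> n2 f <= d -> nc (inner h f g) <= e.
Proof.
move=> Lg e0; have g0 := n2_ge0 h g.
pose c := Num.sqrt ((n2 g + 1) * 2 / e).
have k0 : 0 < (n2 g + 1) * 2 / e by rewrite divr_gt0// mulr_gt0// ltr_wpDl.
have c0 : 0 < c by rewrite sqrtr_gt0.
have c2 : c ^+ 2 = (n2 g + 1) * 2 / e by rewrite sqr_sqrtr// ltW.
have nccE : nc c%:C = c by rewrite ncR gtr0_norm.
exists (e / 2 / c ^+ 2); first by rewrite !divr_gt0// exprn_gt0.
move=> f Lf nf.
have -> : inner h f g = inner h (fun z => c%:C * f z) (fun z => (c^-1)%:C * g z).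
  congr integralC; apply/funext => z.
  have cc : c%:C * (c^-1)%:C = 1 by rewrite -rmorphM/= divff ?gt_eqF.
  rewrite rmorphM/= (_ : Num.conj (c^-1)%:C = (c^-1)%:C); last by rewrite -[LHS]/(conjc _) conjc_real.
  by rewrite mulrACA cc mul1r.
apply: le_trans (inner_le (L2Z _ Lf) (L2Z _ Lg)) _.
rewrite (n2Z _ Lf) (n2Z _ Lg) nccE ncR gtr0_norm ?invr_gt0//.
rewrite [e]splitr; apply: lerD.
  by rewrite mulrC -ler_pdivlMr// exprn_gt0.
rewrite exprVn c2 invf_div mulrAC ler_pdivrMr; last by rewrite mulr_gt0// ltr_wpDl.
have -> : e / 2 * ((n2 g + 1) * 2) = e * (n2 g + 1) by field.
by rewrite ler_pM2l// lerDl.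
Qed.

Lemma inner_rot f g (j : 'I_n) (t : C) : nc t = 1 -> L2 f -> L2 g ->
  inner h (fun z => f (rot j t z)) (fun z => g (rot j t z)) = inner h f g.
Proof.
move=> t1 Lf Lg; have [mt Ht] := trot_preserving j t1.
have P := trot_preserving j t1.
have [mR mI] := lmeas_integrand Lf.1 Lg.1.
have [iR iI] := L1_integrand (L2_rot j t1 Lf) (L2_rot j t1 Lg).
have E x : integrand (fun z => f (rot j t z)) (fun z => g (rot j t z)) (point_of x) =
    integrand f g (point_of (trot j t x)).
  by rewrite point_of_trot /integrand weight_rot.
have EF (p : C -> R) : EFin \o (fun x => p (integrand (fun z => f (rot j t z))
      (fun z => g (rot j t z)) (point_of x))) =
    EFin \o ((fun x => p (integrand f g (point_of x))) \o trot j t).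
  by apply/funext => x /=; rewrite E.
rewrite (EF (@complex.Re R)) in iR; rewrite (EF (@complex.Im R)) in iI.
have innerE f' g' : inner h f' g' = (\int[leb]_x complex.Re (integrand f' g' (point_of x))) +i*
  (\int[leb]_x complex.Im (integrand f' g' (point_of x))) by [].
have KR := Rintegral_pushforward P mR iR.
have KI := Rintegral_pushforward P mI iI.
rewrite [LHS]innerE [RHS]innerE -KR -KI.
apply: (f_equal2 (@Complex R)).
  by apply: eq_Rintegral => x _; exact: (congr1 (@complex.Re R) (E x)).
by apply: eq_Rintegral => x _; exact: (congr1 (@complex.Im R) (E x)).
Qed.

Lemma inner_ae f f' g : lebesgue_measurable f -> lebesgue_measurable f' ->
  lebesgue_measurable g ->
  {ae leb, forall t, f (point_of t) = f' (point_of t)} -> inner h f g = inner h f' g.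
Proof.
move=> mf mf' mg ff.
have [a1 a2] := lmeas_integrand mf mg; have [b1 b2] := lmeas_integrand mf' mg.
rewrite /inner /integralC; congr (_ +i* _); apply: Rintegral_ae.
- exact: a1.
- exact: b1.
- by apply: filterS ff => t ft; rewrite ft.
- exact: a2.
- exact: b2.
- by apply: filterS ff => t ft; rewrite ft.
Qed.

End inner_product.

Lemma summable_tail (R : realType) (a : nat -> R) (M : R) :
  (forall k, 0 <= a k) -> (forall K, \sum_(k < K) a k <= M) ->
  forall e : R, 0 < e -> exists K0, forall K d, (K0 <= K)%N ->
    \sum_(K <= k < K + d) a k <= e.
Proof.
move=> a0 aM e e0; pose S := [set x | exists K, x = \sum_(k < K) a k].
have hS : has_sup S.
  split; first by exists (\sum_(k < 0) a k); exists 0%N.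
  by exists M => _ [K ->].
have [x [K0 xE] xS] := sup_adherent e0 hS.
exists K0 => K d K0K.
have mono m l : (m <= l)%N -> \sum_(k < m) a k <= \sum_(k < l) a k.
  move=> ml; rewrite -(big_mkord xpredT a) -(big_mkord xpredT a).
  by rewrite (big_cat_nat (n := m) (p := l))//= lerDl sumr_ge0.
have uS : \sum_(k < (K + d)%N) a k <= sup S.
  by apply: (ub_le_sup hS.2); exists (K + d)%N.
have E : \sum_(k < (K + d)%N) a k = \sum_(k < K) a k + \sum_(K <= k < K + d) a k.
  by rewrite -(big_mkord xpredT a) (big_cat_nat (n := K))//= ?leq_addr// big_mkord.
by have := mono _ _ K0K; move: uS; rewrite E; lra.
Qed.

Section Rint_sum.
Context d (T : measurableType d) (R : realType) (mu : {measure set T -> \bar R}).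

Lemma integrable_bigsum K (u : nat -> T -> R) : (forall k, mu.-integrable setT (EFin \o u k)) ->
  mu.-integrable setT (EFin \o (fun t => \sum_(k < K) u k t)).
Proof.
move=> iu; elim: K => [|K IH].
  rewrite (_ : _ \o _ = cst 0%E); first exact: integrable0.
  by apply/funext => t /=; rewrite big_ord0.
have := integrableD measurableT IH (iu K); congr (_.-integrable _ _).
by apply/funext => t /=; rewrite big_ord_recr.
Qed.

Lemma Rint_sum K (u : nat -> T -> R) : (forall k, mu.-integrable setT (EFin \o u k)) ->
  \int[mu]_t (\sum_(k < K) u k t) = \sum_(k < K) \int[mu]_t u k t.
Proof.
move=> iu; elim: K => [|K IH].
  rewrite big_ord0 -[RHS](mul0r (fine (mu setT))) -Rintegral_cst//.
  by apply: eq_Rintegral => t _; rewrite big_ord0.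
rewrite big_ord_recr/= -IH -RintegralD//; last exact: integrable_bigsum.
by apply: eq_Rintegral => t _; rewrite big_ord_recr.
Qed.

End Rint_sum.

Section definite.
Context (R : realType) (n : nat) (h : radial_weight R).
Local Notation C := R[i].
Local Notation E := 'cV[C]_n.
Local Notation leb := (@lebesgue R n).
Local Notation n2 := (norm_sqr h).
Local Notation L2 := (L2 h).
Local Notation mR := (measurableTypeR R).

(** If [u z != 0], continuity gives a box around [z] on which [u] has no zero, and boxes have
    positive measure. *)
Lemma ae_eq0_entire (u : E -> C) : entire u -> {ae leb, forall t, u (point_of t) = 0} ->
  forall z, u z = 0.
Proof.
move=> eu [A [mA A0 Au]] z; apply: contrapT => /eqP uz.
have k0 : 0 < nc (u z) by rewrite nc_gt0.
have [d d0 H] := entire_cont z eu k0.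
pose I (x : R) : set mR := `](x - d / 2)%R, (x + d / 2)%R[%classic.
have I0 x : (0 < lebesgue_measure (I x))%E.
  rewrite lebesgue_measure_itv/= lte_fin ifT; last by lra.
  by rewrite -EFinB lte_fin; lra.
have mI x : measurable (I x) by exact: measurable_itv.
pose B (i : 'I_n) : set (mR * mR) := I (complex.Re (z i ord0)) `*` I (complex.Im (z i ord0)).
have mB i : measurable (B i) by exact: measurableX.
have B0 i : (0 < plane_measure (B i))%E.
  rewrite /plane_measure [ltRHS](product_measure1E _ _ (mI _) (mI _)).
  by apply: mule_gt0; exact: I0.
have : (leb (box B) <= leb A)%E.
  apply: le_measure; rewrite ?inE.
  - exact: measurable_lebesgue_box.
  - exact: mA.
  apply: subset_trans Au => t Bt /= ut.
  have : nc (u (point_of t) - u z) < nc (u z).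
    apply: H; apply/en_lt => // i; rewrite !mxE.
    have [] := Bt i; rewrite /I/= !in_itv/= => h1 h2.
    apply: le_lt_trans (nc_le _) _; rewrite [d]splitr.
    have -> : complex.Re ((tnth t i).1 +i* (tnth t i).2 - z i ord0) =
        (tnth t i).1 - complex.Re (z i ord0) by case: (z i ord0).
    have -> : complex.Im ((tnth t i).1 +i* (tnth t i).2 - z i ord0) =
        (tnth t i).2 - complex.Im (z i ord0) by case: (z i ord0).
    by apply: ltrD; rewrite ltr_norml; lra.
  by rewrite ut sub0r ncN ltxx.
rewrite A0 leNgt; apply/negP/negPn; exact: lebesgue_box_gt0.
Qed.

Lemma n2_eq0 (u : E -> C) : entire u -> L2 u -> n2 u = 0 -> forall z, u z = 0.
Proof.
move=> eu Lu u0; apply: ae_eq0_entire => //.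
have mu := measurable_dens h Lu.1.
have : (\int[leb]_t `|(dens h u t)%:E| = 0)%E.
  rewrite -[RHS](_ : sq_norm h u = 0%E); last by rewrite (sq_normE Lu) u0.
  by apply: eq_integral => t _; rewrite gee0_abs// lee_fin dens_ge0.
move/(ae_eq_integral_abs leb measurableT mu).1.
apply: filterS => t /(_ I)[] /eqP; rewrite mulf_eq0 expf_eq0/= nc_eq0.
by rewrite (gt_eqF (expR_gt0 _)) orbF => /eqP.
Qed.

End definite.

Lemma cvg_bigsum (R : realType) K (u : nat -> nat -> R) (l : nat -> R) :
  (forall k, u N k @[N --> \oo] --> l k) ->
  \sum_(k < K) u N k @[N --> \oo] --> \sum_(k < K) l k.
Proof.
move=> ul; elim: K => [|K IH].
  by rewrite big_ord0; under eq_fun do rewrite big_ord0; exact: cvg_cst.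
by rewrite big_ord_recr/=; under eq_fun do rewrite big_ord_recr/=; exact: cvgD.
Qed.

(** * Homogeneous components in norm *)

Section norm_convergence.
Context (R : realType) (n : nat) (h : radial_weight R).
Local Notation C := R[i].
Local Notation E := 'cV[C]_n.
Local Notation leb := (@lebesgue R n).
Local Notation n2 := (norm_sqr h).
Local Notation L2 := (L2 h).
Implicit Types (f g F G : E -> C) (j : 'I_n).

(** The substitute for completeness: the limit is found pointwise and only its norm is estimated.
    Applied to tails of a series, it also gives convergence in norm. *)
Lemma n2_fatou (F : nat -> E -> C) f (c : R) : (forall K, L2 (F K)) -> ptlim F f ->
  (exists K0, forall K, (K0 <= K)%N -> n2 (F K) <= c) -> L2 f /\ n2 f <= c.
Proof.
move=> LF Ff [K0 Fc].
have Nf : (sq_norm h f <= c%:E)%E.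
  apply: (@sq_norm_fatou _ _ h F f c%:E K0 (fun K => (LF K).1) Ff) => K K0K.
  by rewrite (sq_normE (LF K)) lee_fin Fc.
have Lf : L2 f.
  split; first exact: (lmeas_lim (fun K => (LF K).1) Ff).
  by apply: le_lt_trans Nf _; rewrite ltry.
by split; [exact: Lf|rewrite -lee_fin -(sq_normE Lf)].
Qed.

Lemma innerDr f g g' : L2 f -> L2 g -> L2 g' ->
  inner h f (fun z => g z + g' z) = inner h f g + inner h f g'.
Proof.
move=> Lf Lg Lg'; rewrite (inner_conj (L2D Lg Lg') Lf) (innerDl Lg Lg' Lf) rmorphD/=.
by rewrite -(inner_conj Lg Lf) -(inner_conj Lg' Lf).
Qed.

Lemma innerZr (c : C) f g : L2 f -> L2 g ->
  inner h f (fun z => c * g z) = Num.conj c * inner h f g.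
Proof.
by move=> Lf Lg; rewrite (inner_conj (L2Z c Lg) Lf) (innerZl _ Lg Lf) rmorphM/= -(inner_conj Lg Lf).
Qed.

Lemma innerBl f f' g : L2 f -> L2 f' -> L2 g ->
  inner h (fun z => f z - f' z) g = inner h f g - inner h f' g.
Proof.
move=> Lf Lf' Lg; rewrite -mulN1r -(innerZl _ Lf' Lg) -(innerDl Lf (L2Z _ Lf') Lg).
by congr (inner h _ g); apply/funext => z; rewrite mulN1r.
Qed.

Lemma n2D_orth f g : L2 f -> L2 g -> inner h f g = 0 ->
  n2 (fun z => f z + g z) = n2 f + n2 g.
Proof.
move=> Lf Lg fg; apply: complexI.
rewrite -(inner_self (L2D Lf Lg)) (innerDl Lf Lg (L2D Lf Lg)) !innerDr//.
rewrite (inner_conj Lf Lg) fg rmorph0 addr0 add0r.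
by rewrite (inner_self Lf) (inner_self Lg) -rmorphD.
Qed.

Lemma inner_suml K (u : nat -> E -> C) g : (forall k, L2 (u k)) -> L2 g ->
  inner h (fun z => \sum_(k < K) u k z) g = \sum_(k < K) inner h (u k) g.
Proof.
move=> Lu Lg; elim: K => [|K IH].
  rewrite big_ord0 -[RHS](mul0r (inner h g g)) -(innerZl 0 Lg Lg).
  by congr (inner h _ g); apply/funext => z; rewrite big_ord0 mul0r.
have LS : L2 (fun z => \sum_(k < K) u k z) by apply: L2_sum => k _; exact: Lu.
rewrite big_ord_recr/= -IH -(innerDl LS (Lu K) Lg).
by congr (inner h _ g); apply/funext => z; rewrite big_ord_recr.
Qed.

(* Rotation by a root of unity of order greater than k and l preserves the inner
   product, but multiplies it by a nontrivial scalar. *)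
Lemma inner_orth j k l F G : L2 F -> L2 G -> k != l ->
  (forall s, nc s = 1 -> {ae leb, forall t, F (rot j s (point_of t)) = s ^+ k * F (point_of t)}) ->
  (forall s z, nc s = 1 -> G (rot j s z) = s ^+ l * G z) -> inner h F G = 0.
Proof.
move=> LF LG kl Fk Gl.
pose N := maxn k l; pose s := unity R N.
have s1 : nc s = 1 by have := nc_unity R N 1; rewrite expr1.
have LFr := L2_rot j s1 LF.
have E1 : inner h F G = s ^+ k * Num.conj (s ^+ l) * inner h F G.
  rewrite -{1}(inner_rot j s1 LF LG).
  have -> : (fun z => G (rot j s z)) = fun z => s ^+ l * G z.
    by apply/funext => z; exact: Gl.
  rewrite (innerZr _ LFr LG) (inner_ae h LFr.1 (L2Z (s ^+ k) LF).1 LG.1 (Fk s s1)).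
  by rewrite (innerZl _ LF LG) mulrA (mulrC (Num.conj _)).
apply/eqP; move/eqP: E1; rewrite -subr_eq0 -{1}(mul1r (inner h F G)) -mulrBl mulf_eq0.
case/orP => //; rewrite subr_eq0 => /eqP E1.
suff : k == l by rewrite (negPf kl).
have sl : s ^+ l * Num.conj (s ^+ l) = 1.
  have := sqr_normc (s ^+ l); rewrite nc_def ncX s1 expr1n => <-.
  by rewrite expr1n.
have : s ^+ k == s ^+ l.
  rewrite -[X in X == _]mulr1 -sl mulrCA -E1; by rewrite mulr1.
rewrite (eq_prim_root_expr (unityP R N)) !modn_small//.
  by rewrite ltnS leq_maxr.
by rewrite ltnS leq_maxl.
Qed.

Section components.
Variables (j : 'I_n) (f : E -> C).
Hypotheses (ef : entire f) (Lf : L2 f).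

Let u1 N i : nc (unity R N ^+ i) = 1 := nc_unity R N i.

Lemma L2_dcomp N k : L2 (dcomp j N k f).
Proof.
apply: L2Z; apply: L2_sum => i _; apply: L2Z; exact: L2_rot.
Qed.

(** [dft_parseval] integrated over the space; every rotated copy of [f] has the norm of [f], so
    their average does too. *)
Lemma dcomp_parseval N : \sum_(k < N.+1) n2 (dcomp j N k f) = n2 f.
Proof.
have iD k := integrable_dens (L2_dcomp N k).
have iR i := integrable_dens (L2_rot j (u1 N i) Lf).
rewrite -(@Rint_sum _ _ _ leb N.+1 (fun k => dens h (dcomp j N k f)) iD).
have -> : n2 f = N.+1%:R^-1 * \sum_(i < N.+1) n2 (fun z => f (rot j (unity R N ^+ i) z)).
  rewrite (eq_bigr (fun=> n2 f)); last by move=> i _; exact: n2_rot.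
  by rewrite sumr_const card_ord -[X in _ * X]mulr_natl mulrA mulVf ?mul1r// pnatr_eq0.
rewrite -(@Rint_sum _ _ _ leb N.+1 (fun i => dens h (fun z => f (rot j (unity R N ^+ i) z))) iR).
rewrite -RintegralZl//; last exact: (integrable_bigsum N.+1 iR).
apply: eq_Rintegral => t _; rewrite /dens -!mulr_suml mulrA; congr (_ * _).
exact: dft_parseval.
Qed.

Let dcomp_comp k : ptlim (fun N => dcomp j N k f) (comp j k f).
Proof. by move=> z e; exact: dcomp_cvg. Qed.

Lemma L2_comp k : L2 (comp j k f).
Proof.
have [] // := @n2_fatou _ _ (n2 f) (fun N => L2_dcomp N k) (dcomp_comp k).
exists k => N kN; rewrite -(dcomp_parseval N) (bigD1 (Ordinal (kN : (k < N.+1)%N)))//=.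
by rewrite lerDl sumr_ge0// => i _; exact: n2_ge0.
Qed.

(** Fatou's lemma is applied to the sum of the [K] densities at once; term by term it would only
    bound each component by [n2 f]. *)
Lemma comp_bessel K : \sum_(k < K) n2 (comp j k f) <= n2 f.
Proof.
have iC k := integrable_dens (L2_comp k).
have iD N k := integrable_dens (L2_dcomp N k).
rewrite -(@Rint_sum _ _ _ leb K (fun k => dens h (comp j k f)) iC).
(* The shift by [K] ensures that all degrees below [K] occur in the Parseval sum. *)
pose G N t := \sum_(k < K) dens h (dcomp j (N + K) k f) t.
have iG N : leb.-integrable setT (EFin \o G N) := integrable_bigsum K (iD (N + K)%N).
have Gb : (\int[leb]_t (\sum_(k < K) dens h (comp j k f) t)%:E <= (n2 f)%:E)%E.
  apply: (@int_fatou _ _ _ leb G).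
  - by move=> N; have /integrableP[] := iG N.
  - by move=> N t; apply: sumr_ge0 => k _; exact: dens_ge0.
  - move=> t.
    have H k : dens h (dcomp j (N + K)%N k f) t @[N --> \oo] --> dens h (comp j k f) t.
      rewrite (cvg_shiftn K (fun N => dens h (dcomp j N k f) t)).
      exact: dens_cvg (dcomp_comp k).
    exact: (@cvg_bigsum R K (fun N k => dens h (dcomp j (N + K)%N k f) t)
      (fun k => dens h (comp j k f) t) H).
  - move=> N; rewrite -[leLHS]fineK; last exact: integrable_fin_num (iG N).
    rewrite lee_fin -(dcomp_parseval (N + K)).
    have -> : fine (\int[leb]_t (G N t)%:E) = \sum_(k < K) n2 (dcomp j (N + K) k f).
      exact: (@Rint_sum _ _ _ leb K (fun k => dens h (dcomp j (N + K) k f)) (iD (N + K)%N)).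
    rewrite -(big_mkord xpredT (fun k => n2 (dcomp j (N + K) k f))).
    rewrite -[leRHS](big_mkord xpredT (fun k => n2 (dcomp j (N + K) k f))).
    rewrite (big_cat_nat (n := K) (p := (N + K).+1))//=; last by rewrite ltnW// ltnS leq_addl.
    by rewrite lerDl sumr_ge0// => k _; exact: n2_ge0.
rewrite -lee_fin; apply: le_trans Gb; rewrite -[leRHS]fineK//.
exact: integrable_fin_num (integrable_bigsum K iC).
Qed.

Lemma comp_orth k l : k != l -> inner h (comp j k f) (comp j l f) = 0.
Proof.
move=> kl; apply: (inner_orth (L2_comp k) (L2_comp l) kl).
  by move=> s _; apply: nearW => t; exact: comp_rot.
by move=> s z _; exact: comp_rot.
Qed.

Definition psum m K z := \sum_(m <= k < K) comp j k f z.

Lemma L2_psum m K : L2 (psum m K).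
Proof. by apply: L2_sum => k _; exact: L2_comp. Qed.

Lemma n2_psum m d : n2 (psum m (m + d)) = \sum_(m <= k < m + d) n2 (comp j k f).
Proof.
elim: d => [|d IH].
  rewrite addn0 big_geq// (_ : psum m m = fun z => 0 * f z).
    by rewrite (n2Z _ Lf) Normc.normc0 expr0n mul0r.
  by apply/funext => z; rewrite /psum big_geq// mul0r.
rewrite addnS big_nat_recr ?leq_addr//= -IH.
rewrite (_ : psum m (m + d).+1 = fun z => psum m (m + d) z + comp j (m + d) f z).
  apply: n2D_orth; [exact: L2_psum|exact: L2_comp|].
  rewrite (_ : psum m (m + d) = fun z => \sum_(k < d) comp j (k + m) f z).
    rewrite (@inner_suml d (fun k => comp j (k + m) f) _ (fun k => L2_comp _) (L2_comp _)).
    by apply: big1 => k _; apply: comp_orth; rewrite addnC eqn_add2l ltn_eqF.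
  by apply/funext => z; rewrite /psum -{1}[m]add0n big_addn addKn big_mkord.
by apply/funext => z; rewrite /psum big_nat_recr ?leq_addr.
Qed.

Lemma psum_cvg : ptlim (psum 0) f.
Proof.
move=> z e e0; have [K0 H] := comp_cvg j z ef e0; exists K0 => K /H.
by rewrite ncC /psum big_mkord.
Qed.

(** The remainder is the pointwise limit of the blocks [psum K (K + L)], whose squared norms are, by
    orthogonality, tails of the series in [comp_bessel]. *)
Lemma comp_norm_cvg (e : R) : 0 < e -> exists K0, forall K, (K0 <= K)%N ->
  n2 (fun z => f z - psum 0 K z) <= e.
Proof.
move=> e0.
have [K0 H] := summable_tail (fun k => n2_ge0 h (comp j k f)) comp_bessel e0.
exists K0 => K K0K.
have PL : ptlim (fun L => psum K (K + L)) (fun z => f z - psum 0 K z).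
  move=> z e' e'0; have [L0 HL] := psum_cvg z e'0; exists L0 => L L0L.
  have := HL (K + L)%N (leq_trans L0L (leq_addl _ _)).
  by rewrite /psum (big_cat_nat (n := K))//= ?leq_addr//; congr (nc _ <= _); ring.
have B : exists K1, forall L, (K1 <= L)%N -> n2 (psum K (K + L)) <= e.
  by exists 0%N => L _; rewrite n2_psum H.
have [_ Q] := n2_fatou (fun L => L2_psum K (K + L)) PL B; exact: Q.
Qed.

Lemma n2_psum_le K : n2 (psum 0 K) <= n2 f.
Proof. by have := n2_psum 0 K; rewrite add0n => ->; rewrite big_mkord comp_bessel. Qed.

End components.

End norm_convergence.

Lemma geo_series_cvg (R : realType) (a : nat -> R[i]) (B : R) :
  (forall k, nc (a k) <= B * 2^-1 ^+ k) -> exists l, forall e : R, 0 < e ->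
  exists K0, forall K, (K0 <= K)%N -> nc (\sum_(k < K) a k - l) <= e.
Proof.
move=> aB; pose u K := \sum_(k < K) a k.
have uB N d : nc (u (N + d)%N - u N) <= B * (2 * 2^-1 ^+ N).
  rewrite /u -(big_mkord xpredT a) (big_cat_nat (n := N))//= ?leq_addr//.
  rewrite big_mkord [X in nc X]addrAC subrr add0r; apply: le_trans (nc_sum _ _ _) _.
  apply: le_trans (_ : \sum_(N <= k < N + d) B * 2^-1 ^+ k <= _).
    by apply: ler_sum => k _; exact: aB.
  rewrite -mulr_sumr; apply: ler_wpM2l (geo_half R N d).
  by have := le_trans (nc_ge0 _) (aB 0%N); rewrite expr0 mulr1.
apply: (@complex_cauchy R u) => e e0.
have [N /(_ N (leqnn N)) HN] := half_pow_small (4 * B) e0.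
exists N => m k /subnKC <- /subnKC <-.
apply: le_trans (nc_triB _ (u N) _) _; rewrite (ncC (u N)).
by have := uB N (m - N)%N; have := uB N (k - N)%N; lra.
Qed.

(** * Projections of products with an invariant symbol *)

Section density.
Context (R : realType) (n : nat) (h : radial_weight R).
Local Notation C := R[i].
Local Notation E := 'cV[C]_n.
Local Notation leb := (@lebesgue R n).
Local Notation L2 := (L2 h).
Implicit Types (f g u F G : E -> C) (j : 'I_n) (k : 'I_n -> nat).

Lemma inner_comp_eq0 j F u : L2 F -> entire u -> L2 u ->
  (forall l, inner h F (comp j l u) = 0) -> inner h F u = 0.
Proof.
move=> LF eu Lu Fu; apply: nc_eps0 => e e0.
have [d d0 Hd] := inner_small LF e0.
have [K H] := comp_norm_cvg j eu Lu d0.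
have LS := L2_psum j eu Lu 0 K.
have LB := L2B Lu LS.
have psumE : psum j u 0 K = fun z => \sum_(l < K) comp j l u z.
  by apply/funext => z; rewrite /psum big_mkord.
have S0 : inner h (psum j u 0 K) F = 0.
  rewrite psumE (@inner_suml R n h K (fun l => comp j l u) F (L2_comp j eu Lu) LF).
  by apply: big1 => l _; rewrite (inner_conj LF (L2_comp j eu Lu l)) Fu rmorph0.
have E1 : inner h (fun z => u z - psum j u 0 K z) F = inner h u F.
  by rewrite (innerBl Lu LS LF) S0 subr0.
have := Hd _ LB (H K (leqnn K)); rewrite E1 (inner_conj LF Lu).
by rewrite [nc (Num.conj _)](_ : _ = nc (inner h F u))//; case: (inner h F u) => a b /=; rewrite sqrrN.
Qed.

(** The induction predicate of the descents. The degrees [k i] with [m <= i] are arbitrary, and no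
    condition is left at [m = 0]. *)
Definition low_pure m k f := forall i : 'I_n, (i < m)%N -> pure i (k i) f.

Lemma low_pure_comp (m : 'I_n) k l f : entire f -> low_pure m k f ->
  low_pure m.+1 (fun i => if i == m then l else k i) (comp m l f).
Proof.
move=> ef fk i; rewrite ltnS leq_eqVlt; case: (eqVneq i m) => [-> _|im].
  exact: comp_pure ef.
by rewrite val_eqE (negPf im)/= => /fk fi; exact: comp_pure_other ef fi.
Qed.

(** Components of [u] whose degree in some variable differs from [k] are orthogonal to [F] by
    [inner_orth]; what remains is homogeneous of degrees [k], hence a multiple of [f]. The
    homogeneity of [F] is only almost everywhere because [F] will involve the symbol. *)
Lemma weight_orth k F f : L2 F -> entire f -> L2 f -> (forall i, pure i (k i) f) ->
  f (const_mx 1) != 0 ->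
  (forall j s, nc s = 1 ->
     {ae leb, forall t, F (rot j s (point_of t)) = s ^+ k j * F (point_of t)}) ->
  inner h F f = 0 -> forall u, entire u -> L2 u -> inner h F u = 0.
Proof.
move=> LF ef Lf fk f1 Fk Ff.
suff H m : (m <= n)%N -> forall u, entire u -> L2 u -> low_pure (n - m) k u -> inner h F u = 0.
  move=> u eu Lu; apply: (H n (leqnn n) u eu Lu); rewrite subnn => i; by [].
elim: m => [_ u eu Lu|m IH mn u eu Lu uk].
  rewrite subn0 => uk.
  have -> : u = fun z => u (const_mx 1) / f (const_mx 1) * f z.
    apply/funext => z; rewrite (pure_eq1 z (fun i => uk i (ltn_ord i))) (pure_eq1 z fk).
    by rewrite mulrCA divfK.
  by rewrite (innerZr _ LF Lf) Ff mulr0.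
have jn : (n - m.+1 < n)%N by rewrite ltn_subrL/=; exact: leq_ltn_trans (leq0n m) mn.
pose j := Ordinal jn.
apply: (inner_comp_eq0 (j := j) LF eu Lu) => l.
have [lk|lk] := eqVneq (k j) l; last first.
  apply: (inner_orth LF (L2_comp j eu Lu l) lk (Fk j)) => s z _.
  exact: comp_rot.
apply: (IH (ltnW mn) _ (entire_comp j l eu) (L2_comp j eu Lu l)).
have := @low_pure_comp j k l u eu uk.
rewrite /= -subSn// subSS => H i im; have := H i im; case: eqP => // ->.
by rewrite lk.
Qed.

End density.

Section multiplication.
Context (R : realType) (n : nat) (h : radial_weight R).
Local Notation C := R[i].
Local Notation E := 'cV[C]_n.
Local Notation leb := (@lebesgue R n).
Local Notation n2 := (norm_sqr h).
Local Notation L2 := (L2 h).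
Implicit Types (f g u F G p : E -> C) (j : 'I_n) (k : 'I_n -> nat).

(** The content of [is_projection] for bare functions, so that limits can be tested before they are
    packed into [fock]. *)
Definition projects F p := [/\ entire p, L2 p &
  forall u, entire u -> L2 u -> inner h F u = inner h p u].

(** Testing against [p] itself gives [n2 p] as an inner product with [F]. The factor 1/2 in
    [inner_Re] is essential: it lets the term [n2 p / 2] be absorbed. *)
Lemma projects_n2 F p : L2 F -> projects F p -> n2 p <= n2 F.
Proof.
move=> LF [ep Lp Fp].
have := inner_Re LF Lp; rewrite (Fp p ep Lp) (inner_self Lp)/= ger0_norm ?n2_ge0//.
by lra.
Qed.

Lemma projectsD F G p q : L2 F -> L2 G -> projects F p -> projects G q ->
  projects (fun z => F z + G z) (fun z => p z + q z).
Proof.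
move=> LF LG [ep Lp Fp] [eq Lq Gq]; split; [exact: entireD ep eq|exact: L2D|].
by move=> u eu Lu; rewrite (innerDl LF LG Lu) (innerDl Lp Lq Lu) Fp// Gq.
Qed.

Lemma projectsZ (c : C) F p : L2 F -> projects F p ->
  projects (fun z => c * F z) (fun z => c * p z).
Proof.
move=> LF [ep Lp Fp]; split; [exact: entireZ ep|exact: L2Z|].
by move=> u eu Lu; rewrite (innerZl _ LF Lu) (innerZl _ Lp Lu) Fp.
Qed.

Lemma projects_sum m K (F p : nat -> E -> C) : (forall l, L2 (F l)) ->
  (forall l, projects (F l) (p l)) ->
  projects (fun z => \sum_(m <= l < K) F l z) (fun z => \sum_(m <= l < K) p l z).
Proof.
move=> LF Fp; split.
- rewrite (_ : (fun z => _) = \sum_(m <= l < K) p l).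
    by apply: entire_sum => l; have [] := Fp l.
  by apply/funext => z; rewrite fct_sumE.
- by apply: L2_sum => l _; have [] := Fp l.
- move=> u eu Lu; rewrite -[m]add0n.
  have sumE (w : nat -> E -> C) : (fun z => \sum_(0 + m <= l < K) w l z) =
      fun z => \sum_(l < K - m) w (l + m)%N z.
    by apply/funext => z; rewrite big_addn big_mkord.
  rewrite !sumE (@inner_suml R n h (K - m) (fun l => F (l + m)%N) u (fun l => LF _) Lu).
  have Lp l : L2 (p (l + m)%N) by have [] := Fp (l + m)%N.
  rewrite (@inner_suml R n h (K - m) (fun l => p (l + m)%N) u Lp Lu).
  by apply: eq_bigr => l _; have [_ _ ->] := Fp (l + m)%N.
Qed.

Variables (phi : E -> C) (M : R).
Hypotheses (mphi : lebesgue_measurable phi)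
  (phiM : {ae leb, forall t, nc (phi (point_of t)) <= M}).
Hypothesis phi_rot : forall j s, nc s = 1 ->
  {ae leb, forall t, phi (rot j s (point_of t)) = phi (point_of t)}.

Local Notation mult f := (fun z : E => phi z * f z).

Let c2 := `|M| ^+ 2.

Lemma L2_mult_n2 f : L2 f -> L2 (mult f) /\ n2 (mult f) <= c2 * n2 f.
Proof.
move=> Lf; have mf := lmeasM mphi Lf.1.
pose Mf z := `|M|%:C * f z; have LMf : L2 Mf := L2Z `|M|%:C Lf.
have le1 : (sq_norm h (mult f) <= sq_norm h Mf)%E.
  apply: (le_sq_norm h mf LMf.1); apply: filterS phiM => t phiMt.
  rewrite !Normc.normcM; apply: ler_wpM2r; first exact: nc_ge0.
  by rewrite ncR normr_id; apply: le_trans phiMt (ler_norm _).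
have Lm : L2 (mult f) by split; [exact: mf|exact: le_lt_trans le1 LMf.2].
split; first exact: Lm.
rewrite -lee_fin -(sq_normE Lm); apply: le_trans le1 _.
by rewrite (sq_normE LMf) (n2Z _ Lf) ncR normr_id.
Qed.

Let Lm f (Lf : L2 f) : L2 (mult f) := (L2_mult_n2 Lf).1.

(** For [f != 0] the candidate is the projection onto the line of [f]. The difference
    [phi * f - lam * f] has the torus weight of [f] and is orthogonal to [f], so [weight_orth]
    applies; [c2 + 1] comes from [inner_le]. *)
Lemma projection_monomial k f : entire f -> L2 f -> (forall i, pure i (k i) f) ->
  exists2 lam : C, nc lam <= c2 + 1 & projects (mult f) (fun z => lam * f z).
Proof.
move=> ef Lf fk; have n0 := n2_ge0 h f.
have c0 : 0 <= c2 by exact: sqr_ge0.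
have [f1|f1] := eqVneq (f (const_mx 1)) 0.
  exists 0; first by rewrite Normc.normc0 addr_ge0.
  have f0 : f = fun=> 0 by apply/funext => z; rewrite (pure_eq1 z fk) f1 mulr0.
  have -> : mult f = fun z => 0 * f z by apply/funext => z; rewrite f0 !mulr0.
  by split; [exact: entireZ ef|exact: L2Z|].
have f2 : n2 f != 0.
  by apply: contra_neq f1 => f0; exact: (n2_eq0 ef Lf f0).
have f20 : 0 < n2 f by rewrite lt_neqAle eq_sym f2.
pose lam := inner h (mult f) f / (n2 f)%:C.
exists lam.
  rewrite /lam Normc.normcM -rmorphV ?unitfE// ncR ger0_norm ?invr_ge0//.
  rewrite ler_pdivrMr//; apply: le_trans (inner_le (Lm Lf) Lf) _.
  by have := (L2_mult_n2 Lf).2; lra.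
have Ll := L2Z lam Lf; have Lmf := Lm Lf.
split; [exact: entireZ ef|exact: Ll|].
move=> u eu Lu; apply/eqP; rewrite -subr_eq0 -(innerBl Lmf Ll Lu); apply/eqP.
move: u eu Lu; apply: (weight_orth (L2B Lmf Ll) ef Lf fk f1).
  move=> j s s1; apply: filterS (phi_rot j s1) => t ->.
  by rewrite (fk j s) mulrBr; congr (_ - _); rewrite mulrCA.
rewrite (innerBl Lmf Ll Lf) (innerZl _ Lf Lf) (inner_self Lf) /lam divfK ?subrr//.
by rewrite eq_complex/= negb_and f2.
Qed.

(* The pointwise bound makes the series of the projections of the components of
   f converge locally uniformly, so that its sum is entire. *)
Definition good_projection (a c : R) f p := projects (mult f) p /\
  forall (z : E) (B : R),
      (forall w : E, (forall i, nc (w i ord0) <= a * nc (z i ord0)) -> nc (f w) <= B) ->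
    nc (p z) <= c * B.

(** The projection is the pointwise sum of the projections [q l] of the components. Cauchy's
    estimate at radius 2 doubles the polydisc and bounds the [l]-th component by
    [2 * B * 2^-1 ^+ l]; the geometric sum contributes another 2, hence [2 * a] and [4 * c]. *)
Lemma projection_step (m : 'I_n) k (a c : R) : 0 <= a -> 0 <= c ->
  (forall k' f, entire f -> L2 f -> low_pure m.+1 k' f -> exists p, good_projection a c f p) ->
  forall f, entire f -> L2 f -> low_pure m k f -> exists p, good_projection (2 * a) (4 * c) f p.
Proof.
move=> a0 c0 IH f ef Lf fk; pose j := m.
have ec l := entire_comp j l ef; have Lc := L2_comp j ef Lf.
have /choice[q qP] : forall l, exists p, good_projection a c (comp j l f) p.
  move=> l; apply: (IH _ _ (ec l) (Lc l)); exact: low_pure_comp ef fk.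
have qB (z : E) (B : R) :
    (forall w : E, (forall i, nc (w i ord0) <= 2 * a * nc (z i ord0)) -> nc (f w) <= B) ->
    forall l, nc (q l z) <= c * (2 * B) * 2^-1 ^+ l.
  move=> fB l; rewrite -mulrA; apply: (qP l).2 => w wz.
  apply: comp_bound ef _ => t t2; apply: fB => i; rewrite mxE Normc.normcM.
  rewrite -mulrA; apply: ler_pM; [exact: nc_ge0|exact: nc_ge0| |exact: wz].
  by case: ifP => _; rewrite ?t2// Normc.normc1 ler1n.
have fbd (z : E) : exists B : R,
    forall w : E, (forall i, nc (w i ord0) <= 2 * a * nc (z i ord0)) -> nc (f w) <= B.
  have [B HB] := entire_polydisc_bound (2 * a * en z) ef; exists B => w wz; apply: HB => i.
  by apply: le_trans (wz i) _; apply: ler_wpM2l (en_coord _ _); rewrite mulr_ge0.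
have /choice[p pP] : forall z, exists l : C, forall e : R, 0 < e ->
    exists K0, forall K, (K0 <= K)%N -> nc (\sum_(i < K) q i z - l) <= e.
  by move=> z; have [B /qB HB] := fbd z; exact: geo_series_cvg HB.
pose S m K z := \sum_(m <= l < K) q l z.
have Lmc l : L2 (mult (comp j l f)) by exact: Lm.
have multS m' K : (fun z => \sum_(m' <= l < K) (phi z * comp j l f z)) = mult (psum j f m' K).
  by apply/funext => z; rewrite /psum mulr_sumr.
have qP1 l : projects (mult (comp j l f)) (q l) by have [] := qP l.
have SP m' K : projects (mult (psum j f m' K)) (S m' K).
  by rewrite -multS; exact: (@projects_sum m' K (fun l => mult (comp j l f)) q Lmc qP1).
have Lps m' K : L2 (psum j f m' K) by exact: L2_psum.
have LS m' K : L2 (S m' K) by have [] := SP m' K.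
have Sp : ptlim (S 0%N) p.
  move=> z e /(pP z)[K0 H]; exists K0 => K /H; by rewrite /S big_mkord.
have Sn m' K : n2 (S m' K) <= c2 * n2 (psum j f m' K).
  by apply: le_trans (projects_n2 (Lm (Lps m' K)) (SP m' K)) _; exact: (L2_mult_n2 (Lps m' K)).2.
have SB (z : E) (B : R) :
    (forall w : E, (forall i, nc (w i ord0) <= 2 * a * nc (z i ord0)) -> nc (f w) <= B) ->
    forall K, nc (S 0%N K z) <= 4 * c * B.
  move=> fB K; have B0 : 0 <= B.
    apply: le_trans (nc_ge0 (f 0)) (fB _ _) => i.
    by rewrite mxE Normc.normc0 !mulr_ge0 ?nc_ge0.
  apply: le_trans (nc_sum _ _ _) _.
  apply: le_trans (_ : \sum_(0 <= l < K) c * (2 * B) * 2^-1 ^+ l <= _).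
    by apply: ler_sum => l _; exact: qB fB l.
  rewrite -mulr_sumr; have := geo_half R 0 K; rewrite add0n expr0 mulr1.
  move=> /(ler_wpM2l (_ : 0 <= c * (2 * B)))/le_trans; apply; first by rewrite !mulr_ge0.
  have -> : c * (2 * B) * 2 = 4 * c * B by ring.
  exact: lexx.
have [Lp _] : L2 p /\ n2 p <= c2 * n2 f.
  apply: (n2_fatou (LS 0%N) Sp); exists 0%N => K _.
  by apply: le_trans (Sn 0%N K) _; apply: ler_wpM2l (n2_psum_le j ef Lf K); exact: sqr_ge0.
exists p; split; last first.
  move=> z B fB; apply/ler_addgt0Pl => e /(Sp z)[K /(_ K (leqnn K)) H].
  have := nc_triB (p z) (S 0%N K z) 0; rewrite !subr0 => /le_trans; apply.
  by apply: lerD; [rewrite ncC|exact: SB fB K].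
have ep : entire p.
  apply: (@entire_lim R n (S 0%N) p _ Sp) => [K|r]; first by have [] := SP 0%N K.
  have [B HB] := entire_polydisc_bound (2 * a * r) ef; exists (4 * c * B) => K z zr.
  apply: SB => w wz; apply: HB => i; apply: le_trans (wz i) _.
  by apply: ler_wpM2l (zr i); rewrite mulr_ge0.
split; [exact: ep|exact: Lp|] => u eu Lu.
apply/eqP; rewrite -subr_eq0; apply/eqP/nc_eps0 => e e0.
have e2 : 0 < e / 2 by rewrite divr_gt0.
have [d d0 Hd] := inner_small Lu e2.
have k0 : 0 < c2 + 1 by rewrite ltr_wpDl// sqr_ge0.
(* Multiplication by [phi] costs a factor [c2]; the 4 pays for [n2B], since a block [psum j f K L]
   is a difference of two remainders. *)
have d4 : 0 < d / (c2 + 1) / 4 by rewrite !divr_gt0.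
have [K HK] := comp_norm_cvg j ef Lf d4.
have dK : c2 * (d / (c2 + 1)) <= d.
  by rewrite mulrCA ger_pMr// ler_pdivrMr// mul1r lerDl.
have LfK := L2B Lf (Lps 0%N K).
have LpK := L2B Lp (LS 0%N K).
(* The partial sums up to [K] match exactly by [SP], so only the two remainders are left to
   estimate. *)
have E1 : inner h (mult f) u - inner h p u =
    inner h (mult (fun z => f z - psum j f 0 K z)) u - inner h (fun z => p z - S 0%N K z) u.
  have -> : mult (fun z => f z - psum j f 0 K z) = fun z => phi z * f z - phi z * psum j f 0 K z.
    by apply/funext => z; rewrite mulrBr.
  rewrite (innerBl (Lm Lf) (Lm (Lps 0%N K)) Lu) (innerBl Lp (LS 0%N K) Lu).
  have [_ _ ->//] := SP 0%N K.
  set x := inner h (mult f) u; set y := inner h p u; set w := inner h _ u; ring.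
rewrite E1; apply: le_trans (ncB _ _) _; rewrite [e]splitr; apply: lerD; apply: Hd.
- exact: Lm.
- apply: le_trans (L2_mult_n2 LfK).2 _; apply: le_trans dK.
  apply: ler_wpM2l; first exact: sqr_ge0.
  apply: le_trans (HK K (leqnn K)) _; rewrite ler_pdivrMr//.
  by rewrite ler_peMr ?ler1n// ltW// divr_gt0.
- exact: LpK.
- have PL : ptlim (fun L => S K L) (fun z => p z - S 0%N K z).
    move=> z e' e'0; have [L0 HL] := Sp z e' e'0; exists (maxn L0 K) => L.
    rewrite geq_max => /andP[/HL {}HL KL].
    move: HL; rewrite /S (big_cat_nat (n := K))//= => HL.
    rewrite (_ : _ - _ = \sum_(0 <= l < K) q l z + \sum_(K <= l < L) q l z - p z)//.
    by rewrite /S; ring.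
  suff B : exists K1, forall L, (K1 <= L)%N -> n2 (S K L) <= d.
    by have [_] := n2_fatou (LS K) PL B.
  exists K => L KL; apply: le_trans (Sn K L) _; apply: le_trans dK.
  apply: ler_wpM2l; first exact: sqr_ge0.
  have -> : psum j f K L = fun z => (f z - psum j f 0 K z) - (f z - psum j f 0 L z).
    by apply/funext => z; rewrite /psum (big_cat_nat (m := 0) (n := K) (p := L))//=; ring.
  apply: le_trans (n2B LfK (L2B Lf (Lps 0%N L))) _.
  have := HK K (leqnn K); have := HK L KL.
  set x := n2 _; set y := n2 _; set w := d / (c2 + 1).
  by move=> xw yw; lra.
Qed.

Lemma projection_exists f : entire f -> L2 f -> exists p, projects (mult f) p.
Proof.
move=> ef Lf.
(* The constants come before [k] and [f] because the step uses the hypothesis for all components at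
   once, with the same constants. *)
suff H m : (m <= n)%N -> exists ac : R * R, [/\ 0 <= ac.1, 0 <= ac.2 &
    forall k f, entire f -> L2 f -> low_pure (n - m) k f -> exists p, good_projection ac.1 ac.2 f p].
  have [ac [_ _ H0]] := H n (leqnn n).
  have [i|p [pP _]] := H0 (fun=> 0%N) f ef Lf; last by exists p.
  by rewrite subnn.
elim: m => [_|m IH mn].
  exists (1, c2 + 1); split => //=; first by rewrite addr_ge0 ?sqr_ge0.
  move=> k g eg Lg; rewrite subn0 => gk.
  have [lam lamB P] := projection_monomial eg Lg (fun i => gk i (ltn_ord i)).
  exists (fun z => lam * g z); split; first exact: P.
  move=> z B gB; rewrite Normc.normcM; apply: ler_pM lamB _; [exact: nc_ge0|exact: nc_ge0|].
  by apply: gB => i; rewrite mul1r.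
have [[a c] [/= a0 c0 H]] := IH (ltnW mn).
exists (2 * a, 4 * c); split; [by rewrite mulr_ge0|by rewrite mulr_ge0|].
have jn : (n - m.+1 < n)%N by rewrite ltn_subrL/=; exact: leq_ltn_trans (leq0n m) mn.
move=> k g eg Lg gk; apply: (@projection_step (Ordinal jn) k a c a0 c0 _ g eg Lg gk) => k' f'.
by rewrite /= -subSn// subSS; exact: H.
Qed.

End multiplication.

(** * Operators commuting with the torus *)

Section fock_operators.
Context (R : realType) (n : nat) (h : radial_weight R).
Local Notation C := R[i].
Local Notation E := 'cV[C]_n.
Local Notation n2 := (norm_sqr h).
Local Notation L2 := (L2 h).
Local Notation fock := (fock n h).
Local Notation operator := (operator n h).
Implicit Types (f g u : fock) (j : 'I_n) (F : E -> C) (s t : C).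

Lemma fock_entire f : entire (val f).
Proof. by have := valP f; rewrite inE => -[]. Qed.

Lemma fock_L2 f : L2 (val f).
Proof. by have := valP f; rewrite inE => -[]. Qed.

Definition mk_fock F (eF : entire F) (LF : L2 F) : fock :=
  exist _ F (mem_set (conj eF LF : [set F | entire F /\ L2 F] F)).

Lemma valDE f g z : val (f + g) z = val f z + val g z.
Proof. by []. Qed.

Lemma valBE f g z : val (f - g) z = val f z - val g z.
Proof. by []. Qed.

Lemma valZE (c : C) f z : val (c *: f) z = c * val f z.
Proof. by []. Qed.

Lemma fock_ext f g : (forall z, val f z = val g z) -> f = g.
Proof. by move=> fg; apply: val_inj; apply/funext. Qed.

Lemma n2_fock_eq0 f : n2 (val f) = 0 -> f = 0.
Proof.
by move=> f0; apply: fock_ext => z; exact: (n2_eq0 (fock_entire f) (fock_L2 f) f0).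
Qed.

Lemma inner_fock_eq0 f : (forall u, inner h (val f) (val u) = 0) -> f = 0.
Proof.
move=> /(_ f); rewrite (inner_self (fock_L2 f)) => f0.
by apply: n2_fock_eq0; apply: complexI.
Qed.

Lemma n2_eps0 f : (forall e : R, 0 < e -> n2 (val f) <= e) -> f = 0.
Proof.
move=> H; apply: n2_fock_eq0; apply: le_anti; rewrite n2_ge0 andbT.
by apply/ler_addgt0Pl => e /H; rewrite addr0.
Qed.

Lemma nc_inv_unit t : nc t = 1 -> nc t^-1 = 1.
Proof.
move=> t1; have t0 : t != 0 by apply: contra_eq_neq t1 => ->; rewrite Normc.normc0 eq_sym oner_eq0.
by have := Normc.normcM t t^-1; rewrite mulfV// Normc.normc1 t1 mul1r.
Qed.

Lemma rotK j t z : nc t = 1 -> rot j t^-1 (rot j t z) = z.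
Proof.
move=> t1; have t0 : t != 0 by apply: contra_eq_neq t1 => ->; rewrite Normc.normc0 eq_sym oner_eq0.
by rewrite rotM mulVf// rot1.
Qed.

Definition rotf j t (t1 : nc t = 1) f : fock :=
  mk_fock (entire_rot j t (fock_entire f)) (L2_rot j t1 (fock_L2 f)).

Lemma rotfE j t (t1 : nc t = 1) f z : val (rotf j t1 f) z = val f (rot j t z).
Proof. by []. Qed.

Lemma n2_rotf j t (t1 : nc t = 1) f : n2 (val (rotf j t1 f)) = n2 (val f).
Proof. exact: (n2_rot j t1 (fock_L2 f)). Qed.

Lemma inner_rotf_r F j t (t1 : nc t = 1) f : L2 F ->
  inner h F (val (rotf j t1 f)) = inner h (fun z => F (rot j t^-1 z)) (val f).
Proof.
move=> LF.
rewrite -(inner_rot j t1 (L2_rot j (nc_inv_unit t1) LF) (fock_L2 f)).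
apply: (congr1 (fun G => inner h G _)).
by apply/funext => z; rewrite rotK.
Qed.

Definition rot_equivariant (A : operator) :=
  forall j t (t1 : nc t = 1) f, A (rotf j t1 f) = rotf j t1 (A f).

Lemma L2normE f : L2norm h (val f) = Num.sqrt (n2 (val f)).
Proof. by []. Qed.

Lemma bounded_n2 (A : operator) : bounded_operator A ->
  exists2 M : R, 0 <= M & forall f, n2 (val (A f)) <= M * n2 (val f).
Proof.
move=> [_ [M AM]]; exists (`|M| ^+ 2); first exact: sqr_ge0.
move=> f; have := AM f; rewrite !L2normE => H.
have {}H : Num.sqrt (n2 (val (A f))) <= `|M| * Num.sqrt (n2 (val f)).
  by apply: le_trans H _; apply: ler_wpM2r (ler_norm M); exact: sqrtr_ge0.
have : Num.sqrt (n2 (val (A f))) ^+ 2 <= (`|M| * Num.sqrt (n2 (val f))) ^+ 2.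
  by apply: lerXn2r H; rewrite nnegrE ?mulr_ge0 ?sqrtr_ge0.
by rewrite exprMn !sqr_sqrtr// n2_ge0.
Qed.

Lemma n2_bounded (A : operator) (M : R) : linear A -> 0 <= M ->
  (forall f, n2 (val (A f)) <= M * n2 (val f)) -> bounded_operator A.
Proof.
move=> lA M0 AM; split; first exact: lA.
exists (Num.sqrt M) => f; rewrite !L2normE -sqrtrM//; exact: ler_wsqrtr.
Qed.

Section linear_operator.
Variable A : operator.
Hypothesis lA : linear A.

Lemma opD f g : A (f + g) = A f + A g.
Proof. by have := lA 1 f g; rewrite !scale1r. Qed.

Lemma op0 : A 0 = 0.
Proof. by apply: (addrI (A 0)); rewrite -opD !addr0. Qed.

Lemma opZ (c : C) f : A (c *: f) = c *: A f.
Proof. by have := lA c f 0; rewrite op0 !addr0. Qed.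

Lemma opB f g : A (f - g) = A f - A g.
Proof. by rewrite addrC -scaleN1r lA scaleN1r addrC. Qed.

Lemma op_sum K (F : nat -> fock) : A (\sum_(l < K) F l) = \sum_(l < K) A (F l).
Proof.
by elim: K => [|K IH]; rewrite ?big_ord0 ?op0// !big_ord_recr/= opD IH.
Qed.

End linear_operator.

Lemma bounded0 : bounded_operator ((fun=> 0) : operator).
Proof.
apply: (@n2_bounded _ 0) => //.
  by move=> c f g; rewrite scaler0 addr0.
move=> f; rewrite mul0r; have -> : val (0 : fock) = fun z => 0 * val f z.
  by apply/funext => z; rewrite mul0r.
by rewrite (n2Z _ (fock_L2 f)) Normc.normc0 expr0n mul0r.
Qed.

Lemma boundedD (A B : operator) : bounded_operator A -> bounded_operator B ->
  bounded_operator (fun f => A f + B f).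
Proof.
move=> bA bB; have [MA MA0 HA] := bounded_n2 bA; have [MB MB0 HB] := bounded_n2 bB.
apply: (@n2_bounded _ (2 * MA + 2 * MB)).
- by move=> c f g; rewrite bA.1 bB.1 scalerDr addrACA.
- by rewrite addr_ge0// mulr_ge0.
- move=> f; apply: le_trans (n2D (fock_L2 (A f)) (fock_L2 (B f))) _.
  by have := HA f; have := HB f; lra.
Qed.

Lemma boundedZ (c : C) (A : operator) : bounded_operator A ->
  bounded_operator (fun f => c *: A f).
Proof.
move=> bA; have [M M0 HA] := bounded_n2 bA.
apply: (@n2_bounded _ (nc c ^+ 2 * M)).
- by move=> d f g; rewrite bA.1 scalerDr !scalerA mulrC.
- by rewrite mulr_ge0// sqr_ge0.
- move=> f; rewrite (n2Z c (fock_L2 (A f))) -[leRHS]mulrA.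
  exact: (ler_wpM2l (sqr_ge0 (nc c)) (HA f)).
Qed.

Lemma bounded_comp (A B : operator) : bounded_operator A -> bounded_operator B ->
  bounded_operator (A \o B).
Proof.
move=> bA bB; have [MA MA0 HA] := bounded_n2 bA; have [MB MB0 HB] := bounded_n2 bB.
apply: (@n2_bounded _ (MA * MB)).
- by move=> c f g; rewrite /= bB.1 bA.1.
- exact: mulr_ge0.
- move=> f; apply: le_trans (HA (B f)) _; rewrite -mulrA.
  exact: (ler_wpM2l MA0 (HB f)).
Qed.

Lemma boundedB (A B : operator) : bounded_operator A -> bounded_operator B ->
  bounded_operator (fun f => A f - B f).
Proof.
move=> bA bB; have := boundedD bA (boundedZ (-1) bB).
congr bounded_operator; apply/funext => f; exact: congr1 (scaleN1r _).
Qed.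

(** Dividing [f] by [1 + n2 f] instead of its norm also lands in the unit ball, and [f = 0] needs no
    separate case. *)
Lemma op_norm_small (D : operator) (e : R) : bounded_operator D -> op_norm D < e ->
  forall f, n2 (val (D f)) <= (e * (1 + n2 (val f))) ^+ 2.
Proof.
move=> bD De f; have f0 := n2_ge0 h (val f).
have c0 : 0 < 1 + n2 (val f) by rewrite ltr_wpDr.
set c := 1 + n2 (val f) in c0 *.
have nck : nc (c^-1)%:C = c^-1 by rewrite ncR gtr0_norm// invr_gt0.
pose g := (c^-1)%:C *: f.
have gn : n2 (val g) = c^-1 ^+ 2 * n2 (val f) by rewrite (n2Z _ (fock_L2 f)) nck.
have g1 : L2norm h (val g) <= 1.
  rewrite L2normE -[leRHS]sqrtr1; apply: ler_wsqrtr.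
  rewrite gn exprVn ler_pdivrMl ?exprn_gt0// mulr1.
  have : 0 <= n2 (val f) * n2 (val f) by rewrite mulr_ge0.
  by rewrite /c expr2; lra.
have [M M0 DM] := bounded_n2 bD.
have Dg : L2norm h (val (D g)) <= op_norm D.
  apply: ub_le_sup; last by exists g.
  exists (Num.sqrt M) => _ [u u1 <-]; rewrite L2normE; apply: ler_wsqrtr.
  apply: le_trans (DM u) _; rewrite -[leRHS]mulr1; apply: (ler_wpM2l M0).
  move: u1; rewrite /= L2normE => /(lerXn2r 2); rewrite !nnegrE sqrtr_ge0 ler01 => /(_ isT isT).
  by rewrite expr1n sqr_sqrtr// n2_ge0.
have {}Dg : L2norm h (val (D g)) <= e by exact: ltW (le_lt_trans Dg De).
have e0 : 0 <= e by apply: le_trans Dg; exact: sqrtr_ge0.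
have : n2 (val (D g)) <= e ^+ 2.
  move: Dg; rewrite L2normE => /(lerXn2r 2); rewrite !nnegrE sqrtr_ge0 e0 => /(_ isT isT).
  by rewrite sqr_sqrtr// n2_ge0.
have -> : D g = (c^-1)%:C *: D f by rewrite /g (opZ bD.1).
rewrite (n2Z _ (fock_L2 (D f))) nck exprVn ler_pdivrMl ?exprn_gt0//.
by rewrite exprMn mulrC.
Qed.

Definition equivariant_operators : set operator :=
  [set A | bounded_operator A /\ rot_equivariant A].

Lemma rotfD j t (t1 : nc t = 1) f g : rotf j t1 (f + g) = rotf j t1 f + rotf j t1 g.
Proof. exact: fock_ext. Qed.

Lemma rotfZ j t (t1 : nc t = 1) (c : C) f : rotf j t1 (c *: f) = c *: rotf j t1 f.
Proof. exact: fock_ext. Qed.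

(** The rotations are unitary: moved to the other argument, [t] becomes [t^-1], where it passes
    through [A]. *)
Lemma equivariant_adjoint (A B : operator) : rot_equivariant A ->
  is_adjoint A B -> rot_equivariant B.
Proof.
move=> eA AB j t t1 f; apply/eqP; rewrite -subr_eq0; apply/eqP/inner_fock_eq0 => u.
set v := rotf j t1 (B f).
have E1 : inner h (val u) (val (B (rotf j t1 f))) = inner h (val u) (val v).
  rewrite -AB (inner_rotf_r j t1 f (fock_L2 (A u))) (inner_rotf_r j t1 (B f) (fock_L2 u)).
  have t1' := nc_inv_unit t1.
  rewrite -[RHS](AB (rotf j t1' u) f) eA; exact: erefl.
rewrite (innerBl (fock_L2 (B (rotf j t1 f))) (fock_L2 v) (fock_L2 u)).
rewrite (inner_conj (fock_L2 u) (fock_L2 (B (rotf j t1 f)))).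
by rewrite (inner_conj (fock_L2 u) (fock_L2 v)) E1 subrr.
Qed.

Lemma equivariant_closed (A : operator) : bounded_operator A ->
  (forall e : R, 0 < e ->
     exists2 B, equivariant_operators B & op_norm (fun f => A f - B f) < e) ->
  rot_equivariant A.
Proof.
move=> bA AB j t t1 f; apply/eqP; rewrite -subr_eq0; apply/eqP/n2_eps0 => e e0.
have f0 := n2_ge0 h (val f).
(* Chosen so that [op_norm_small] yields [e / 4] for [D f] and for [D] at the rotated [f]; [n2B]
   turns this into [e]. *)
pose c := 2 * (1 + n2 (val f)); have c0 : 0 < c by rewrite mulr_gt0// ltr_wpDr.
have d0 : 0 < Num.sqrt e / c by rewrite divr_gt0// sqrtr_gt0.
have [B [bB eB] ABd] := AB _ d0.
have bD := boundedB bA bB; have Dd := op_norm_small bD ABd.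
pose D f := A f - B f.
have -> : A (rotf j t1 f) - rotf j t1 (A f) = D (rotf j t1 f) - rotf j t1 (D f).
  apply: fock_ext => z; rewrite !valBE !rotfE /D eB !valBE !rotfE.
  set x := val _ _; set y := val _ _; set w := val _ _; ring.
apply: le_trans (n2B (fock_L2 _) (fock_L2 _)) _; rewrite n2_rotf.
have := Dd (rotf j t1 f); have := Dd f; rewrite n2_rotf -/(D f) -/(D (rotf j t1 f)).
have -> : (Num.sqrt e / c * (1 + n2 (val f))) ^+ 2 = e / 4.
  have -> : Num.sqrt e / c * (1 + n2 (val f)) = Num.sqrt e / 2.
    by rewrite /c; field; rewrite gt_eqF// ltr_wpDr.
  by rewrite expr_div_n sqr_sqrtr ?ltW// -natrX.
by set x := n2 _; set y := n2 _; lra.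
Qed.

Lemma equivariant_Cstar : Cstar_subalgebra equivariant_operators.
Proof.
split.
- by move=> A [].
- split; first exact: bounded0.
  by move=> j t t1 f; exact: fock_ext.
- move=> A B [bA eA] [bB eB]; split; first exact: boundedD.
  by move=> j t t1 f; rewrite eA eB rotfD.
- move=> c A [bA eA]; split; first exact: boundedZ.
  by move=> j t t1 f; rewrite eA rotfZ.
- move=> A B [bA eA] [bB eB]; split; first exact: bounded_comp.
  by move=> j t t1 f; rewrite /= eB eA.
- by move=> A B [bA eA] bB AB; split; [exact: bB|exact: equivariant_adjoint eA AB].
- by move=> A bA AB; split; [exact: bA|exact: equivariant_closed bA AB].
Qed.

End fock_operators.

(** * Commutativity of the equivariant operators *)

Section commutativity.
Context (R : realType) (n : nat) (h : radial_weight R).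
Local Notation C := R[i].
Local Notation E := 'cV[C]_n.
Local Notation fock := (fock n h).
Local Notation operator := (operator n h).
Implicit Types (f g u : fock) (j : 'I_n) (F : E -> C) (s t : C) (k : 'I_n -> nat).

(** Equivariance gives homogeneity only for [nc s = 1]; [unit_pure] extends it to all [s]. *)
Lemma equivariant_pure (A : operator) j l f : linear A -> rot_equivariant A ->
  pure j l (val f) -> pure j l (val (A f)).
Proof.
move=> lA eA fl; apply: unit_pure (fock_entire (A f)) _ => s z s1.
rewrite -(rotfE j s1) -eA.
have -> : rotf j s1 f = s ^+ l *: f by apply: fock_ext => w; rewrite rotfE fl.
by rewrite (opZ lA).
Qed.

Lemma pure_eigenvector (A : operator) k f : linear A -> rot_equivariant A ->
  (forall i, pure i (k i) (val f)) -> val f (const_mx 1) != 0 ->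
  exists a : C, A f = a *: f.
Proof.
move=> lA eA fk f1; exists (val (A f) (const_mx 1) / val f (const_mx 1)).
apply: fock_ext => z; rewrite valZE.
rewrite (pure_eq1 z (fun i => equivariant_pure lA eA (fk i))) (pure_eq1 z fk).
by rewrite mulrCA divfK.
Qed.

Lemma pure_commute (A B : operator) k f : linear A -> rot_equivariant A ->
  linear B -> rot_equivariant B -> (forall i, pure i (k i) (val f)) -> A (B f) = B (A f).
Proof.
move=> lA eA lB eB fk; have [f1|f1] := eqVneq (val f (const_mx 1)) 0.
  have -> : f = 0 by apply: fock_ext => z; rewrite (pure_eq1 z fk) f1 mulr0.
  by rewrite !(op0 lA, op0 lB).
have [a Af] := pure_eigenvector lA eA fk f1; have [b Bf] := pure_eigenvector lB eB fk f1.
by rewrite Af Bf (opZ lA) (opZ lB) Af Bf !scalerA mulrC.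
Qed.

(** [D] kills the finite sums of components, which tend to [f] in norm, and [D] is bounded. *)
Lemma op_comp_eq0 (D : operator) j f : bounded_operator D ->
  (forall l (g : fock), val g = comp j l (val f) -> D g = 0) -> D f = 0.
Proof.
move=> bD Df; have [M M0 DM] := bounded_n2 bD.
have ef := fock_entire f; have Lf := fock_L2 f.
pose c l : fock := mk_fock (entire_comp j l ef) (L2_comp j ef Lf l).
apply: n2_eps0 => e e0.
have k0 : 0 < M + 1 by rewrite ltr_wpDl.
have [K /(_ K (leqnn K)) H] := comp_norm_cvg j ef Lf (divr_gt0 e0 k0).
pose S : fock := \sum_(l < K) c l.
have DS : D S = 0.
  rewrite /S (op_sum bD.1); apply: big1 => l _; exact: (Df l).
have vS : val (f - S) = fun z => val f z - psum j (val f) 0 K z.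
  apply/funext => z; rewrite valBE /S /psum big_mkord raddf_sum fct_sumE; exact: erefl.
have -> : D f = D (f - S) by rewrite (opB bD.1) DS subr0.
apply: le_trans (DM _) _; rewrite vS.
apply: le_trans (ler_wpM2l M0 H) _.
by rewrite mulrCA ger_pMr// ler_pdivrMr// mul1r lerDl.
Qed.

Lemma equivariant_commutative : commutative_algebra (@equivariant_operators R n h).
Proof.
move=> A B [bA eA] [bB eB]; apply/funext => f; apply/eqP; rewrite -subr_eq0; apply/eqP.
have bD := boundedB (bounded_comp bA bB) (bounded_comp bB bA).
set D := fun f => _ in bD.
(* [D] is the commutator; [m] counts the variables in which [f] need not be homogeneous. *)
suff H m : (m <= n)%N -> forall k f, low_pure (n - m) k (val f) -> D f = 0.
  by apply: (H n (leqnn n) (fun=> 0%N) f); rewrite subnn => i.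
elim: m => [_ k g|m IH mn k g gk].
  rewrite subn0 => gk; apply/eqP; rewrite subr_eq0; apply/eqP.
  exact: (pure_commute bA.1 eA bB.1 eB (fun i => gk i (ltn_ord i))).
have jn : (n - m.+1 < n)%N by rewrite ltn_subrL/=; exact: leq_ltn_trans (leq0n m) mn.
apply: (@op_comp_eq0 D (Ordinal jn) g bD) => l c cE.
have := @low_pure_comp R n (Ordinal jn) k l (val g) (fock_entire g) gk.
by rewrite -cE /= -subSn// subSS; exact: IH (ltnW mn) _ _.
Qed.

End commutativity.

(** * Toeplitz operators with invariant symbols *)

Section toeplitz.
Context (R : realType) (n : nat) (h : radial_weight R).
Local Notation C := R[i].
Local Notation E := 'cV[C]_n.
Local Notation leb := (@lebesgue R n).
Local Notation n2 := (norm_sqr h).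
Local Notation L2 := (L2 h).
Local Notation fock := (fock n h).
Implicit Types (f g u : fock) (j : 'I_n) (F : E -> C) (s t : C) (k : 'I_n -> nat).

Lemma projectsP F (p : fock) : L2 F -> projects h F (val p) <-> is_projection h F p.
Proof.
move=> LF; split.
  move=> [_ Lp Fp] u; rewrite (innerBl LF Lp (fock_L2 u)).
  by rewrite (Fp _ (fock_entire u) (fock_L2 u)) subrr.
move=> Fp; split; [exact: fock_entire|exact: fock_L2|] => u eu Lu.
apply/eqP; rewrite -subr_eq0 -(innerBl LF (fock_L2 p) Lu); apply/eqP.
exact: (Fp (mk_fock eu Lu)).
Qed.

Lemma projects_uniq F (p q : fock) : projects h F (val p) -> projects h F (val q) -> p = q.
Proof.
move=> [_ Lp Fp] [_ Lq Fq]; apply/eqP; rewrite -subr_eq0; apply/eqP/inner_fock_eq0 => u.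
have [eu Lu] := (fock_entire u, fock_L2 u).
by rewrite (innerBl Lp Lq Lu) -(Fp _ eu Lu) -(Fq _ eu Lu) subrr.
Qed.

Definition diag_rot j s : 'M[C]_n := diag_mx (\row_i (if i == j then s else 1)).

Lemma diag_rotM j s t : diag_rot j s *m diag_rot j t = diag_rot j (s * t).
Proof.
rewrite /diag_rot mulmx_diag; congr diag_mx; apply/rowP => i; rewrite !mxE.
by case: eqP => // _; rewrite mulr1.
Qed.

Lemma diag_rot1 j : diag_rot j 1 = 1%:M.
Proof.
rewrite -diag_const_mx /diag_rot; congr diag_mx; apply/rowP => i; rewrite !mxE.
by case: eqP.
Qed.

Lemma diag_rot_mul j s z : diag_rot j s *m z = rot j s z.
Proof. by rewrite mul_diag_mx; apply/colP => i; rewrite !mxE. Qed.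

Lemma diag_rot_unitary j s : nc s = 1 -> diag_rot j s \is unitarymx.
Proof.
move=> s1; apply/unitarymxP.
have sc : s * Num.conj s = 1.
  by have := sqr_normc s; rewrite nc_def s1 expr1n => <-.
rewrite -(diag_rot1 j) -sc -diag_rotM; congr (_ *m _).
apply/matrixP => i l; rewrite !mxE (eq_sym l i); case: (eqVneq i l) => [<-|_];
  rewrite ?mulr1n ?mulr0n ?rmorph0//.
by case: eqP => _; rewrite ?rmorph1.
Qed.

(** The group acts through inverse matrices, so invariance is used for [diag_rot j s^-1]. *)
Lemma invariant_symbol_rot (phi : E -> C) : invariant_symbol (unitary_group R n) phi ->
  forall j s, nc s = 1 -> {ae leb, forall x, phi (rot j s (point_of x)) = phi (point_of x)}.
Proof.
move=> Hphi j s s1; have s1' := nc_inv_unit s1.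
have s0 : s != 0 by apply: contra_eq_neq s1 => ->; rewrite Normc.normc0 eq_sym oner_eq0.
have UV : diag_rot j s^-1 *m diag_rot j s = 1%:M by rewrite diag_rotM mulVf// diag_rot1.
have -> : rot j s = mulmx (diag_rot j s) by apply/funext => z; rewrite diag_rot_mul.
have -> : diag_rot j s = invmx (diag_rot j s^-1).
  have [U1 _] := mulmx1_unit UV.
  by rewrite -[RHS]mulmx1 -UV mulKmx.
exact: Hphi (diag_rot_unitary j s1').
Qed.

Variable phi : E -> C.
Hypotheses (Lphi : Linfty phi) (phi_inv : invariant_symbol (unitary_group R n) phi).

Local Notation T := (toeplitz h phi).
Local Notation mult f := (fun z : E => phi z * val f z).

Let phi_rot := invariant_symbol_rot phi_inv.

Lemma toeplitz_bound : exists M : R, forall F, L2 F ->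
  L2 (fun z => phi z * F z) /\ n2 (fun z => phi z * F z) <= M ^+ 2 * n2 F.
Proof.
have [mphi [M phiM]] := Lphi; exists `|M| => F LF.
exact: (L2_mult_n2 mphi phiM LF).
Qed.

Lemma L2_mult f : L2 (mult f).
Proof. by have [M /(_ _ (fock_L2 f))[]] := toeplitz_bound. Qed.

(** This rules out the default value of [xget]; together with [projects_uniq] it characterises
    [T f]. *)
Lemma toeplitz_projects f : projects h (mult f) (val (T f)).
Proof.
have [mphi [M phiM]] := Lphi.
have [p pP] := projection_exists mphi phiM phi_rot (fock_entire f) (fock_L2 f).
have [ep Lp _] := pP.
have q := (projectsP (mk_fock ep Lp) (L2_mult f)).1 pP.
apply/(projectsP _ (L2_mult f)); rewrite /toeplitz /bergman_projection.
exact: (@xgetPex _ 0 (is_projection h (mult f)) (ex_intro _ _ q)).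
Qed.

Lemma toeplitz_bounded : bounded_operator T.
Proof.
have [M TM] := toeplitz_bound.
apply: (@n2_bounded _ _ _ _ (M ^+ 2)).
- move=> c f g; apply: projects_uniq (toeplitz_projects _) _.
  have := projectsD (L2Z c (L2_mult f)) (L2_mult g)
    (projectsZ c (L2_mult f) (toeplitz_projects f)) (toeplitz_projects g).
  rewrite (_ : (fun z => _) = mult (c *: f + g)) => [P|]; first exact: P.
  by apply/funext => z; rewrite valDE valZE mulrDr mulrCA.
- exact: sqr_ge0.
- move=> f; apply: le_trans (projects_n2 (L2_mult f) (toeplitz_projects f)) _.
  exact: (TM _ (fock_L2 f)).2.
Qed.

(** By uniqueness it is enough that the rotated [T f] projects the product of [phi] with the rotated
    [f]. That product agrees almost everywhere with the rotated [phi * f], and the rotation is then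
    moved to the test function. *)
Lemma toeplitz_equivariant : rot_equivariant T.
Proof.
move=> j t t1 f; apply: projects_uniq (toeplitz_projects _) _.
have [ep Lp Fp] := toeplitz_projects f.
have t1' := nc_inv_unit t1.
split; [exact: fock_entire|exact: fock_L2|] => u eu Lu.
pose v z := u (rot j t^-1 z).
have Lv : L2 v := L2_rot j t1' Lu.
have uE : u = fun z => v (rot j t z) by apply/funext => z; rewrite /v rotK.
have LR := L2_rot j t1 (L2_mult f).
have -> : inner h (mult (rotf j t1 f)) u = inner h (fun z => mult f (rot j t z)) u.
  apply: (inner_ae h (L2_mult (rotf j t1 f)).1 LR.1 Lu.1).
  by apply: filterS (phi_rot j t1) => x ->.
rewrite uE (inner_rot j t1 (L2_mult f) Lv) (Fp v (entire_rot j t^-1 eu) Lv).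
by rewrite -(inner_rot j t1 Lp Lv).
Qed.

End toeplitz.

Theorem proposition4p3 (R : realType) (n : nat) (h : radial_weight R) :
  (1 <= n)%N ->
  (forall m : nat,
    (\int[@lebesgue_measure R]_(r in `[0%R, +oo[)
       (r ^+ (2 * m + 2 * n - 1) * expR (- 2 * h r))%:E < +oo)%E) ->
  commutative_algebra (toeplitz_algebra h (unitary_group R n)).
Proof.
move=> _ _ A B XA XB.
have sub : toeplitz_algebra h (unitary_group R n) `<=` @equivariant_operators R n h.
  apply: smallest_sub; first exact: equivariant_Cstar.
  move=> _ [phi [Lphi phi_inv] <-].
  by split; [exact: toeplitz_bounded|exact: toeplitz_equivariant].
exact: equivariant_commutative (sub _ XA) (sub _ XB).
Qed.
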